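(* Let $\mathcal U_h=L^\infty(\Omega)$ (variational discretization). Let $\bar u\in\mathcal U_{ad}$ be a strict local minimum of $(P)$ with $\bar y:=S(\bar u)$, and let $\{(\bar y_h,\bar u_h)\}$ be the sequence of discrete solutions converging strongly to $(\bar y,\bar u)$ in $H^1_0(\Omega)\times L^2(\Omega)$ as $h\to0$. Assume that $\{\bar y=\bar t\}$ decomposes into finitely many connected components and that on each such connected component $\mathcal C$ either (1) $\nabla\bar y(x)\neq0$ for all $x\in\mathcal C$, or (2) $\nabla\bar y=0$ on $\mathcal C$ and there are constants $c_s,\epsilon_0,r_0>0$ with $\mathrm{meas}_{\mathbb R^2}(\{0<|\bar y-\bar t|<r\}\cap\mathcal C^{\epsilon_0})\le c_sr$ for all $r\in(0,r_0)$, where $\mathcal C^{\epsilon_0}:=\{x\in\overline\Omega:\mathrm{dist}(x,\mathcal C)<\epsilon_0\}$. Assume further that there exists $\bar\varphi\in W^{1,\bar p}_0(\Omega)\cap W^{1,\infty}(\Omega)$ such that $$-\mathrm{div}[(b+a(\bar y))\nabla\bar\varphi]+\mathbf 1_{\{\bar y\ne\bar t\}}a'(\bar y)\nabla\bar y\cdot\nabla\bar\varphi=\tfrac{\partial L}{\partial y}(\cdot,\bar y)\ \text{in }\Omega,\quad\bar\varphi=0\ \text{on }\partial\Omega,$$ $$\int_\Omega(\bar\varphi+\nu\bar u)(u-\bar u)\,dx\ge0\quad\text{for all }u\in\mathcal U_{ad},$$ and $Q(\bar u,\bar y,\bar\varphi;v)>0$ for all $v\in\mathcal C(\mathcal U_{ad};\bar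 u)\setminus\{0\}$. Then there exists a constant $C>0$ such that for all $h\in(0,\hat h)$, $$\|\bar u_h-\bar u\|_{L^2(\Omega)}\le C\Big(h^{1+\gamma}+\sigma_0^{1/2}\,\|\Sigma_{\kappa_h}(\bar y)\|_{L^1(\Omega)}^{1/2}\,h^{3/2}\Big)\le C h^{1+\gamma}$$ (the constant in the last bound being possibly different), where $\kappa_h:=C_\infty h+\|S(\bar u_h)-\bar y\|_{L^\infty(\Omega)}$.
   Context: Setting: $\Omega\subset\mathbb R^2$ is an open bounded convex polygonal domain. $b:\overline\Omega\to\mathbb R$ is Lipschitz continuous with $b\ge\underline b>0$. $a:\mathbb R\to[0,\infty)$ is given by $a(t)=a_0(t)$ for $t\le\bar t$ and $a(t)=a_1(t)$ for $t>\bar t$, where $\bar t\in\mathbb R$, $a_0\in C^2((-\infty,\bar t])$, $a_1\in C^2([\bar t,\infty))$, $a_0(\bar t)=a_1(\bar t)$. Its directional derivative is $a'(t;s)=a'(t)s$ for $t\ne\bar t$, and $a'(\bar t;s)=a_1'(\bar t)s$ for $s\geq0$, $a_0'(\bar t)s$ for $s<0$. $\mathbf 1_{\{y\neq\bar t\}}a'(y)$ and $\mathbf 1_{\{y\neq\bar t\}}a''(y)$ are $0$ on $\{y=\bar t\}$. $L:\Omega\times\mathbb R\to\mathbb R$ is a Carathéodory function of class $C^2$ in the second variable, $L(\cdot,0)\in L^1(\Omega)$, and for every $M>0$ there are $C_M>0$, $\psi_M\in L^{\bar p}(\Omega)$ ($\bar p>2$ fixed) with $|\partial_yL(x,y)|\le\psi_M(x)$,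 $|\partial_{yy}L(x,y)|\le C_M$ for $|y|\le M$, a.e. $x$. Constants $\alpha<\beta$, $\nu>0$. For $u\in L^2(\Omega)$, $S(u)=y_u$ is the unique weak solution of $-\mathrm{div}[(b+a(y_u))\nabla y_u]=u$ in $\Omega$, $y_u=0$ on $\partial\Omega$; $S$ is $C^1$ and $z_v=S'(u)v$ is the unique solution of $-\mathrm{div}[(b+a(y_u))\nabla z_v+\mathbf 1_{\{y_u\ne\bar t\}}a'(y_u)z_v\nabla y_u]=v$, $z_v|_{\partial\Omega}=0$. $p_*>2$ is a number (known to exist) such that $S$ maps bounded sets of $L^p(\Omega)$ into bounded sets of $W^{2,p}(\Omega)$ for $p\in[2,p_* )$. $\mathcal U_{ad}:=\{u\in L^\infty(\Omega):\alpha\le u\le\beta\text{ a.e.}\}$; $j(u):=\int_\Omega L(x,S(u)(x))dx+\frac\nu2\|u\|_{L^2}^2$; $(P)$ is $\min_{u\in\mathcal U_{ad}}j(u)$; $j'(u)v=\int_\Omega(\varphi_u+\nu u)v\,dx$ with $\varphi_u\in H^1_0(\Omega)$ solving $-\mathrm{div}[(b+a(y_u))\nabla\varphi_u]+\mathbf 1_{\{y_u\ne\bar t\}}a'(y_u)\nabla y_u\cdot\nabla\varphi_u=\partial_yL(\cdot,y_u)$. Critical cone: $\mathcal C(\mathcal U_{ad};\bar u):=\{v\in L^2(\Omega):v\ge0\text{ where }\bar u=\alpha,\ v\le0\text{ where }\bar u=\beta,\ v=0\text{ where }\bar\varphi+\nu\bar u\ne0,\text{ a.e. in }\Omega\}$.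 With $z_v=S'(\bar u)v$ and $\mathcal H^1$ the one-dimensional Hausdorff measure, $$Q(\bar u,\bar y,\bar\varphi;v)=\tfrac12\int_\Omega\partial_{yy}L(\cdot,\bar y)z_v^2dx+\tfrac\nu2\int_\Omega v^2dx-\tfrac12\int_\Omega\mathbf 1_{\{\bar y\ne\bar t\}}a''(\bar y)z_v^2\nabla\bar y\cdot\nabla\bar\varphi\,dx-\int_\Omega a'(\bar y;z_v)\nabla z_v\cdot\nabla\bar\varphi\,dx+\tfrac12[a_0'(\bar t)-a_1'(\bar t)]\int_{\{\bar y=\bar t\}}\mathbf 1_{\{|\nabla\bar y|>0\}}z_v^2\tfrac{\nabla\bar y\cdot\nabla\bar\varphi}{|\nabla\bar y|}d\mathcal H^1.$$ Finite elements: $\{\mathcal T_h\}_{h>0}$ is a family of triangulations of $\overline\Omega$, mesh size $h=\max_T\varrho(T)$, with $\varrho(T)/\delta(T)\le\bar\delta$, $h/\varrho(T)\le\bar\varrho$ for all $T,h$ and fixed $\bar\varrho,\bar\delta>0$ ($\varrho(T)$ = diameter of $T$, $\delta(T)$ = diameter of largest ball in $T$). $V_h$: continuous, affine on each $T\in\mathcal T_h$, zero on $\partial\Omega$. Discrete state equation: $y_h\in V_h$, $\int_\Omega(b+a(y_h))\nabla y_h\cdot\nabla v_hdx=\int_\Omega uv_hdx$ $\forall v_h\in V_h$. $\mathcal U_{ad,h}:=\mathcal U_{ad}\cap\mathcal U_h$ $(=\mathcal U_{ad}$ here$)$. Fixed constants: $\tilde p\ge4$; $h_1,\rho,\kappa_\rho>0$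 such that for $h<h_1$, $u\in\overline B_{L^2(\Omega)}(\bar u,\rho)$ the discrete state equation has a unique solution $S_h(u)$ in $\overline B_{W^{1,\tilde p}_0(\Omega)}(\bar y,\kappa_\rho)\cap V_h$, with $\|S(u)-S_h(u)\|_{L^2}+h\|S(u)-S_h(u)\|_{H^1_0}+h\|S(u)-S_h(u)\|_{L^\infty}\le C_\rho h^2$, $C_\rho$ independent of $u,h$; $h_2\in(0,h_1)$ such that for $h<h_2$ and $y_h\in\overline B_{W^{1,\tilde p}_0(\Omega)}(\bar y,\kappa_\rho)\cap V_h$ the discrete linearized operator $w_h\mapsto\big(z_h\mapsto\int_\Omega[(b+a(y_h))\nabla w_h+\mathbf 1_{\{y_h\ne\bar t\}}a'(y_h)w_h\nabla y_h]\cdot\nabla z_hdx\big)$ is an isomorphism $V_h\to V_h^*$. $C_\infty>0$ is a constant with $\|S(u)-S_h(u)\|_{L^\infty(\Omega)}\le C_\infty h$ for all $u\in\overline B_{L^2(\Omega)}(\bar u,\rho)\cap\mathcal U_{ad}$, $h\in(0,h_2)$. Exponents $\gamma,p_0,p_1$ with $p_0>2$, $p_1\in(2,p_* )$, $1-\frac2{p_0}\le\gamma<\min\{\frac1{p_0},1-\frac2{p_1}\}<\frac12$ (and $\gamma\in(0,\frac12)$). Notation: $\sigma_0:=|a_0'(\bar t)-a_1'(\bar t)|$; $Z_{y,\hat y}:=\mathbf 1_{\{y\ne\bar t\}}a'(y)\nabla y-\mathbf 1_{\{\hat y\ne\bar t\}}a'(\hat y)\nabla\hat y$; $V(y,r):=\sigma_0\sum_{m=1}^2\mathbf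 1_{\{0<|y-\bar t|\le r\}}|\partial_{x_m}y|$ and $\Sigma_r(y):=\frac1rV(y,r)$ for $r>0$; $\epsilon_h^u:=h^{1+\gamma}+h\|Z_{S(u),\bar y}\|_{L^2(\Omega)}+h\|V(S(u),\|S_h(u)-S(u)\|_{L^\infty(\Omega)})\|_{L^2(\Omega)}$. Discrete problems: $\bar\epsilon\in(0,\rho)$ is such that $j(\bar u)<j(u)$ for all $u\in\mathcal U_{ad}\cap\overline B_{L^2(\Omega)}(\bar u,\bar\epsilon)$, $u\ne\bar u$. $j_h(u):=\int_\Omega L(x,S_h(u)(x))dx+\frac\nu2\|u\|^2_{L^2}$ for $u\in\overline B_{L^2(\Omega)}(\bar u,\rho)$. The discrete problem $(P_h)$ is to minimize $\int_\Omega L(x,y_h)dx+\frac\nu2\|u_h\|_{L^2}^2$ over $u_h\in\mathcal U_{ad,h}$, $y_h\in V_h$ satisfying the discrete state equation with $u=u_h$. ''Discrete solutions $(\bar y_h,\bar u_h)$'' means (local) solutions of $(P_h)$ with $\bar u_h\in\mathcal U_{ad,h}\cap\overline B_{L^2(\Omega)}(\bar u,\bar\epsilon)$ and $\bar y_h=S_h(\bar u_h)$, i.e. for some $r_h>0$, $j_h(\bar u_h)\le j_h(u)$ for all $u\in\mathcal U_{ad,h}\cap\overline B_{L^2(\Omega)}(\bar u,\bar\epsilon)$ with $\|u-\bar u_h\|_{L^2}\le r_h$. $\hat h\in(0,h_2)$ is a fixed constant (known to exist under the hypotheses of the claim) for which there are $C>0$ and $\hat\epsilon\in(0,\bar\epsilon]$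 such that $\|\bar u_h-\bar u\|_{L^2}^2\le C[(\epsilon_h^{\bar u_h})^2+\|\bar u-u_h\|_{L^2}^2+j'(\bar u)(u_h-\bar u)]$ for all $h\in(0,\hat h)$ and $u_h\in\mathcal U_{ad,h}\cap\overline B_{L^2(\Omega)}(\bar u,\hat\epsilon)$. *)

(* Defs.v *)
From HB Require Import structures.
From mathcomp Require Import all_boot all_order all_algebra.
From mathcomp Require Import all_classical all_reals all_analysis.

Set Implicit Arguments.
Unset Strict Implicit.
Unset Printing Implicit Defensive.
Import Order.TTheory GRing.Theory Num.Theory.
Import numFieldNormedType.Exports.
Local Open Scope classical_set_scope.
Local Open Scope ring_scope.

(* Conventions.  Functions on Omega are total functions R * R -> R of which only
   the restriction to Omega matters, up to a.e. equality.  Coordinates are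
   indexed by bool (false: first, true: second).  Norms take values in \bar R. *)

(* R * R with its Borel sigma-algebra, as the library's measures expect it *)
Notation plane R := (measurableTypeR R * measurableTypeR R)%type.

Section Plane.
Context {R : realType}.
Implicit Types (x y : R * R) (A : set (R * R)).

Definition leb2 : {measure set (plane R) -> \bar R} :=
  (@lebesgue_measure R \x @lebesgue_measure R)%E.

(* The topology of R * R is the usual one, but its library norm is the sup norm;
   metric quantities below use the Euclidean distance. *)
Definition edist x y : R :=
  Num.sqrt ((x.1 - y.1) ^+ 2 + (x.2 - y.2) ^+ 2).

Definition evec (i : bool) : R * R := if i then (0, 1) else (1, 0).

Definition diam A : R := sup [set edist p.1 p.2 | p in A `*` A].

Definition inball_diam A : R :=
  sup [set d | exists c r,
    [/\ 0 <= r, [set y | edist c y <= r] `<=` A & d = 2 * r]].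

Definition hull (s : seq (R * R)) : set (R * R) :=
  [set x | exists l : nat -> R,
    [/\ forall i, 0 <= l i, \sum_(i < size s) l i = 1
      & x = \sum_(i < size s) l i *: nth 0 s i]].

Definition ediam A : \bar R :=
  ereal_sup ([set 0%E] `|` [set (edist p.1 p.2)%:E | p in A `*` A]).

(* One-dimensional Hausdorff (outer) measure; for dimension 1 the usual
   normalising constant is 1. *)
Definition hausdorff1_delta (d : R) A : \bar R :=
  ereal_inf [set (\sum_(0 <= n <oo) ediam (U n))%E | U in
    [set U : nat -> set (R * R) |
      A `<=` \bigcup_n U n /\ forall n, (ediam (U n) <= d%:E)%E]].

Definition hausdorff1 A : \bar R :=
  ereal_sup [set hausdorff1_delta d A | d in [set d : R | 0 < d]].

(* Bounded, nonempty finite intersection of open half-planes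
   {x | c.1.1 * x.1 + c.1.2 * x.2 < c.2}. *)
Definition convex_polygonal_domain A :=
  [/\ A !=set0, bounded_set A & exists s : seq (R * R * R),
    A = [set x | forall c, c \in s -> c.1.1 * x.1 + c.1.2 * x.2 < c.2]].

End Plane.

Section FunctionSpaces.
Context {R : realType} (Omega : set (R * R)).
Implicit Types (f g : R * R -> R) (p : \bar R) (i : bool).

Definition aeO (Q : R * R -> Prop) :=
  {ae @leb2 R, forall x, Omega x -> Q x}.

Definition intO f : R := \int[@leb2 R]_(x in Omega) f x.

Definition nL p f : \bar R := Lnorm (@leb2 R) p (EFin \o (f \_ Omega)).

Definition Lp p f := measurable_fun (Omega : set (plane R)) (f : plane R -> R) /\ (nL p f < +oo)%E.

Definition loc_integrable f :=
  measurable_fun (Omega : set (plane R)) (f : plane R -> R) /\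
  forall K, compact K -> K `<=` Omega -> (@leb2 R).-integrable K (EFin \o (f : plane R -> R)).

Definition iter_partial (s : seq bool) f : R * R -> R :=
  foldr (fun i g x => 'D_(evec i) g x) f s.

Definition smooth f := forall s : seq bool,
  continuous (iter_partial s f) /\
  forall i x, derivable (iter_partial s f) x (evec i).

Definition test_fun f :=
  smooth f /\ exists K, [/\ compact K, K `<=` Omega & forall x, ~ K x -> f x = 0].

Definition is_weak_partial i f g :=
  [/\ loc_integrable f, loc_integrable g & forall phi, test_fun phi ->
    intO (fun x => f x * 'D_(evec i) phi x) = - intO (fun x => g x * phi x)].

Definition wd i f : R * R -> R := xget (cst 0) [set g | is_weak_partial i f g].

Definition gdot f g x : R := \sum_(i : bool) wd i f x * wd i g x.

Definition W1 p f :=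
  Lp p f /\ forall i, exists g, is_weak_partial i f g /\ Lp p g.

Definition nW1 p f : \bar R := (nL p f + \sum_(i : bool) nL p (wd i f))%E.

Definition W2 p f := W1 p f /\ forall i, W1 p (wd i f).

Definition nW2 p f : \bar R :=
  (nW1 p f + \sum_(i : bool) \sum_(k : bool) nL p (wd k (wd i f)))%E.

Definition W10 p f := W1 p f /\ forall e : R, 0 < e ->
  exists phi, test_fun phi /\ (nW1 p (f \- phi)%R < e%:E)%E.

Definition H10 := W10 2%:E.

(* The representative of the class of f that is continuous on the closure of
   Omega (unique there); all pointwise statements (level sets, line integrals)
   refer to it. *)
Definition crep f : R * R -> R := xget (cst 0)
  [set g | {within closure Omega, continuous g} /\ aeO (fun x => g x = f x)].

Definition cgrad f i : R * R -> R := crep (wd i f).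

Definition cgradn f x : R := Num.sqrt (\sum_(i : bool) cgrad f i x ^+ 2).

End FunctionSpaces.

Section OneSided.
Context {R : realType}.
Implicit Types (D : set R) (f : R -> R).

Definition dquot f x y : R := (f y - f x) / (y - x).

(* Derivative relative to D; one-sided at an end point of D. *)
Definition dwithin D f x : R := lim (dquot f x y @[y --> within D x^']).

Definition C2_on D f :=
  [/\ forall x, D x -> cvg (dquot f x y @[y --> within D x^']),
      forall x, D x -> cvg (dquot (dwithin D f) x y @[y --> within D x^'])
    & {within D, continuous (dwithin D (dwithin D f))}].

End OneSided.

Record problem (R : realType) := Problem {
  dom : set (R * R);
  bco : R * R -> R;
  tbar : R;
  a0 : R -> R;
  a1 : R -> R;
  Lag : R * R -> R -> R;
  pbar : R;
  alpha : R;
  beta : R;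
  nu : R }.

Section Problem.
Context {R : realType} (P : problem R).
Implicit Types (u v w y z phi : R * R -> R).
Local Notation Omega := (dom P).
Local Notation tb := (tbar P).

Definition left_part : set R := [set t | t <= tb].
Definition right_part : set R := [set t | tb <= t].

Definition aco t : R := if t <= tb then a0 P t else a1 P t.

Definition da0 : R -> R := dwithin left_part (a0 P).
Definition da1 : R -> R := dwithin right_part (a1 P).

(* 1_{t <> tbar} a'(t) and 1_{t <> tbar} a''(t) *)
Definition da t : R :=
  if t < tb then da0 t else if tb < t then da1 t else 0.
Definition dda t : R :=
  if t < tb then dwithin left_part da0 t
  else if tb < t then dwithin right_part da1 t else 0.

Definition adir t s : R :=
  if t == tb then (if 0 <= s then da1 tb * s else da0 tb * s) else da t * s.

Definition sigma0 : R := `|da0 tb - da1 tb|.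

Definition dyL x t : R := derive1 (Lag P x) t.
Definition dyyL x t : R := derive1 (derive1 (Lag P x)) t.

Record standing_assumptions : Prop := {
  sa_dom : convex_polygonal_domain Omega;
  sa_b_lip : exists K : R, forall x x' : R * R,
    closure Omega x -> closure Omega x' ->
    `|bco P x - bco P x'| <= K * edist x x';
  sa_b_pos : exists2 c : R, 0 < c & forall x, closure Omega x -> c <= bco P x;
  sa_a0 : C2_on left_part (a0 P);
  sa_a1 : C2_on right_part (a1 P);
  sa_a01 : a0 P tb = a1 P tb;
  sa_a_ge0 : forall t, 0 <= aco t;
  sa_L_meas : forall t, measurable_fun (Omega : set (plane R)) (fun x : plane R => Lag P x t);
  sa_L_C2 : aeO Omega (fun x => [/\ forall t, derivable (Lag P x) t 1,
    forall t, derivable (dyL x : R -> R) t 1 & continuous (dyyL x : R -> R)]);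
  sa_L0 : Lp Omega 1%E (fun x => Lag P x 0);
  sa_L_bound : forall M : R, 0 < M -> exists (C : R) (psi : R * R -> R),
    [/\ 0 < C, Lp Omega (pbar P)%:E psi & aeO Omega (fun x => forall t,
      `|t| <= M -> `|dyL x t| <= psi x /\ `|dyyL x t| <= C)];
  sa_pbar : 2 < pbar P;
  sa_alpha_beta : alpha P < beta P;
  sa_nu : 0 < nu P }.

Definition L2 := Lp Omega 2%:E.
Definition n2 := nL Omega 2%:E.
Definition noo := nL Omega +oo%E.

(* Since a may grow arbitrarily, weak solutions are taken in H^1_0 /\ L^oo. *)
Definition weak_sol u y :=
  [/\ H10 Omega y, Lp Omega +oo%E y & forall w, H10 Omega w ->
    intO Omega (fun x => (bco P x + aco (y x)) * gdot Omega y w x)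
    = intO Omega (fun x => u x * w x)].

Definition S u : R * R -> R := xget (cst 0) [set y | weak_sol u y].

Definition lin_form y z w : R :=
  intO Omega (fun x => (bco P x + aco (y x)) * gdot Omega z w x
                       + da (y x) * z x * gdot Omega y w x).

Definition lin_sol u v z := H10 Omega z /\ forall w, H10 Omega w ->
  lin_form (S u) z w = intO Omega (fun x => v x * w x).

Definition dS u v : R * R -> R := xget (cst 0) [set z | lin_sol u v z].

Definition nY y : \bar R := (nW1 Omega 2%:E y + noo y)%E.

(* S is well defined, and is of class C^1 from L^2 to H^1_0 /\ L^oo with
   derivative dS. *)
Record control_to_state : Prop := {
  cs_sol : forall u, L2 u -> weak_sol u (S u);
  cs_uniq : forall u y, L2 u -> weak_sol u y -> aeO Omega (fun x => y x = S u x);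
  cs_lin_sol : forall u v, L2 u -> L2 v -> lin_sol u v (dS u v);
  cs_lin_uniq : forall u v z, L2 u -> L2 v -> lin_sol u v z ->
    aeO Omega (fun x => z x = dS u v x);
  cs_dS_bounded : forall u, L2 u -> exists K : R,
    forall v, L2 v -> (nY (dS u v) <= K%:E * n2 v)%E;
  cs_frechet : forall u, L2 u -> forall e : R, 0 < e -> exists2 d : R, 0 < d &
    forall v, L2 v -> (n2 v <= d%:E)%E ->
      (nY ((S (u \+ v) \- S u) \- dS u v)%R <= e%:E * n2 v)%E;
  cs_dS_cont : forall u, L2 u -> forall e : R, 0 < e -> exists2 d : R, 0 < d &
    forall w, L2 w -> (n2 w <= d%:E)%E -> forall v, L2 v ->
      (nY (dS (u \+ w)%R v \- dS u v)%R <= e%:E * n2 v)%E }.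

Definition W2_regularity (ps : R) := forall p : R, 2 <= p < ps ->
  forall M : R, exists K : R, forall u, Lp Omega p%:E u ->
    (nL Omega p%:E u <= M%:E)%E ->
    W2 Omega p%:E (S u) /\ (nW2 Omega p%:E (S u) <= K%:E)%E.

Definition Uad u :=
  Lp Omega +oo%E u /\ aeO Omega (fun x => alpha P <= u x <= beta P).

Definition cost y u : R :=
  intO Omega (fun x => Lag P x (y x)) + nu P / 2 * intO Omega (fun x => u x ^+ 2).

Definition j u : R := cost (S u) u.

Definition adjoint_eq y phi := forall w, H10 Omega w ->
  intO Omega (fun x => (bco P x + aco (y x)) * gdot Omega phi w x
                       + da (y x) * gdot Omega y phi x * w x)
  = intO Omega (fun x => dyL x (y x) * w x).

Definition adj u : R * R -> R :=
  xget (cst 0) [set phi | H10 Omega phi /\ adjoint_eq (S u) phi].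

Definition dj u v : R := intO Omega (fun x => (adj u x + nu P * u x) * v x).

Definition crit_cone ub phi v := L2 v /\ aeO Omega (fun x =>
  [/\ ub x = alpha P -> 0 <= v x, ub x = beta P -> v x <= 0
    & phi x + nu P * ub x != 0 -> v x = 0]).

Definition level_set y : set (R * R) :=
  [set x | closure Omega x /\ crep Omega y x = tb].

Definition Q ub yb phi v : R :=
  let z := dS ub v in
  2^-1 * intO Omega (fun x => dyyL x (yb x) * z x ^+ 2)
  + nu P / 2 * intO Omega (fun x => v x ^+ 2)
  - 2^-1 * intO Omega (fun x => dda (yb x) * z x ^+ 2 * gdot Omega yb phi x)
  - intO Omega (fun x => adir (yb x) (z x) * gdot Omega z phi x)
  + 2^-1 * (da0 tb - da1 tb) *
    fine (\int[(@hausdorff1 R : set (plane R) -> \bar R)]_(x in level_set yb)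
      (if 0 < cgradn Omega yb x then
         crep Omega z x ^+ 2
         * (\sum_(i : bool) cgrad Omega yb i x * cgrad Omega phi i x)
         / cgradn Omega yb x
       else 0)%:E)%E.

(* C^eps for the connected component C of the level set *)
Definition nbhd (C : set (R * R)) (e : R) : set (R * R) :=
  [set x | closure Omega x /\ exists2 c, C c & edist x c < e].

Definition component_condition y (C : set (R * R)) :=
  (forall x, C x -> exists i, cgrad Omega y i x != 0) \/
  ((forall x, C x -> forall i, cgrad Omega y i x = 0) /\
   exists cs e0 r0 : R, [/\ 0 < cs, 0 < e0, 0 < r0 & forall r, 0 < r < r0 ->
     (leb2 ([set x | (0 < `|crep Omega y x - tb| < r)%R] `&` nbhd C e0)
      <= (cs * r)%:E)%E]).

Definition level_set_condition y :=
  finite_set [set connected_component (level_set y) x | x in level_set y] /\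
  forall x, level_set y x ->
    component_condition y (connected_component (level_set y) x).

Definition Znorm y yh : \bar R := n2 (fun x => Num.sqrt (\sum_(i : bool)
  (da (y x) * wd Omega i y x - da (yh x) * wd Omega i yh x) ^+ 2)).

Definition V y (r : R) x : R := sigma0 * \sum_(i : bool)
  (if 0 < `|y x - tb| <= r then `|wd Omega i y x| else 0).

Definition Sigma (r : R) y x : R := r^-1 * V y r x.

Definition triangle : Type := (R * R) * (R * R) * (R * R).

Definition vertices (T : triangle) : seq (R * R) := [:: T.1.1; T.1.2; T.2].

Definition tri (T : triangle) : set (R * R) := hull (vertices T).

Definition nondegenerate (T : triangle) :=
  let p := T.1.2 - T.1.1 in let q := T.2 - T.1.1 in
  p.1 * q.2 - p.2 * q.1 != 0.

(* Conformity: two triangles meet exactly in the hull of their common vertices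
   (nothing, a vertex, an edge, or the whole triangle). *)
Definition triangulation (Th : seq triangle) :=
  [/\ forall T, T \in Th -> nondegenerate T,
      closure Omega = [set x | exists2 T, T \in Th & tri T x]
    & forall T T', T \in Th -> T' \in Th ->
        tri T `&` tri T' = hull [seq p <- vertices T | p \in vertices T']].

(* A mesh size h = max_T diam T cannot exceed diam Omega, so the family is
   indexed by a set Hs of positive mesh sizes accumulating at 0. *)
Definition mesh_family (Hs : set R) (Th : R -> seq triangle) (db rb : R) :=
  [/\ 0 < db, 0 < rb, (forall h, Hs h -> 0 < h), closure Hs 0
    & forall h, Hs h -> [/\ triangulation (Th h),
      (forall T, T \in Th h -> diam (tri T) <= h),
      (exists2 T, T \in Th h & diam (tri T) = h)
      & forall T, T \in Th h -> diam (tri T) / inball_diam (tri T) <= db /\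
                                h / diam (tri T) <= rb]].

(* Elements of V_h are extended by zero outside Omega, which makes equality of
   functions on R * R the right equality. *)
Definition Vh (Th : seq triangle) y :=
  [/\ {within closure Omega, continuous y}, (forall x, ~ Omega x -> y x = 0)
    & forall T, T \in Th -> exists c0 c1 c2 : R,
        forall x, tri T x -> y x = c0 + c1 * x.1 + c2 * x.2].

Definition disc_state_eq (Th : seq triangle) u y :=
  forall w, Vh Th w ->
    intO Omega (fun x => (bco P x + aco (y x)) * gdot Omega y w x)
    = intO Omega (fun x => u x * w x).

Definition Vh_ball (Th : seq triangle) yb (pt kap : R) y :=
  Vh Th y /\ (nW1 Omega pt%:E (y \- yb)%R <= kap%:E)%E.

Definition disc_state (Th : seq triangle) yb (pt kap : R) u y :=
  Vh_ball Th yb pt kap y /\ disc_state_eq Th u y.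

(* S_h(u) *)
Definition Sh (Th : seq triangle) yb (pt kap : R) u : R * R -> R :=
  xget (cst 0) [set y | disc_state Th yb pt kap u y].

Definition Vh_linear (Th : seq triangle) (l : (R * R -> R) -> R) :=
  forall (c : R) w z, Vh Th w -> Vh Th z ->
    l (fun x => c * w x + z x) = c * l w + l z.

(* Since V_h is finite-dimensional, an isomorphism V_h -> V_h^* is a linear
   bijection. *)
Definition lin_iso (Th : seq triangle) y :=
  forall l, Vh_linear Th l ->
    exists! w, Vh Th w /\ forall z, Vh Th z -> lin_form y w z = l z.

Definition L2ball uc (r : R) u := L2 u /\ (n2 (u \- uc)%R <= r%:E)%E.

Definition strict_local_min ub (e : R) :=
  Uad ub /\ forall u, Uad u -> L2ball ub e u ->
    ~ aeO Omega (fun x => u x = ub x) -> j ub < j u.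

(* variational discretization: U_h = L^oo(Omega) *)
Definition Uh u := Lp Omega +oo%E u.
Definition Uadh u := Uad u /\ Uh u.

(* epsilon_h^u, where yh stands for S_h(u) *)
Definition eps_h (h gam : R) yb u yh : \bar R :=
  ((h `^ (1 + gam))%:E + h%:E * Znorm (S u) yb
   + h%:E * n2 (V (S u) (fine (noo (yh \- S u)%R))))%E.

(* local solutions of the discrete problem, with Sol the map u |-> S_h(u) *)
Definition disc_local_sol (Sol : (R * R -> R) -> R * R -> R) ub (e : R) yh uh :=
  [/\ Uadh uh, L2ball ub e uh, yh = Sol uh & exists2 r : R, 0 < r &
    forall u, Uadh u -> L2ball ub e u -> (n2 (u \- uh)%R <= r%:E)%E ->
      cost (Sol uh) uh <= cost (Sol u) u].

End Problem.

(* Main.v *)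
Require Import Defs.
From HB Require Import structures.
From mathcomp Require Import all_boot all_order all_algebra.
From mathcomp Require Import all_classical all_reals all_analysis.
From mathcomp Require Import measurable_realfun ess_sup_inf.
From mathcomp Require Import ring lra.

Set Implicit Arguments.
Unset Strict Implicit.
Unset Printing Implicit Defensive.
Import Order.TTheory GRing.Theory Num.Theory.
Import numFieldNormedType.Exports.
Local Open Scope classical_set_scope.
Local Open Scope ring_scope.

(** The estimate rests on an energy bound for thin strips. Let [y] be the state of an
    admissible control and test its equation with a smooth truncation of [y] at height
    [k] around [tbar], a function with values of order [k] whose derivative is at least
    one half where [y] is within [k] of [tbar]. As the diffusion coefficient is bounded
    below, the strip where [y] is within [k] of [tbar] carries energy

      [int_(|y - tbar| <= k) |grad y| ^ 2 <= CE * k],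

    with [CE] uniform over the admissible controls ([strip_energy], [state_energy]).
    Letting [k] tend to zero shows that the gradient vanishes almost everywhere on the
    level set ([gradient_zero_level]). The truncation is built from the arctangent, so
    it maps test functions to test functions, and the equation only has to be tested
    with truncated approximations of [y]; the limit is taken in [intO_pass_limit].

    For the first inequality, take the reference control as competitor in the estimate
    that defines [hhat]: the squared error is then bounded by the square of the
    consistency error [eps_h]. Write [d] for the error of the control and [r] for
    [K * d + h]. The state depends on the control in a Lipschitz way near the reference
    control, so the states differ by at most [r], in the uniform norm and for the
    gradients in the mean square. Two states lie on different sides of [tbar] only where
    the reference state is within [r] of it, so [Znorm] is of order
    [sqrt (r ^ 2 + r)] by the strip energy ([Znorm_estimate]). The other term of
    [eps_h] is of order [sqrt h], by the strip energy of the discrete control's own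
    continuous state ([V_estimate]). Since [gam < 1 / 2], the powers of [h] that arise are
    at most of order [h ^ (1 + gam)], and the terms containing [d] are absorbed
    ([absorb_error]). Thus the error is of order [h ^ (1 + gam)], which is
    one of the terms of the bound.

    The second inequality asks for a bound on the [L^1] norm of [Sigma k] that is uniform
    in [k]. Strips have energy of order [k], so it is enough that their measure is
    of order [k] as well ([Sigma_bounded]). This is a local question by
    compactness ([thin_closure]). Off the level set it is clear, and at points of the
    second kind it is assumed. At a point where some partial derivative is nonzero, this
    derivative keeps its sign nearby, and its flux through the strip, weighted by a bump
    function, is of order [k]: integrate by parts against the truncation, which vanishes
    on the boundary ([strip_flux], [thin_regular]). The continuous representative of the
    reference state, to which the level set refers, exists because the discrete states
    are continuous and converge uniformly ([state_continuous]). *)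

(** * Lebesgue measure on the plane *)

Section PlaneMeasure.
Context {R : realType}.
Local Notation mu := (@leb2 R).
Implicit Types (f g : R * R -> R) (D A : set (R * R)).

Lemma ball2P (a b c d e : R) : ball ((a, b) : R * R) e (c, d) <->
  [/\ c < a + e, a < c + e, d < b + e & b < d + e].
Proof.
have E (x y : R) : (`|x - y| < e) = (y < x + e) && (x < y + e).
  by rewrite ltr_distl ltrBlDr.
rewrite /ball/= /prod_ball/= /ball/= !E.
by split => [[/andP[? ?] /andP[? ?]]|[-> -> -> ->]].
Qed.

Definition box (a b c d : R) : set (R * R) := `[a, b]%classic `*` `[c, d]%classic.
Definition obox (a b c d : R) : set (R * R) := `]a, b[%classic `*` `]c, d[%classic.

Lemma measurable_box a b c d : measurable (box a b c d : set (plane R)).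
Proof. by apply: measurableX. Qed.

Lemma measurable_obox a b c d : measurable (obox a b c d : set (plane R)).
Proof. by apply: measurableX. Qed.

(** The closed boxes stay inside [A], so that test functions supported in them are
    test functions on [A]; rational end points make the union countable. *)
Lemma open_bigcup_obox A : open A ->
  A = \bigcup_(q in [set q : rat * rat * rat * rat |
        box (ratr q.1.1.1) (ratr q.1.1.2) (ratr q.1.2) (ratr q.2) `<=` A])
      obox (ratr q.1.1.1) (ratr q.1.1.2) (ratr q.1.2) (ratr q.2).
Proof.
move=> oA; apply/seteqP; split => [[x y] Ax|x [q qA [x1 x2]]]; last first.
  by apply: qA; split; exact: subset_itv_oo_cc.
have /nbhs_ballP[e /= e0 eA] : nbhs (x, y) A by exact: open_nbhs_nbhs.
have H (z : R) : exists q q' : rat, [/\ z - e < ratr q, ratr q < z, z < ratr q' & ratr q' < z + e].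
  have [q /[!in_itv]/= /andP[q1 q2]] : exists q, ratr q \in `]z - e, z[.
    by apply: rat_in_itvoo; rewrite gtrBl.
  have [q' /[!in_itv]/= /andP[q1' q2']] : exists q, ratr q \in `]z, z + e[.
    by apply: rat_in_itvoo; rewrite ltrDl.
  by exists q, q'.
have [q1 [q2 [? ? ? ?]]] := H x; have [q3 [q4 [? ? ? ?]]] := H y.
exists (q1, q2, q3, q4); last first.
  by rewrite /obox/= !in_itv/=; split; apply/andP.
move=> [c d]; rewrite /box/= !in_itv/= => -[/andP[? ?] /andP[? ?]].
by apply: eA; apply/ball2P; split; lra.
Qed.

Lemma measurable_open2 A : open A -> measurable (A : set (plane R)).
Proof.
move=> /open_bigcup_obox ->; rewrite bigcup_mkcond.
apply: countable_bigcupT_measurable => // q.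
by case: ifPn => // _; exact: measurable_obox.
Qed.

Lemma measurable_closed2 A : closed A -> measurable (A : set (plane R)).
Proof. by move/closed_openC/measurable_open2/measurableC; rewrite setCK. Qed.

Lemma measurable_within2 D f : measurable (D : set (plane R)) ->
  {within D, continuous f} -> measurable_fun (D : set (plane R)) (f : plane R -> R).
Proof.
move=> mD /continuousP cf.
apply: (measurability _ (RGenOpens.measurableE R)).
move=> _ [_ [a [b ->] <-]].
have /cf : open (`]a, b[%classic : set R) by exact: interval_open.
move=> /open_subspaceP [V oV VD]; rewrite setIC -VD.
by apply: measurableI => //; exact: measurable_open2.
Qed.

Lemma measurable_cont2 f : continuous f ->
  measurable_fun [set: plane R] (f : plane R -> R).
Proof.
move=> cf; apply: measurable_within2 => //; exact: continuous_subspaceT.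
Qed.

Lemma leb2_obox a b c d : a <= b -> c <= d ->
  mu (obox a b c d) = ((b - a) * (d - c))%:E.
Proof.
move=> ab cd.
transitivity (lebesgue_measure (`]a, b[%classic : set R) *
    lebesgue_measure (`]c, d[%classic : set R))%E; first exact: product_measure1E.
have L (x y : R) : x <= y -> lebesgue_measure (`]x, y[%classic : set R) = (y - x)%:E.
  rewrite le_eqVlt => /orP[/eqP->|xy].
    by rewrite lebesgue_measure_itv/= ltxx subrr.
  by rewrite lebesgue_measure_itv/= lte_fin xy.
by rewrite !L.
Qed.

Lemma leb2_box_lty a b c d : (mu (box a b c d) < +oo)%E.
Proof.
have -> : mu (box a b c d) = (lebesgue_measure (`[a, b]%classic : set R) *
    lebesgue_measure (`[c, d]%classic : set R))%E by exact: product_measure1E.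
rewrite !lebesgue_measure_itv/=; case: ifPn => ?; case: ifPn => ?; rewrite ?mule0 ?mul0e ?ltry// -!EFinB -EFinM ltry//.
Qed.

Lemma bounded_box D : bounded_set D -> exists2 M : R, 0 < M & D `<=` box (- M) M (- M) M.
Proof.
move=> [M [_ DM]]; have M0 : 0 < `|M| + 1 by rewrite ltr_wpDl.
exists (`|M| + 1) => // -[x y] Dx.
have /= := DM (`|M| + 1) (ltr_pwDr ltr01 (ler_norm _)) (x, y) Dx.
rewrite /Num.Def.normr/= ge_max => /andP[].
rewrite !ler_norml /box/= !in_itv/= => xM yM; split; [exact: xM|exact: yM].
Qed.

Lemma bounded_leb2_lty D : bounded_set D -> measurable (D : set (plane R)) -> (mu D < +oo)%E.
Proof.
move=> /bounded_box[M _ DM] mD.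
apply: (le_lt_trans _ (leb2_box_lty (- M) M (- M) M)).
by apply: le_measure; rewrite ?inE//; exact: measurable_box.
Qed.

Lemma ae2_imp (P Q : R * R -> Prop) : (forall x, P x -> Q x) ->
  {ae mu, forall x, P x} -> {ae mu, forall x, Q x}.
Proof. by move=> PQ; exact: (@filterS _ _ (ae_filter_ringOfSetsType mu)). Qed.

Lemma aeO_imp Omega (P Q : R * R -> Prop) : (forall x, Omega x -> P x -> Q x) ->
  aeO Omega P -> aeO Omega Q.
Proof. by move=> PQ; apply: ae2_imp => x H Ox; apply: PQ => //; exact: H. Qed.

Lemma aeO_and Omega (P Q : R * R -> Prop) : aeO Omega P -> aeO Omega Q ->
  aeO Omega (fun x => P x /\ Q x).
Proof.
move=> HP HQ; have := @filterI _ _ (ae_filter_ringOfSetsType mu) _ _ HP HQ.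
by apply: ae2_imp => x [H1 H2] Ox; split; [exact: H1|exact: H2].
Qed.

Lemma aeO_all Omega (P : R * R -> Prop) : (forall x, Omega x -> P x) -> aeO Omega P.
Proof. by move=> H; exact: aeW. Qed.

End PlaneMeasure.

(** * Integrals of partial derivatives with compact support *)

Section PartialDerivatives.
Context {R : realType}.
Local Notation mu := (@leb2 R).
Implicit Types (f g : R * R -> R) (x : R * R) (i : bool).

(** A directional derivative is the derivative of the restriction to a line, to
    which the chain rule in one variable applies. *)
Lemma is_derive_line f x v d :
  is_derive x v f d <-> is_derive (0 : R) (1 : R) (fun h : R => f (h *: v + x)) d.
Proof.
have E : (fun h : R => h^-1 *: (((f : R * R -> R) \o shift x) (h *: v) - f x)) =
         (fun h : R => h^-1 *: (((fun h : R => f (h *: v + x)) \o shift 0) (h *: (1 : R)) -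
                         (fun h : R => f (h *: v + x)) 0)).
  by apply/funext => h /=; rewrite addr0 scale0r add0r /GRing.scale/= mulr1.
split => [[df <-]|[df <-]]; split; rewrite /derivable /derive.
- by rewrite -E.
- by rewrite -E.
- by rewrite E.
- by rewrite E.
Qed.

Lemma is_derive_fst f s y d : is_derive (s, y) (evec false) f d ->
  is_derive s (1 : R) (fun s => f (s, y)) d.
Proof.
have E : (fun h : R => h^-1 *: (((f : R * R -> R) \o shift (s, y)) (h *: (evec false)) - f (s, y))) =
         (fun h : R => h^-1 *: (((fun s => f (s, y)) \o shift s) (h *: (1 : R)) - f (s, y))).
  apply/funext => h /=; congr (_ *: (f _ - _)).
  have -> : h *: evec false + (s, y) = (h *: (1 : R) + s, h *: (0 : R) + y) by [].
  by rewrite scaler0 add0r.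
by case=> df <-; split; rewrite /derivable /derive -E.
Qed.

Lemma is_derive_snd f s y d : is_derive (s, y) (evec true) f d ->
  is_derive y (1 : R) (fun y => f (s, y)) d.
Proof.
have E : (fun h : R => h^-1 *: (((f : R * R -> R) \o shift (s, y)) (h *: (evec true)) - f (s, y))) =
         (fun h : R => h^-1 *: (((fun y => f (s, y)) \o shift y) (h *: (1 : R)) - f (s, y))).
  apply/funext => h /=; congr (_ *: (f _ - _)).
  have -> : h *: evec true + (s, y) = (h *: (0 : R) + s, h *: (1 : R) + y) by [].
  by rewrite scaler0 add0r.
by case=> df <-; split; rewrite /derivable /derive -E.
Qed.

Lemma integral_derive0 (g dg : R -> R) (M : R) :
  (forall s, is_derive s (1 : R) g (dg s)) -> continuous dg ->
  (forall s, M < `|s| -> g s = 0) ->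
  (\int[lebesgue_measure]_s (dg s)%:E = 0)%E.
Proof.
move=> gd cdg g0.
have dg0 s : M < `|s| -> dg s = 0.
  move=> Ms; have [_ <-] := gd s.
  rewrite (@near_eq_derive _ _ _ g (cst 0)) ?derive_cst//.
  apply/nbhs_ballP; exists (`|s| - M) => /=; first by rewrite subr_gt0.
  move=> s'; rewrite /ball/= => ss'; rewrite g0//.
  have := lerB_dist s (s - s'); rewrite subKr; lra.
pose N := `|M| + 1.
have MN : M < `|N| by rewrite ger0_norm ?addr_ge0// ltr_pwDr// ler_norm.
have N0 : 0 < N by rewrite ltr_wpDl.
have := @continuous_FTC2 R dg g (- N) N.
rewrite !g0 ?normrN// subee// => <-; last 4 first.
- by rewrite gtrN.
- exact: continuous_subspaceT.
- split.
  + by move=> s _; have [] := gd s.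
  + apply: cvg_at_right_filter; apply: differentiable_continuous; apply/derivable1_diffP; by have [] := gd (- N).
  + apply: cvg_at_left_filter; apply: differentiable_continuous; apply/derivable1_diffP; by have [] := gd N.
- by move=> s _; rewrite derive1E; have [_ ] := gd s.
rewrite [RHS]integral_mkcond; apply: eq_integral => s _.
rewrite patchE; case: ifPn => // /negP sN; rewrite dg0//.
rewrite ltNge; apply/negP => sM; apply: sN; rewrite inE/= in_itv/= -ler_norml.
apply: (le_trans sM); rewrite /N; apply: (le_trans (ler_norm _)); rewrite lerDl//.
Qed.

Lemma derive_outside (K : set (R * R)) f v x : closed K ->
  (forall y, ~ K y -> f y = 0) -> ~ K x -> 'D_v f x = 0.
Proof.
move=> cK f0 Kx; rewrite (@near_eq_derive _ _ _ f (cst 0)) ?derive_cst//.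
have : nbhs x (~` K) by apply: open_nbhs_nbhs; split => //; exact: closed_openC.
by apply: filterS => y; exact: f0.
Qed.

Lemma integrable_supported (D : set (R * R)) f : compact D -> continuous f ->
  (forall x, ~ D x -> f x = 0) -> mu.-integrable [set: plane R] (EFin \o f).
Proof.
move=> cD cf f0.
have clD : closed D by apply: compact_closed => //; exact: norm_hausdorff.
have mD := measurable_closed2 clD.
suff : mu.-integrable D (EFin \o f : plane R -> \bar R).
  move=> /(integrable_mkcond _ mD).1.
  by rewrite restrict_EFin (_ : f \_ D = f)//; apply/funext => x;
    rewrite patchE; case: ifPn => //; rewrite notin_setE => /f0/= ->.
apply: measurable_bounded_integrable => //.
- by apply: bounded_leb2_lty => //; exact: compact_bounded.
- by apply: measurable_funTS; exact: measurable_cont2.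
- have /compact_bounded [B [Br HB]] : compact (f @` D).
    by apply: continuous_compact => //; exact: continuous_subspaceT.
  by exists B; split => // b Bb x Dx; apply: (HB b Bb (f x)); exists x.
Qed.

Lemma continuous_line1 f y : continuous f -> continuous (fun s => f (s, y)).
Proof.
move=> cf s; apply: (@continuous_comp _ _ _ (fun s => (s, y)) f); last exact: cf.
by apply: (@cvg_pair R R R (nbhs s) (nbhs s) (nbhs y) _ _ _ id (cst y)) => //; exact: cvg_cst.
Qed.

Lemma continuous_line2 f s : continuous f -> continuous (fun y => f (s, y)).
Proof.
move=> cf y; apply: (@continuous_comp _ _ _ (fun y => (s, y)) f); last exact: cf.
by apply: (@cvg_pair R R R (nbhs y) (nbhs s) (nbhs y) _ _ _ (cst s) id) => //; exact: cvg_cst.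
Qed.

(** Fubini's theorem, integrating first along the direction of differentiation. *)
Lemma integral_partial0 i f (K : set (R * R)) : compact K ->
  (forall x, ~ K x -> f x = 0) -> (forall x, derivable f x (evec i)) ->
  continuous ('D_(evec i) f) ->
  (\int[mu]_x ('D_(evec i) f x)%:E = 0)%E.
Proof.
move=> cK f0 df cdf.
have clK : closed K by apply: compact_closed => //; exact: norm_hausdorff.
have /bounded_box[M M0 KM] := compact_bounded cK.
have idf : mu.-integrable [set: plane R] (EFin \o 'D_(evec i) f).
  apply: (integrable_supported cK) => // x Kx.
  exact: derive_outside Kx.
have f0M s y : M < `|s| \/ M < `|y| -> f (s, y) = 0.
  move=> sy; apply: f0 => /KM; rewrite /box/= !in_itv/= -!ler_norml => -[sM yM].
  by case: sy; rewrite ltNge ?sM ?yM.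
case: i df cdf idf => df cdf idf.
- rewrite -(integral12_prod_meas1 idf) -[RHS](integral0 lebesgue_measure setT).
  apply: eq_integral => s _; rewrite /fubini_F.
  apply: (@integral_derive0 (fun y => f (s, y)) (fun y => 'D_(evec true) f (s, y)) M).
  + by move=> y; exact: (@is_derive_snd f s y _ (DeriveDef (df (s, y)) erefl)).
  + exact: (@continuous_line2 ('D_(evec true) f) s cdf).
  + by move=> y yM; apply: f0M; right.
- rewrite -(integral21_prod_meas1 idf) -[RHS](integral0 lebesgue_measure setT).
  apply: eq_integral => y _; rewrite /fubini_G.
  apply: (@integral_derive0 (fun s => f (s, y)) (fun s => 'D_(evec false) f (s, y)) M).
  + by move=> s; exact: (@is_derive_fst f s y _ (DeriveDef (df (s, y)) erefl)).
  + exact: (@continuous_line1 ('D_(evec false) f) y cdf).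
  + by move=> s sM; apply: f0M; left.
Qed.

End PartialDerivatives.

(** * Smooth functions on the plane *)

Section Smoothness.
Context {R : realType}.
Implicit Types (f g : R * R -> R) (x : R * R) (i : bool).

(** If the partial derivatives of the generators stay in the algebra, so do those of
    all its elements, by the product rule; iterating shows that they are smooth. This
    replaces formulas for derivatives of every order. *)
Inductive algebra (Gen : set (R * R -> R)) : set (R * R -> R) :=
| algebra_gen f : Gen f -> algebra Gen f
| algebra_cst c : algebra Gen (fun=> c)
| algebra_add f g : algebra Gen f -> algebra Gen g -> algebra Gen (fun x => f x + g x)
| algebra_mul f g : algebra Gen f -> algebra Gen g -> algebra Gen (fun x => f x * g x).

Lemma algebra_derive (Gen : set (R * R -> R)) :
  (forall f, Gen f -> continuous f /\ forall i, exists df, algebra Gen df /\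
     forall x, is_derive x (evec i) f (df x)) ->
  forall f, algebra Gen f -> continuous f /\ forall i, exists df, algebra Gen df /\
     forall x, is_derive x (evec i) f (df x).
Proof.
move=> HG f; elim => {f} [f /HG//|c|f g Gf [cf df] Gg [cg dg]|f g Gf [cf df] Gg [cg dg]].
- split; first by move=> x; exact: cvg_cst.
  move=> i; exists (fun=> 0); split; first exact: algebra_cst.
  by move=> x; exact: is_derive_cst.
- split; first by move=> x; apply: cvgD; [exact: cf|exact: cg].
  move=> i; have [f' [Gf' Hf']] := df i; have [g' [Gg' Hg']] := dg i.
  exists (fun x => f' x + g' x); split; first exact: algebra_add.
  by move=> x; exact: is_deriveD.
- split; first by move=> x; apply: cvgM; [exact: cf|exact: cg].
  move=> i; have [f' [Gf' Hf']] := df i; have [g' [Gg' Hg']] := dg i.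
  exists (fun x => f x * g' x + g x * f' x); split.
    by apply: algebra_add; exact: algebra_mul.
  by move=> x; exact: is_deriveM.
Qed.

Lemma smooth_algebra (Gen : set (R * R -> R)) :
  (forall f, Gen f -> continuous f /\ forall i, exists df, algebra Gen df /\
     forall x, is_derive x (evec i) f (df x)) ->
  forall f, algebra Gen f -> smooth f.
Proof.
move=> /algebra_derive HG f Gf.
suff H s : algebra Gen (iter_partial s f).
  move=> s; have [cs ds] := HG _ (H s); split => // i x.
  by have [df [_ /(_ x)[]]] := ds i.
elim: s => [//|i s /= /HG[_ /(_ i)[df [Gdf Hdf]]]].
rewrite (_ : (fun x => _) = df)//; apply/funext => x.
by have [_ ->] := Hdf x.
Qed.

Lemma is_derive_comp_dir (F : R -> R) f x (v : R * R) (a d : R) :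
  is_derive (f x) (1 : R) F a -> is_derive x v f d ->
  is_derive x v (fun y => F (f y)) (a * d).
Proof.
move=> HF /is_derive_line Hf; apply/is_derive_line.
apply: (@is_derive1_comp _ F (fun h : R => f (h *: v + x))) => //.
by rewrite scale0r add0r.
Qed.

(** [s ^- m * exp (- 1 / s)], extended by zero: differentiating one of these functions
    gives a linear combination of two others. *)
Definition flat (m : nat) (s : R) : R :=
  if 0 < s then s^-1 ^+ m * expR (- s^-1) else 0.

Lemma flat_ge0 m s : 0 <= flat m s.
Proof.
rewrite /flat; case: ifPn => // s0.
by rewrite mulr_ge0 ?expR_ge0// exprn_ge0// invr_ge0 ltW.
Qed.

Lemma flat_gt0 m s : 0 < s -> 0 < flat m s.
Proof.
by move=> s0; rewrite /flat s0 mulr_gt0 ?expR_gt0// exprn_gt0// invr_gt0.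
Qed.

Lemma flat_le1 s : flat 0 s <= 1.
Proof.
rewrite /flat; case: ifPn => // s0; rewrite expr0 mul1r -expR0 ler_expR.
by rewrite oppr_le0 invr_ge0 ltW.
Qed.

Lemma flat_le0 m s : s <= 0 -> flat m s = 0.
Proof. by move=> s0; rewrite /flat ltNge s0. Qed.

(** Quadratic flatness at the origin, from [(1 + y / n) ^ n <= exp y]. *)
Lemma flat_bound m : exists2 C : R, 0 < C & forall s, flat m s <= C * s ^+ 2.
Proof.
exists (m.+2%:R ^+ m.+2); first by rewrite exprn_gt0.
move=> s; rewrite /flat; case: ifPn => [s0|_]; last first.
  by apply: mulr_ge0; [exact: exprn_ge0|exact: sqr_ge0].
have [y y0 ->] : exists2 y : R, 0 < y & s = y^-1.
  by exists s^-1; rewrite ?invr_gt0 ?invrK.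
rewrite invrK expRN ler_pdivrMr ?expR_gt0// exprVn.
have n0 : 0 < m.+2%:R :> R by [].
have H : (y / m.+2%:R) ^+ m.+2 <= expR y.
  have -> : expR y = expR (y / m.+2%:R) ^+ m.+2 by rewrite -expRM_natl mulrC divfK// lt0r_neq0.
  apply: lerXn2r; rewrite ?nnegrE ?divr_ge0 ?expR_ge0//; first exact: ltW.
  by apply: le_trans (expR_ge1Dx _); rewrite mulrC lerDr.
move: H; rewrite exprMn exprVn ler_pdivrMr ?exprn_gt0// => H.
rewrite mulrAC ler_pdivlMr ?exprn_gt0// -exprD addn2.
by rewrite [leRHS]mulrC.
Qed.

Lemma is_derive_flat m (s : R) :
  is_derive s (1 : R) (flat m) (flat m.+2 s - m%:R * flat m.+1 s).
Proof.
have [s0|s0|->] := ltgtP s 0.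
- rewrite !flat_le0 ?(ltW s0)// mulr0 subr0.
  apply: (@near_eq_is_derive _ _ _ (cst 0)).
    near=> y; rewrite /= flat_le0//; apply: ltW; near: y.
    by apply: lt_nbhsl.
- have D1 : is_derive s (1 : R) (fun y : R => y^-1) (- s ^- 2 *: 1).
    by apply: is_deriveV; rewrite gt_eqF.
  have D2 : is_derive s (1 : R) (fun y : R => expR (- y^-1))
      (expR (- s^-1) * - (- s ^- 2 *: 1)).
    exact: (@is_derive1_comp _ expR (fun y : R => - y^-1) s _ _
      (is_derive_expR _) (is_deriveN D1)).
  have D3 := is_deriveM (is_deriveX m D1) D2.
  have D4 : is_derive s (1 : R) (fun y : R => y^-1 ^+ m * expR (- y^-1))
      (flat m.+2 s - m%:R * flat m.+1 s).
    have -> : (fun y : R => y^-1 ^+ m * expR (- y^-1)) =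
        (fun y : R => y^-1) ^+ m * (fun y : R => expR (- y^-1)).
      by apply/funext => y; rewrite /GRing.mul/= exprfctE.
    apply: is_derive_eq D3 _.
    rewrite /flat s0 /GRing.scale/= exprfctE /= expr2 invfM.
    case: m => [|k]; rewrite /= !exprS ?expr0 ?mulr0n; first by ring.
    by move: (s^-1 ^+ k) (k.+1%:R) => p c; ring.
  apply: near_eq_is_derive D4.
  near=> y; rewrite /= /flat ifT//; near: y.
  by apply: lt_nbhsr.

- rewrite !flat_le0// mulr0 subr0.
  have [C C0 HC] := flat_bound m.
  have H : (fun h : R => h^-1 *: ((flat m \o shift 0) (h *: 1) - flat m 0)) @ 0^' --> (0 : R).
    apply/cvgrPdist_le => e e0; near=> h.
    have h0 : 0 < `|h| by rewrite normr_gt0; near: h; exact: nbhs_dnbhs_neq.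
    rewrite sub0r normrN /= [flat m 0]flat_le0// subr0 addr0 /GRing.scale/= mulr1.
    rewrite normrM normfV ler_pdivrMl// ger0_norm ?flat_ge0//.
    apply: (le_trans (HC h)); rewrite -real_normK ?num_real// expr2 mulrCA.
    rewrite ler_pM2l// -ler_pdivlMl// mulrC; apply: ltW; near: h.
    apply: dnbhs0_lt; exact: divr_gt0.
  by split; [apply/cvg_ex; exists 0|exact: cvg_lim].
Unshelve. all: by end_near.
Qed.

End Smoothness.

(** * Bump functions and smooth truncations *)

Section Bumps.
Context {R : realType}.
Implicit Types (f g : R * R -> R) (x : R * R) (i : bool).

Lemma continuous_flat m : continuous (@flat R m).
Proof.
move=> s; apply: differentiable_continuous; apply/derivable1_diffP.
by have [] := is_derive_flat m s.
Qed.

Definition coord (j : bool) (x : R * R) : R := if j then x.2 else x.1.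

Lemma continuous_coord j : continuous (coord j).
Proof. by case: j => x; [exact: cvg_snd|exact: cvg_fst]. Qed.

Lemma is_derive_coord i j x :
  is_derive x (evec i) (coord j) (if i == j then 1 else 0).
Proof.
apply/is_derive_line.
have -> : (fun h : R => coord j (h *: evec i + x)) =
    (fun h : R => h * (if i == j then 1 else 0) + coord j x).
  by apply/funext => h; rewrite /coord /evec; case: i; case: j.
set c : R := (if _ then _ else _).
have D := is_deriveD (is_deriveM (is_derive_id (0 : R) (1 : R)) (is_derive_cst c (0 : R) (1 : R)))
  (is_derive_cst (coord j x) (0 : R) (1 : R)).
by apply: is_derive_eq D _; rewrite /GRing.scale/= mulr0 add0r addr0 mulr1.
Qed.

Definition affine_flat : set (R * R -> R) :=
  [set f | exists m j p q, f = (fun x => flat m (p * coord j x + q))].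

Lemma is_derive_affine_coord i j p q x :
  is_derive x (evec i) (fun x => p * coord j x + q) (p * (if i == j then 1 else 0)).
Proof.
have D := is_deriveD (is_deriveM (is_derive_cst p x (evec i)) (is_derive_coord i j x))
  (is_derive_cst q x (evec i)).
by apply: is_derive_eq D _; rewrite /= addr0 /GRing.scale/= mulr0 addr0.
Qed.

Lemma affine_flat_derive f : affine_flat f -> continuous f /\
  forall i, exists df, algebra affine_flat df /\
     forall x, is_derive x (evec i) f (df x).
Proof.
move=> [m [j [p [q ->]]]]; split.
  move=> x; apply: (@continuous_comp _ _ _ (fun x => p * coord j x + q)); last exact: continuous_flat.
  by apply: cvgD; [apply: cvgM; [exact: cvg_cst|exact: continuous_coord]|exact: cvg_cst].
move=> i; set c : R := p * (if i == j then 1 else 0).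
exists (fun x => (flat m.+2 (p * coord j x + q) + - m%:R * flat m.+1 (p * coord j x + q)) * c).
split.
  apply: algebra_mul; last exact: algebra_cst.
  apply: algebra_add; first by apply: algebra_gen; exists m.+2, j, p, q.
  apply: algebra_mul; first exact: algebra_cst.
  by apply: algebra_gen; exists m.+1, j, p, q.
move=> x; rewrite mulNr; apply: is_derive_comp_dir; first exact: is_derive_flat.
exact: is_derive_affine_coord.
Qed.

(** A smooth function that is positive exactly on the open box and increases to
    its indicator as [n] grows. *)
Definition bump (a b c d n : R) (x : R * R) : R :=
  flat 0 (n * coord false x + - (n * a)) * flat 0 (- n * coord false x + n * b) *
  (flat 0 (n * coord true x + - (n * c)) * flat 0 (- n * coord true x + n * d)).

Lemma algebra_bump a b c d n : algebra affine_flat (bump a b c d n).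
Proof.
apply: algebra_mul; apply: algebra_mul; apply: algebra_gen.
- by exists 0, false, n, (- (n * a)).
- by exists 0, false, (- n), (n * b).
- by exists 0, true, n, (- (n * c)).
- by exists 0, true, (- n), (n * d).
Qed.

Lemma smooth_bump a b c d n : smooth (bump a b c d n).
Proof. by apply: (smooth_algebra affine_flat_derive); exact: algebra_bump. Qed.

Lemma bump_ge0 a b c d n x : 0 <= bump a b c d n x.
Proof. by rewrite !mulr_ge0 ?flat_ge0. Qed.

Lemma bump_le1 a b c d n x : bump a b c d n x <= 1.
Proof.
have H (s s' : R) : flat 0 s * flat 0 s' <= 1 by rewrite mulr_ile1 ?flat_ge0 ?flat_le1.
by rewrite mulr_ile1 ?mulr_ge0 ?flat_ge0.
Qed.

Lemma bump_gt0 a b c d n x : 0 < n -> obox a b c d x -> 0 < bump a b c d n x.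
Proof.
move=> n0; rewrite /obox/= !in_itv/= => -[/andP[x1 x2] /andP[x3 x4]].
have H (p q : R) : p < q -> 0 < n * q + - (n * p).
  by move=> pq; rewrite -mulrBr mulr_gt0// subr_gt0.
rewrite /bump /coord !mulr_gt0// ?flat_gt0// ?H// mulNr addrC H//.
Qed.

Lemma bump_out a b c d n x : 0 < n -> ~ obox a b c d x -> bump a b c d n x = 0.
Proof.
move=> n0 nx.
have H (p q : R) : p <= q -> n * p + - (n * q) <= 0.
  by move=> pq; rewrite -mulrBr pmulr_rle0// subr_le0.
rewrite /bump /coord.
have [x1|x1] := leP x.1 a; first by rewrite (flat_le0 _ (H _ _ x1)) !mul0r.
have [x2|x2] := leP b x.1.
  by rewrite mulNr [- _ + _]addrC (flat_le0 _ (H _ _ x2)) mulr0 !mul0r.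
have [x3|x3] := leP x.2 c; first by rewrite (flat_le0 _ (H _ _ x3)) mul0r mulr0.
have [x4|x4] := leP d x.2.
  by rewrite ![- n * _]mulNr [- (n * x.2) + _]addrC (flat_le0 _ (H _ _ x4)) !mulr0.
by exfalso; apply: nx; rewrite /obox/= !in_itv/= x1 x2 x3 x4.
Qed.

Lemma cvg_flat (e : R) : 0 < e -> flat 0 (n.+1%:R * e) @[n --> \oo] --> (1 : R).
Proof.
move=> e0; apply: (@squeeze_cvgr _ _ _ _ (fun n : nat => 1 - n.+1%:R^-1 * e^-1) (cst 1)).
- near=> n; rewrite flat_le1 andbT /flat pmulr_rgt0// e0 expr0 mul1r.
  by rewrite -invfM; exact: expR_ge1Dx.
- rewrite -[X in _ --> X]subr0 -(mul0r e^-1).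
  by apply: cvgB; [exact: cvg_cst|apply: cvgM; [exact: cvg_harmonic|exact: cvg_cst]].
- exact: cvg_cst.
Unshelve. all: by end_near.
Qed.

Lemma cvg_bump a b c d x :
  bump a b c d n.+1%:R x @[n --> \oo] --> (\1_(obox a b c d) x : R).
Proof.
rewrite indicE; case: (boolP (x \in _)); last first.
  rewrite notin_setE => nx.
  by under eq_fun do rewrite bump_out//; exact: cvg_cst.
rewrite inE /obox/= !in_itv/= => -[/andP[x1 x2] /andP[x3 x4]].
have H (p q : R) : p < q -> flat 0 (n.+1%:R * q + - (n.+1%:R * p)) @[n --> \oo] --> (1 : R).
  move=> pq; under eq_fun do rewrite -mulrBr.
  by apply: cvg_flat; rewrite subr_gt0.
rewrite /bump /coord/=.
under eq_fun do rewrite ![- _.+1%:R * _]mulNr ![- (_.+1%:R * _) + _]addrC.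
have -> : (true%:R : R) = 1 * 1 * (1 * 1) by rewrite !mulr1.
by apply: cvgM; apply: cvgM; exact: H.
Qed.

Lemma compact_box a b c d : compact (@box R a b c d).
Proof. by apply: compact_setX; exact: segment_compact. Qed.

Lemma test_bump (Omega : set (R * R)) a b c d n : 0 < n -> box a b c d `<=` Omega ->
  test_fun Omega (bump a b c d n).
Proof.
move=> n0 BO; split; first exact: smooth_bump.
exists (box a b c d); split => //; first exact: compact_box.
move=> x nx; apply: bump_out => // -[/= x1 x2]; apply: nx.
by split; exact: subset_itv_oo_cc.
Qed.

End Bumps.

Section Truncation.
Context {R : realType} (t k : R).
Hypothesis k0 : 0 < k.
Implicit Types (f g phi : R * R -> R) (x : R * R) (i : bool).

(** A smooth bounded substitute for truncation at height [k] around [t]. It vanishes at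
    [0], so that it maps test functions to test functions; with the arctangent, its
    derivatives are polynomials in [s] and [slope s]. *)
Definition trunc (s : R) : R := k * (atan ((s - t) / k) - atan (- t / k)).
Definition slope (s : R) : R := (1 + ((s - t) / k) ^+ 2)^-1.

Lemma slope_gt0 s : 0 < slope s.
Proof. by rewrite invr_gt0 ltr_pwDl// sqr_ge0. Qed.

Lemma slope_le1 s : slope s <= 1.
Proof. by rewrite invf_le1 ?ltr_pwDl ?sqr_ge0// lerDl sqr_ge0. Qed.

Lemma slope_ge s : `|s - t| <= k -> 2^-1 <= slope s.
Proof.
move=> st; rewrite lef_pV2 ?posrE ?ltr_pwDl ?sqr_ge0//.
have : `|(s - t) / k| <= 1 by rewrite normrM normfV (gtr0_norm k0) ler_pdivrMr// mul1r.
rewrite -(ler_pXn2r (_ : (0 < 2)%N)) ?nnegrE// expr1n real_normK ?num_real//.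
by set w := (_ / _) ^+ 2 => ?; lra.
Qed.

Lemma trunc0 : trunc 0 = 0.
Proof. by rewrite /trunc sub0r subrr mulr0. Qed.

Lemma trunc_bound s : `|trunc s| <= k * pi.
Proof.
rewrite /trunc normrM (gtr0_norm k0) ler_pM2l//.
have := atan_gtNpi2 ((s - t) / k); have := atan_ltpi2 ((s - t) / k).
have := atan_gtNpi2 (- t / k); have := atan_ltpi2 (- t / k).
move: (atan _) (atan _) => A B ? ? ? ?; rewrite ler_norml; apply/andP; split; lra.
Qed.

Lemma slope_lip a b : `|slope a - slope b| <= `|a - b| / k.
Proof.
rewrite /slope.
have -> : `|a - b| / k = `|(a - t) / k - (b - t) / k|.
  by rewrite -mulrBl normrM normfV (gtr0_norm k0); congr (`|_| / _); ring.
move: ((a - t) / k) ((b - t) / k) => A B.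
have A0 : 0 < 1 + A ^+ 2 by rewrite ltr_pwDl// sqr_ge0.
have B0 : 0 < 1 + B ^+ 2 by rewrite ltr_pwDl// sqr_ge0.
have -> : (1 + A ^+ 2)^-1 - (1 + B ^+ 2)^-1 =
    (A - B) * (- (A + B) / ((1 + A ^+ 2) * (1 + B ^+ 2))).
  by field; rewrite !gt_eqF.
rewrite normrM ler_piMr// normrM normfV normrN [`|_ * _|]gtr0_norm ?mulr_gt0//.
rewrite ler_pdivrMr ?mulr_gt0// mul1r.
have [a1 a2] := (sqr_ge0 (A - 2^-1), sqr_ge0 (A + 2^-1)).
have [b1 b2] := (sqr_ge0 (B - 2^-1), sqr_ge0 (B + 2^-1)).
have ab := sqr_ge0 (A * B).
by rewrite ler_norml; apply/andP; split; nra.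
Qed.

Lemma is_derive_shiftdiv (s : R) : is_derive s (1 : R) (fun s => (s - t) / k) k^-1.
Proof.
have D := is_deriveM (is_deriveB (is_derive_id s (1 : R)) (is_derive_cst t s (1 : R)))
  (is_derive_cst k^-1 s (1 : R)).
by apply: is_derive_eq D _; rewrite /GRing.scale/= mulr0 add0r subr0 mulr1.
Qed.

Lemma is_derive_trunc (s : R) : is_derive s (1 : R) trunc (slope s).
Proof.
have D1 := @is_derive1_comp _ atan (fun s => (s - t) / k) s _ _ (is_derive1_atan _) (is_derive_shiftdiv s).
have D := is_deriveM (is_derive_cst k s (1 : R)) (is_deriveB D1 (is_derive_cst (atan (- t / k)) s (1 : R))).
apply: is_derive_eq D _; rewrite /GRing.scale/= mulr0 addr0 subr0 mulrCA divff ?mulr1//.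
by rewrite gt_eqF.
Qed.

Lemma is_derive_slope (s : R) : is_derive s (1 : R) slope
  (- 2 / k ^+ 2 * (s + - t) * (slope s * slope s)).
Proof.
have D1 := is_deriveM (is_derive_shiftdiv s) (is_derive_shiftdiv s).
have D2 := is_deriveD (is_derive_cst (1 : R) s (1 : R)) D1.
have E : (cst (1 : R) + (fun s : R => (s - t) / k) * (fun s : R => (s - t) / k) : R -> R) s != 0.
  by rewrite /GRing.add/= /GRing.mul/= gt_eqF// ltr_pwDl// -expr2 sqr_ge0.
have D := is_deriveV E D2.
have -> : slope = (fun y => ((cst (1 : R) + (fun s : R => (s - t) / k) *
    (fun s : R => (s - t) / k) : R -> R) y)^-1).
  by apply/funext => y; rewrite /slope expr2.
apply: is_derive_eq D _; rewrite /GRing.scale/= /slope.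
move: E; move: ((_ : R -> R) s) => w w0.
by field; rewrite w0 gt_eqF.
Qed.

(** Besides [phi] and its derivatives, only two functions are needed, because
    [slope' = - 2 (s - t) / k ^ 2 * slope ^ 2]. *)
Definition trunc_gens phi : set (R * R -> R) :=
  [set f | (exists s, f = iter_partial s phi) \/
    f = (fun x => slope (phi x)) \/ f = (fun x => trunc (phi x))].

Lemma trunc_gens_derive phi : smooth phi -> forall f, trunc_gens phi f -> continuous f /\
  forall i, exists df, algebra (trunc_gens phi) df /\
     forall x, is_derive x (evec i) f (df x).
Proof.
move=> sphi.
have Gphi s : algebra (trunc_gens phi) (iter_partial s phi).
  by apply: algebra_gen; left; exists s.
have cphi := (sphi [::]).1.
have Dphi i x : is_derive x (evec i) phi (iter_partial [:: i] phi x).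
  exact: (DeriveDef ((sphi [::]).2 i x) erefl).
have Gs : algebra (trunc_gens phi) (fun x => slope (phi x)).
  by apply: algebra_gen; right; left.
have cF (F dF : R -> R) : (forall s, is_derive s (1 : R) F (dF s)) -> continuous (fun x => F (phi x)).
  move=> HF x; apply: (@continuous_comp _ _ _ phi F); first exact: cphi.
  by apply: differentiable_continuous; apply/derivable1_diffP; have [] := HF (phi x).
move=> f [[s ->]|[->|->]]; split.
- exact: (sphi s).1.
- move=> i; exists (iter_partial (i :: s) phi); split; first exact: Gphi.
  by move=> x; exact: (DeriveDef ((sphi s).2 i x) erefl).
- exact: cF is_derive_slope.
- move=> i; exists (fun x => (- 2 / k ^+ 2 * (phi x + - t)) * (slope (phi x) * slope (phi x)) * iter_partial [:: i] phi x); split.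
    apply: algebra_mul; last exact: Gphi.
    apply: algebra_mul; last exact: algebra_mul.
    apply: algebra_mul; first exact: algebra_cst.
    by apply: algebra_add; [exact: (Gphi [::])|exact: algebra_cst].
  by move=> x; exact: (is_derive_comp_dir (is_derive_slope (phi x)) (Dphi i x)).
- exact: cF is_derive_trunc.
- move=> i; exists (fun x => slope (phi x) * iter_partial [:: i] phi x); split.
    by apply: algebra_mul.
  by move=> x; exact: (is_derive_comp_dir (is_derive_trunc (phi x)) (Dphi i x)).
Qed.

Lemma test_trunc (Omega : set (R * R)) phi : test_fun Omega phi ->
  test_fun Omega (fun x => trunc (phi x)).
Proof.
move=> [sphi [K [cK KO K0]]]; split.
  apply: (smooth_algebra (trunc_gens_derive sphi)).
  by apply: algebra_gen; right; right.
by exists K; split => // x /K0 ->; exact: trunc0.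
Qed.

Lemma is_derive_test_trunc (Omega : set (R * R)) phi i x : test_fun Omega phi ->
  is_derive x (evec i) (fun x => trunc (phi x)) (slope (phi x) * 'D_(evec i) phi x).
Proof.
move=> [sphi _].
exact: (is_derive_comp_dir (is_derive_trunc _)
  (DeriveDef ((sphi [::]).2 i x) erefl)).
Qed.

End Truncation.

(** * The fundamental lemma of the calculus of variations *)

Section PiLambda.
Context d d' (T : measurableType d) (T' : measurableType d') (R : realType).
Variables (mu : {measure set T -> \bar R}) (g : T -> \bar R).
Hypothesis ig : mu.-integrable [set: T] g.

(** Dynkin's argument, in a form that can be applied to one coordinate at a time. *)
Lemma integral_preimage0 (p : T -> T') (C : set T) (G : set (set T')) :
  measurable_fun [set: T] p -> measurable C ->
  @measurable _ T' = <<s G >> -> setI_closed G ->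
  (\int[mu]_(x in C) g x = 0)%E ->
  (forall A, G A -> \int[mu]_(x in p @^-1` A `&` C) g x = 0)%E ->
  forall A, measurable A -> (\int[mu]_(x in p @^-1` A `&` C) g x = 0)%E.
Proof.
move=> mp mC GE GI C0 G0 A mA.
have mpA B : measurable B -> measurable (p @^-1` B).
  by move=> mB; rewrite -[X in measurable X]setTI; exact: mp.
have igS B : measurable B -> mu.-integrable B g.
  by move=> mB; apply: integrableS ig.
have mg B : measurable_fun B g by apply: measurable_funTS; exact: measurable_int ig.
rewrite GE in mA.
apply: (@dynkin_induction _ T' G (fun A => \int[mu]_(x in p @^-1` A `&` C) g x = 0)%E) mA => //.
- by rewrite preimage_setT setTI.
- move=> S mS S0.
  have E : (p @^-1` S `&` C) `|` (p @^-1` (~` S) `&` C) = C.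
    by rewrite -setIUl -preimage_setU setUv setTI.
  have : (\int[mu]_(x in (p @^-1` S `&` C) `|` (p @^-1` (~` S) `&` C)) g x = 0)%E.
    by rewrite E.
  rewrite integral_setU//.
  + by rewrite S0 add0e => <-.
  + by apply: measurableI => //; exact: mpA.
  + by apply: measurableI => //; apply: measurableC; exact: mpA.
  + by apply/eqP; rewrite setIACA -preimage_setI setICr preimage_set0 set0I.
- move=> F mF tF F0; rewrite preimage_bigcup setI_bigcupl integral_bigcup.
  + by apply: eseries0 => n _ _; exact: F0.
  + apply/trivIsetP => i j _ _ ij; move/trivIsetP : tF => /(_ i j Logic.I Logic.I ij) Fij.
    by rewrite setIACA -preimage_setI Fij preimage_set0 set0I.
  + by move=> n; apply: measurableI => //; exact: mpA.
  + apply: igS; apply: bigcupT_measurable => n.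
    by apply: measurableI => //; exact: mpA.
Qed.

End PiLambda.

Section FundamentalLemma.
Context {R : realType} (Omega : set (R * R)).
Local Notation mu := (@leb2 R).
Hypothesis oO : open Omega.
Implicit Types (f g : R * R -> R).

Let mO : measurable (Omega : set (plane R)) := measurable_open2 oO.

Lemma oboxI (a b c d a' b' c' d' : R) : obox a b c d `&` obox a' b' c' d' =
  obox (Num.max a a') (Num.min b b') (Num.max c c') (Num.min d d').
Proof.
apply/seteqP; split => -[x y]; rewrite /obox/= !in_itv/= !gt_max !lt_min.
  by move=> [[/andP[-> ->] /andP[-> ->]] [/andP[-> ->] /andP[-> ->]]].
by move=> [/andP[/andP[-> ->] /andP[-> ->]] /andP[/andP[-> ->] /andP[-> ->]]].
Qed.

Lemma integral_obox0 f (a b c d : R) : loc_integrable Omega f ->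
  (forall psi, test_fun Omega psi -> intO Omega (fun x => f x * psi x) = 0) ->
  box a b c d `<=` Omega -> (\int[mu]_(x in obox a b c d) (f x)%:E = 0)%E.
Proof.
move=> [mf lf] f0 BO.
set K := box a b c d; set O := obox a b c d.
have mK : measurable (K : set (plane R)) by exact: measurable_box.
have mOb : measurable (O : set (plane R)) by exact: measurable_obox.
have OK : O `<=` K by move=> x [x1 x2]; split; exact: subset_itv_oo_cc.
have ifK : mu.-integrable K (EFin \o (f : plane R -> R)).
  by apply: lf => //; exact: compact_box.
have mfK : measurable_fun (K : set (plane R)) (f : plane R -> R).
  exact: measurable_funS mf.
pose psi n := bump a b c d (n.+1%:R : R).
have mpsi n : measurable_fun [set: plane R] (psi n : plane R -> R).
  by apply: measurable_cont2; exact: (smooth_bump _ _ _ _ _ [::]).1.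
have psi0 n x : ~ O x -> psi n x = 0 by move=> nx; rewrite /psi bump_out.
have I0 n : (\int[mu]_(x in K) (f x * psi n x)%:E = 0)%E.
  have := f0 _ (test_bump (ltr0Sn _ n) BO).
  rewrite /intO /Rintegral -/K.
  have -> : (\int[mu]_(x in Omega) (f x * bump a b c d n.+1%:R x)%:E =
    \int[mu]_(x in K) (f x * psi n x)%:E)%E.
    rewrite integral_mkcond [RHS]integral_mkcond; apply: eq_integral => x _.
    rewrite !patchE; case: ifPn => [xO|xO]; case: ifPn => [xK|xK] //.
      by rewrite -/(psi n x) psi0 ?mulr0// => /OK; rewrite notin_setE in xK.
    by move: xO; rewrite notin_setE inE in xK *; case; exact: BO.
  move/eqP; rewrite fine_eq0; first by move/eqP.
  apply: integrable_fin_num => //.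
  apply: (le_integrable _ _ _ ifK) => //.
    apply/measurable_EFinP; apply: measurable_funM => //.
    by apply: measurable_funTS; exact: mpsi.
  move=> x _ /=; rewrite lee_fin normrM ler_piMr// ger0_norm ?bump_ge0//.
  exact: bump_le1.
have m1 n : measurable_fun K (fun x : plane R => (f x * psi n x)%:E).
  apply/measurable_EFinP; apply: measurable_funM => //.
  by apply: measurable_funTS; exact: mpsi.
have m2 : measurable_fun K (fun x : plane R => (f x * \1_O x)%:E).
  by apply/measurable_EFinP; apply: measurable_funM.
have cv : {ae mu, forall x, K x ->
    (fun n => (f x * psi n x)%:E) @ \oo --> (f x * \1_O x)%:E}.
  apply: aeW => x _; apply: cvg_EFin; first exact: nearW.
  by apply: cvgM; [exact: cvg_cst|exact: cvg_bump].
have dom : {ae mu, forall x n, K x -> (`|(f x * psi n x)%:E| <= `|(f x)%:E|)%E}.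
  apply: aeW => x n _ /=; rewrite lee_fin normrM ler_piMr// ger0_norm ?bump_ge0//.
  exact: bump_le1.
have [_ _] := dominated_convergence mK m1 m2 cv (integrable_abse ifK) dom.
under eq_fun do rewrite I0.
move=> /(cvg_lim (@ereal_hausdorff R)); rewrite lim_cst; last exact: ereal_hausdorff.
have -> : (fun x => (f x * \1_O x)%:E) = (EFin \o (f : plane R -> R)) \_ O.
  apply/funext => x; rewrite patchE indicE; case: ifPn => _ /=; rewrite ?mulr1 ?mulr0//.
rewrite -integral_mkcondr => ->; congr integral.
by apply/seteqP; split => x; [move=> Ox; split => //; exact: OK|case].
Qed.

(** The integrals of [f] over boxes determine, one coordinate after the other, its
    integrals over all Borel subsets of the box. *)
Lemma fundamental_obox f (a b c d : R) : loc_integrable Omega f ->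
  (forall psi, test_fun Omega psi -> intO Omega (fun x => f x * psi x) = 0) ->
  box a b c d `<=` Omega -> {ae mu, forall x, obox a b c d x -> f x = 0}.
Proof.
move=> lif f0 BO.
set K := box a b c d; set O := obox a b c d.
have mK : measurable (K : set (plane R)) by exact: measurable_box.
have mOb : measurable (O : set (plane R)) by exact: measurable_obox.
have OK : O `<=` K by move=> x [x1 x2]; split; exact: subset_itv_oo_cc.
have ifO : mu.-integrable O (EFin \o (f : plane R -> R)).
  by apply: (integrableS mK) => //; apply: lif.2 => //; exact: compact_box.
pose g := (EFin \o (f : plane R -> R)) \_ O.
have ig : mu.-integrable [set: plane R] g by apply: (integrable_mkcond _ mOb).1.
have gE (S : set (plane R)) : (\int[mu]_(x in S) g x = \int[mu]_(x in S `&` O) (f x)%:E)%E.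
  by rewrite -integral_mkcondr.
have g0 (a' b' c' d' : R) : (\int[mu]_(x in obox a' b' c' d') g x = 0)%E.
  rewrite gE setIC oboxI; apply: integral_obox0 => //.
  apply: subset_trans BO => -[x y]; rewrite /box/= !in_itv/= !ge_max !le_min.
  by move=> [/andP[/andP[-> _] /andP[-> _]] /andP[/andP[-> _] /andP[-> _]]].
have gT : (\int[mu]_x g x = 0)%E.
  rewrite -(g0 a b c d) !gE setTI; congr integral.
  by rewrite -/O setIid.
have RE : @measurable _ (measurableTypeR R) = <<s @RGenOpens.G R >>.
  exact: RGenOpens.measurableE.
have RI : setI_closed (@RGenOpens.G R).
  move=> _ _ [x [y ->]] [x' [y' ->]]; exists (Num.max x x'), (Num.min y y').
  apply/seteqP; split => z /=; rewrite !in_itv/= gt_max lt_min.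
    by move=> [/andP[-> ->] /andP[-> ->]].
  by move=> /andP[/andP[-> ->] /andP[-> ->]].
have step1 c' d' (A : set (measurableTypeR R)) : measurable A ->
    (\int[mu]_(x in fst @^-1` A `&` (setT `*` `]c', d'[%classic)) g x = 0)%E.
  apply: (@integral_preimage0 _ _ _ _ _ mu g ig fst _ _ (@measurable_fst _ _ _ _) _ RE RI).
  - exact: measurableX.
  - rewrite -(g0 a b c' d') !gE; congr integral.
    by apply/seteqP; split => x; rewrite /O /obox/=; tauto.
  - move=> _ [x [y ->]]; rewrite -(g0 x y c' d'); congr integral.
    by apply/seteqP; split => z; rewrite /obox/=; tauto.
have step2 (A B : set (measurableTypeR R)) : measurable A -> measurable B ->
    (\int[mu]_(x in A `*` B) g x = 0)%E.
  move=> mA mB.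
  have -> : A `*` B = snd @^-1` B `&` (A `*` setT).
    by apply/seteqP; split => z /=; tauto.
  move: B mB.
  apply: (@integral_preimage0 _ _ _ _ _ mu g ig snd _ _ (@measurable_snd _ _ _ _) _ RE RI).
  - exact: measurableX.
  - rewrite -(step1 c d A mA) !gE; congr integral.
    by apply/seteqP; split => x; rewrite /O /obox/=; tauto.
  - move=> _ [x [y ->]]; rewrite -(step1 x y A mA); congr integral.
    by apply/seteqP; split => z /=; tauto.
have step3 (S : set (plane R)) : measurable S -> (\int[mu]_(x in S) g x = 0)%E.
  move=> mS; rewrite -(setIT S).
  apply: (@integral_preimage0 _ _ _ _ _ mu g ig id setT _ (@measurable_id _ _ _) _
    (@measurable_prod_measurableType _ _ _ _)) mS => //.
  - move=> _ _ [A mA [B mB <-]] [A' mA' [B' mB' <-]].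
    exists (A `&` A'); first exact: measurableI.
    by exists (B `&` B'); [exact: measurableI|rewrite setXI].
  - by move=> _ [A mA [B mB <-]]; rewrite setIT; exact: step2.
have : ae_eq mu O (EFin \o (f : plane R -> R)) (cst 0%E).
  apply: integral_ae_eq => // S SO mS.
  rewrite integral0 -(step3 S mS) gE; congr integral.
  by apply/seteqP; split => [x Sx|x []//]; split => //; exact: SO.
by apply: ae2_imp => x /= H /H [].
Qed.

(** Bumps increasing to indicators of boxes turn the vanishing of all test
    integrals into that of the integrals over boxes, which generate the Borel sets. *)
Lemma fundamental_lemma f : loc_integrable Omega f ->
  (forall psi, test_fun Omega psi -> intO Omega (fun x => f x * psi x) = 0) ->
  aeO Omega (fun x => f x = 0).
Proof.
move=> lif f0; rewrite /aeO.
have H (n : nat) : {ae mu, forall x, forall q : rat * rat * rat * rat, unpickle n = Some q ->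
    box (ratr q.1.1.1) (ratr q.1.1.2) (ratr q.1.2) (ratr q.2) `<=` Omega ->
    obox (ratr q.1.1.1) (ratr q.1.1.2) (ratr q.1.2) (ratr q.2) x -> f x = 0}.
  case: (unpickle n) => [q|]; last by apply: aeW.
  have [qO|nqO] := pselect (box (ratr q.1.1.1) (ratr q.1.1.2) (ratr q.1.2) (ratr q.2) `<=` Omega).
    have := fundamental_obox lif f0 qO.
    by apply: ae2_imp => x fx q' [<-] _; exact: fx.
  by apply: aeW => x q' [<-].
have := ae_foralln H.
apply: ae2_imp => x Hx; rewrite {1}(open_bigcup_obox oO) => -[q qO xq].
by apply: (Hx (pickle q) q) => //; rewrite pickleK.
Qed.

End FundamentalLemma.

(** * Integrability and square integrability on a bounded open set *)

Section IntegralsOnDomain.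
Context {R : realType} (Omega : set (R * R)).
Local Notation mu := (@leb2 R).
Hypothesis oO : open Omega.
Hypothesis bO : bounded_set Omega.
Implicit Types (f g : R * R -> R).

Let mO : measurable (Omega : set (plane R)) := measurable_open2 oO.

Definition meas f := measurable_fun (Omega : set (plane R)) (f : plane R -> R).
Definition integ f := mu.-integrable (Omega : set (plane R)) (EFin \o (f : plane R -> R)).
Definition sqint f := meas f /\ integ (fun x => f x ^+ 2).

Lemma leb2_domain_lty : (mu Omega < +oo)%E.
Proof. exact: bounded_leb2_lty. Qed.

Lemma integ_meas f : integ f -> meas f.
Proof. by move=> /measurable_int /measurable_EFinP. Qed.

Lemma integ_fin f : integ f -> (\int[mu]_(x in Omega) (f x)%:E = (intO Omega f)%:E)%E.
Proof. by move=> fi; rewrite /intO /Rintegral fineK// integrable_fin_num. Qed.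

Lemma integ_le f g : meas f -> integ g -> aeO Omega (fun x => `|f x| <= g x) -> integ f.
Proof.
move=> mf ig fg; apply/integrableP; split; first exact/measurable_EFinP.
have [_] := integrableP _ _ _ ig; apply: le_lt_trans.
apply: ae_ge0_le_integral => //.
- by apply: measurableT_comp => //; exact/measurable_EFinP.
- by apply: measurableT_comp => //; exact: measurable_int ig.
- move: fg; apply: aeO_imp => x Ox; rewrite /= lee_fin => /le_trans; apply.
  exact: ler_norm.
Qed.

Lemma integ_cst (c : R) : integ (fun=> c).
Proof.
apply: measurable_bounded_integrable => //; first exact: leb2_domain_lty.
by exists `|c|; split => // x cx y _ /=; exact: ltW.
Qed.

Lemma integ_bounded f C : meas f -> aeO Omega (fun x => `|f x| <= C) -> integ f.
Proof. by move=> mf; apply: integ_le => //; exact: integ_cst. Qed.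

Lemma integD f g : integ f -> integ g -> integ (fun x => f x + g x).
Proof. by move=> i1 i2; exact: (integrableD mO i1 i2). Qed.

Lemma integB f g : integ f -> integ g -> integ (fun x => f x - g x).
Proof. by move=> i1 i2; exact: (integrableB mO i1 i2). Qed.

Lemma integZ (c : R) f : integ f -> integ (fun x => c * f x).
Proof. by move=> i1; exact: (integrableZl mO c i1). Qed.

Lemma integ_norm f : integ f -> integ (fun x => `|f x|).
Proof. exact: integrable_norm. Qed.

Lemma intOD f g : integ f -> integ g ->
  intO Omega (fun x => f x + g x) = intO Omega f + intO Omega g.
Proof. by move=> i1 i2; exact: (RintegralD mO i1 i2). Qed.

Lemma intOB f g : integ f -> integ g ->
  intO Omega (fun x => f x - g x) = intO Omega f - intO Omega g.
Proof. by move=> i1 i2; exact: (RintegralB mO i1 i2). Qed.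

Lemma intOZ (c : R) f : integ f -> intO Omega (fun x => c * f x) = c * intO Omega f.
Proof. by move=> i1; exact: RintegralZl. Qed.

Lemma eq_intO f g : meas f -> meas g -> aeO Omega (fun x => f x = g x) ->
  intO Omega f = intO Omega g.
Proof.
move=> mf mg fg; rewrite /intO /Rintegral; congr fine.
apply: ae_eq_integral => //; [exact/measurable_EFinP|exact/measurable_EFinP|].
by move: fg; apply: ae2_imp => x H Ox; rewrite /= H.
Qed.

Lemma le_intO f g : integ f -> integ g -> aeO Omega (fun x => f x <= g x) ->
  intO Omega f <= intO Omega g.
Proof.
move=> i1 i2 fg; rewrite -subr_ge0 -intOB//.
have mh : meas (fun x => g x - f x) by apply: integ_meas; exact: integB.
rewrite (@eq_intO _ (fun x => `|g x - f x|)) //; last 2 first.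
- by apply: measurableT_comp.
- by move: fg; apply: aeO_imp => x _ ?; rewrite ger0_norm// subr_ge0.
by apply: Rintegral_ge0.
Qed.

Lemma intO_ge0 f : (forall x, Omega x -> 0 <= f x) -> 0 <= intO Omega f.
Proof. by move=> f0; exact: Rintegral_ge0. Qed.

Lemma le_norm_intO f : integ f -> `|intO Omega f| <= intO Omega (fun x => `|f x|).
Proof. by move=> fi; exact: le_normr_Rintegral. Qed.

Lemma intO_cst (c : R) : intO Omega (fun=> c) = c * intO Omega (fun=> 1).
Proof.
rewrite -intOZ; last exact: integ_cst.
by congr intO; apply/funext => x; rewrite mulr1.
Qed.

Lemma measD f g : meas f -> meas g -> meas (fun x => f x + g x).
Proof. exact: measurable_funD. Qed.

Lemma measB f g : meas f -> meas g -> meas (fun x => f x - g x).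
Proof. exact: measurable_funB. Qed.

Lemma measM f g : meas f -> meas g -> meas (fun x => f x * g x).
Proof. exact: measurable_funM. Qed.

Lemma measX f n : meas f -> meas (fun x => f x ^+ n).
Proof. exact: measurable_funX. Qed.

Lemma meas_norm f : meas f -> meas (fun x => `|f x|).
Proof. by move=> mf; apply: measurableT_comp. Qed.

Lemma meas_cst (c : R) : meas (fun=> c).
Proof. exact: measurable_cst. Qed.

Lemma meas_cont f : continuous f -> meas f.
Proof. by move=> cf; apply: measurable_funTS; exact: measurable_cont2. Qed.

Lemma meas_comp (F : R -> R) f : measurable_fun setT F -> meas f -> meas (fun x => F (f x)).
Proof. by move=> mF mf; exact: measurableT_comp mF mf. Qed.

Lemma mul_le_sqr (a b : R) : `|a * b| <= a ^+ 2 + b ^+ 2.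
Proof.
rewrite ler_norml; apply/andP; split.
  by have := sqr_ge0 (a + b); have := sqr_ge0 a; have := sqr_ge0 b; rewrite sqrrD; lra.
by have := sqr_ge0 (a - b); have := sqr_ge0 a; have := sqr_ge0 b; rewrite sqrrB; lra.
Qed.

Lemma sqint_mul f g : sqint f -> sqint g -> integ (fun x => f x * g x).
Proof.
move=> [mf f2] [mg g2]; apply: (integ_le _ (integD f2 g2)); first exact: measM.
by apply: aeO_all => x _; exact: mul_le_sqr.
Qed.

Lemma sqint_le f g : meas f -> sqint g -> aeO Omega (fun x => `|f x| <= `|g x|) -> sqint f.
Proof.
move=> mf [mg g2] fg; split => //; apply: (integ_le _ g2); first exact: measX.
by move: fg; apply: aeO_imp => x _ H; rewrite normrX -(real_normK (num_real (g x))) lerXn2r ?nnegrE.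
Qed.

Lemma sqint_bounded f C : meas f -> aeO Omega (fun x => `|f x| <= C) -> sqint f.
Proof.
move=> mf fC; apply: (@sqint_le _ (fun=> C)) => //.
  split; first exact: meas_cst.
  exact: integ_cst.
by move: fC; apply: aeO_imp => x _ H; rewrite (le_trans H)// ler_norm.
Qed.

Lemma sqint_integ f : sqint f -> integ f.
Proof.
move=> [mf f2]; apply: (integ_le mf (integD f2 (integ_cst 1))).
apply: aeO_all => x _; rewrite -[X in `|X|]mulr1 -[X in _ + X](expr1n R 2).
exact: mul_le_sqr.
Qed.

Lemma sqintD f g : sqint f -> sqint g -> sqint (fun x => f x + g x).
Proof.
move=> [mf f2] [mg g2]; split; first exact: measD.
apply: (integ_le _ (integZ 2 (integD f2 g2))); first by apply: measX; exact: measD.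
apply: aeO_all => x _; rewrite ger0_norm ?sqr_ge0//.
by have := sqr_ge0 (f x - g x); rewrite sqrrB sqrrD; lra.
Qed.

Lemma sqintZ (c : R) f : sqint f -> sqint (fun x => c * f x).
Proof.
move=> [mf f2]; split; first by apply: measM => //; exact: meas_cst.
have -> : (fun x => (c * f x) ^+ 2) = (fun x => c ^+ 2 * f x ^+ 2).
  by apply/funext => x; rewrite exprMn.
exact: integZ.
Qed.

Lemma sqintB f g : sqint f -> sqint g -> sqint (fun x => f x - g x).
Proof.
move=> sf /(sqintZ (-1)) sg; have := sqintD sf sg; congr sqint.
by apply/funext => x; rewrite mulN1r.
Qed.

Lemma sqint_mulb f g C : meas g -> aeO Omega (fun x => `|g x| <= C) -> sqint f ->
  sqint (fun x => g x * f x).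
Proof.
move=> mg gC sf; apply: (sqint_le _ (sqintZ C sf)); first by apply: measM; [|exact: sf.1].
move: gC; apply: aeO_imp => x _ H; rewrite !normrM ler_wpM2r//.
by rewrite (le_trans H)// ler_norm.
Qed.

Lemma nL_patch (p : R) f : p != 0 -> meas f ->
  (nL Omega p%:E f `^ p = \int[mu]_(x in Omega) (`|f x| `^ p)%:E)%E.
Proof.
move=> p0 mf; rewrite /nL poweR_Lnorm// [RHS]integral_mkcond; apply: eq_integral => x _.
rewrite /= !patchE; case: ifPn => // _.
by rewrite normr0 /= powR0.
Qed.

Lemma n2_sqr f : meas f -> (nL Omega 2%:E f ^+ 2 = \int[mu]_(x in Omega) (f x ^+ 2)%:E)%E.
Proof.
move=> mf.
have -> : (\int[mu]_(x in Omega) (f x ^+ 2)%:E = nL Omega 2%:E f `^ 2)%E.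
  rewrite nL_patch//; apply: eq_integral => x _.
  by rewrite powR_mulrn// real_normK ?num_real.
have := @Lnorm_ge0 _ (plane R) R mu 2%:E (EFin \o (f \_ Omega)); rewrite -/(nL Omega 2%:E f).
case: (nL _ _ _) => [r| |]// r0; first by rewrite poweR_EFin powR_mulrn.
by rewrite poweRyr// expe2 mulyy.
Qed.

Lemma nL_ge0 p f : (0 <= nL Omega p f)%E.
Proof. exact: Lnorm_ge0. Qed.

Lemma Lp2_sqint f : Lp Omega 2%:E f <-> sqint f.
Proof.
split => [[mf nf]|[mf f2]]; split => //.
- apply/integrableP; split; first by apply/measurable_EFinP; exact: measX.
  rewrite (_ : (\int[mu]_(x in Omega) _)%E = nL Omega 2%:E f ^+ 2)%E; last first.
    rewrite n2_sqr//; apply: eq_integral => x _ /=.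
    by rewrite ger0_norm// sqr_ge0.
  by move: nf (nL_ge0 2%:E f); case: (nL _ _ _) => [r| |]; rewrite ?ltxx// => _ _; exact: ltry.
- have := n2_sqr mf; rewrite integ_fin//.
  by case: (nL _ _ _) => [r| |]//; rewrite ?ltry.
Qed.

Lemma n2_le f (c : R) : 0 <= c -> sqint f ->
  (nL Omega 2%:E f <= c%:E)%E <-> intO Omega (fun x => f x ^+ 2) <= c ^+ 2.
Proof.
move=> c0 [mf f2]; have := n2_sqr mf; rewrite integ_fin//.
move: (nL_ge0 2%:E f); case: (nL _ _ _) => [r| |]//; rewrite lee_fin => r0 [<-].
by rewrite lee_fin -expr2 ler_pXn2r.
Qed.

Lemma n2_fin f : sqint f ->
  exists2 r : R, 0 <= r & nL Omega 2%:E f = r%:E /\ r ^+ 2 = intO Omega (fun x => f x ^+ 2).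
Proof.
move=> [mf f2]; have := n2_sqr mf; rewrite integ_fin//.
move: (nL_ge0 2%:E f); case: (nL _ _ _) => [r| |]//; rewrite lee_fin => r0 [H].
by exists r; rewrite // expr2.
Qed.

End IntegralsOnDomain.

(** * Weak partial derivatives and the Sobolev space *)

Section WeakPartials.
Context {R : realType} (Omega : set (R * R)).
Local Notation mu := (@leb2 R).
Hypothesis oO : open Omega.
Hypothesis bO : bounded_set Omega.
Implicit Types (f g h phi psi y w : R * R -> R) (i : bool).

Let mO : measurable (Omega : set (plane R)) := measurable_open2 oO.

Lemma cont_bounded_on (K : set (R * R)) h : bounded_set K -> continuous h ->
  exists2 C : R, 0 < C & forall x, K x -> `|h x| <= C.
Proof.
move=> /bounded_box[M _ KM] ch.
have /compact_bounded [B [Br HB]] : compact (h @` (box (- M) M (- M) M)).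
  apply: continuous_compact; first exact: continuous_subspaceT.
  exact: compact_box.
exists (`|B| + 1) => [|x /KM Kx]; first by rewrite ltr_wpDl.
by apply: (HB (`|B| + 1) _ (h x)); [rewrite ltr_pwDr// ler_norm|exists x].
Qed.

Lemma sqint_cont h : continuous h -> sqint Omega h.
Proof.
move=> ch; have [C _ HC] := cont_bounded_on bO ch.
apply: (sqint_bounded oO bO) (aeO_all HC).
exact: meas_cont.
Qed.

Lemma compact_closed2 (K : set (R * R)) : compact K -> closed K.
Proof. by apply: compact_closed; exact: norm_hausdorff. Qed.

Lemma integ_loc f : integ Omega f -> loc_integrable Omega f.
Proof.
move=> fi; split; first exact: integ_meas fi.
move=> K cK KO; apply: (integrableS mO) => //.
exact: measurable_closed2 (compact_closed2 cK).
Qed.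

Lemma loc_integrableB f g : loc_integrable Omega f -> loc_integrable Omega g ->
  loc_integrable Omega (fun x => f x - g x).
Proof.
move=> [mf lf] [mg lg]; split; first exact: measB.
move=> K cK KO; have mK := measurable_closed2 (compact_closed2 cK).
exact: (integrableB mK (lf K cK KO) (lg K cK KO)).
Qed.

Lemma integ_mul_supported f h (K : set (R * R)) : loc_integrable Omega f ->
  continuous h -> compact K -> K `<=` Omega -> (forall x, ~ K x -> h x = 0) ->
  integ Omega (fun x => f x * h x).
Proof.
move=> [mf lf] ch cK KO h0.
have mK := measurable_closed2 (compact_closed2 cK).
have [C C0 HC] := cont_bounded_on (compact_bounded cK) ch.
have ifK : mu.-integrable K (EFin \o (fun x : plane R => f x * h x)).
  apply: (le_integrable _ _ _ (integrableZl mK C (lf K cK KO))) => //.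
    apply/measurable_EFinP; apply: measurable_funM; first exact: measurable_funS mf.
    by apply: measurable_funTS; exact: measurable_cont2.
  move=> x Kx; rewrite /= lee_fin !normrM mulrC ler_wpM2r//.
  by rewrite (le_trans (HC x Kx))// ler_norm.
have := (integrable_mkcond _ mK).1 ifK; rewrite restrict_EFin.
rewrite (_ : _ \_ K = fun x => f x * h x); last first.
  apply/funext => x; rewrite patchE; case: ifPn => //.
  by rewrite notin_setE => /h0 ->; rewrite mulr0.
by apply: integrableS.
Qed.

(** Both derivatives have the same integrals against test functions, so the
    fundamental lemma applies to their difference. *)
Lemma weak_partial_unique i f g g' : is_weak_partial Omega i f g ->
  is_weak_partial Omega i f g' -> aeO Omega (fun x => g x = g' x).
Proof.
move=> [lf lg Hg] [_ lg' Hg'].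
have := @fundamental_lemma R Omega oO (fun x => g x - g' x) (loc_integrableB lg lg').
move=> H; have /H : forall psi, test_fun Omega psi -> intO Omega (fun x => (g x - g' x) * psi x) = 0.
  move=> psi tpsi; have [spsi [K [cK KO psi0]]] := tpsi.
  have cpsi := (spsi [::]).1.
  have -> : (fun x => (g x - g' x) * psi x) = (fun x => g x * psi x - g' x * psi x).
    by apply/funext => x; rewrite mulrBl.
  rewrite intOB//; [|exact: integ_mul_supported psi0|exact: integ_mul_supported psi0].
  have := Hg _ tpsi; rewrite Hg'// => /eqP; rewrite eqr_opp => /eqP ->.
  by rewrite subrr.
by apply: aeO_imp => x _ /subr0_eq.
Qed.

(** Only the product has to vanish near the boundary; [psi] alone may be any smooth
    function when [phi] is a test function. *)
Lemma intO_by_parts i phi psi (K : set (R * R)) : smooth phi -> smooth psi ->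
  compact K -> K `<=` Omega -> (forall x, ~ K x -> phi x * psi x = 0) ->
  intO Omega (fun x => phi x * 'D_(evec i) psi x) =
  - intO Omega (fun x => 'D_(evec i) phi x * psi x).
Proof.
move=> sphi spsi cK KO K0.
have c1 := (sphi [::]).1; have c2 := (spsi [::]).1.
have c1' := (sphi [:: i]).1; have c2' := (spsi [:: i]).1.
pose F : R * R -> R := fun x => phi x * psi x.
have D x : is_derive x (evec i) F
    (phi x * 'D_(evec i) psi x + psi x * 'D_(evec i) phi x).
  exact: (is_deriveM (DeriveDef ((sphi [::]).2 i x) erefl) (DeriveDef ((spsi [::]).2 i x) erefl)).
have E : 'D_(evec i) F =
    (fun x => phi x * 'D_(evec i) psi x + 'D_(evec i) phi x * psi x).
  by apply/funext => x; have [_ ->] := D x; rewrite [X in _ + X]mulrC.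
pose dF : R * R -> R := 'D_(evec i) F.
have I0 : (\int[mu]_x (dF x)%:E = 0)%E.
  apply: (integral_partial0 cK K0) => [x|]; first by have [] := D x.
  rewrite E => x; apply: cvgD; apply: cvgM.
  - exact: c1. - exact: c2'. - exact: c1'. - exact: c2.
apply/eqP; rewrite -addr_eq0 -intOD//; last 2 first.
- by apply: sqint_mul => //; exact: sqint_cont.
- by apply: sqint_mul => //; exact: sqint_cont.
rewrite /intO /Rintegral; apply/eqP.
suff -> : (\int[mu]_(x in Omega) (phi x * 'D_(evec i) psi x + 'D_(evec i) phi x * psi x)%:E = 0)%E by [].
rewrite -[RHS]I0 integral_mkcond; apply: eq_integral => x _.
have -> : dF x = phi x * 'D_(evec i) psi x + 'D_(evec i) phi x * psi x.
  by have := congr1 (fun f : R * R -> R => f x) E.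
rewrite patchE; case: ifPn => //; rewrite notin_setE => nO.
have nK : ~ K x by move/KO.
have := derive_outside (evec i) (compact_closed2 cK) K0 nK.
by have [_ ->] := D x; rewrite [X in _ + X]mulrC => ->.
Qed.

Lemma test_weak_partial i phi : test_fun Omega phi ->
  is_weak_partial Omega i phi ('D_(evec i) phi).
Proof.
move=> [sphi [K [cK KO K0]]]; split.
- by apply: integ_loc; apply: sqint_integ => //; apply: sqint_cont; exact: (sphi [::]).1.
- by apply: integ_loc; apply: sqint_integ => //; apply: sqint_cont; exact: (sphi [:: i]).1.
- move=> psi [spsi _]; apply: (intO_by_parts _ sphi spsi cK KO) => x /K0 ->.
  by rewrite mul0r.
Qed.

Lemma weak_partialB i f g f' g' : is_weak_partial Omega i f g ->
  is_weak_partial Omega i f' g' ->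
  is_weak_partial Omega i (f \- f') (fun x => g x - g' x).
Proof.
move=> [lf lg H] [lf' lg' H']; split; [exact: loc_integrableB|exact: loc_integrableB|].
move=> phi tphi; have [sphi [K [cK KO K0]]] := tphi.
have c := (sphi [::]).1; have c' := (sphi [:: i]).1.
have K0' x : ~ K x -> 'D_(evec i) phi x = 0.
  exact: derive_outside (compact_closed2 cK) K0.
have -> : (fun x => (f \- f') x * 'D_(evec i) phi x) =
    (fun x => f x * 'D_(evec i) phi x - f' x * 'D_(evec i) phi x).
  by apply/funext => x; rewrite mulrBl.
have -> : (fun x => (g x - g' x) * phi x) = (fun x => g x * phi x - g' x * phi x).
  by apply/funext => x; rewrite mulrBl.
rewrite intOB//; [|exact: integ_mul_supported K0'|exact: integ_mul_supported K0'].
rewrite intOB//; [|exact: integ_mul_supported K0|exact: integ_mul_supported K0].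
by rewrite H// H'// opprB opprK addrC.
Qed.

Lemma wdP i f g : is_weak_partial Omega i f g -> is_weak_partial Omega i f (wd Omega i f).
Proof. by move=> H; rewrite /wd; case: xgetP => [_ -> //|/(_ g)]. Qed.

(** The chosen derivative [wd] may be replaced by any other one under integrals. *)
Lemma wd_ae i f g : is_weak_partial Omega i f g -> aeO Omega (fun x => wd Omega i f x = g x).
Proof. by move=> H; exact: (weak_partial_unique (wdP H) H). Qed.

Lemma meas_wd i f g : is_weak_partial Omega i f g -> meas Omega (wd Omega i f).
Proof. by move=> /wdP[_ []]. Qed.

Lemma sqint_ae f g : meas Omega f -> sqint Omega g -> aeO Omega (fun x => f x = g x) ->
  sqint Omega f.
Proof.
move=> mf sg fg; apply: (sqint_le oO mf sg).
by move: fg; apply: aeO_imp => x _ ->.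
Qed.

Lemma W1_wd f : W1 Omega 2%:E f -> sqint Omega f /\
  forall i, is_weak_partial Omega i f (wd Omega i f) /\ sqint Omega (wd Omega i f).
Proof.
move=> [/Lp2_sqint sf H]; split; first exact: sf.
move=> i; have [g [Hg /Lp2_sqint sg]] := H i; split; first exact: wdP Hg.
apply: (sqint_ae _ (sg _)) => //; [exact: meas_wd Hg|exact: wd_ae Hg].
Qed.

Lemma wdB i f g : W1 Omega 2%:E f -> W1 Omega 2%:E g ->
  sqint Omega (wd Omega i (f \- g)) /\
  aeO Omega (fun x => wd Omega i (f \- g) x = wd Omega i f x - wd Omega i g x).
Proof.
move=> /W1_wd[_ /(_ i)[Hf sf]] /W1_wd[_ /(_ i)[Hg sg]].
have H := weak_partialB Hf Hg.
split; last exact: wd_ae H.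
by apply: (sqint_ae (meas_wd H)) (wd_ae H); exact: sqintB.
Qed.

Lemma test_W1 phi : test_fun Omega phi -> W1 Omega 2%:E phi.
Proof.
move=> tphi; have [sphi _] := tphi; split.
  by apply/Lp2_sqint => //; apply: sqint_cont; exact: (sphi [::]).1.
move=> i; exists ('D_(evec i) phi); split; first exact: test_weak_partial.
by apply/Lp2_sqint => //; apply: sqint_cont; exact: (sphi [:: i]).1.
Qed.

Lemma test_cst0 : test_fun Omega (cst 0).
Proof.
split; last by exists set0; split => //; exact: compact0.
have H : algebra set0 (cst 0 : R * R -> R) by exact: algebra_cst.
by apply: (smooth_algebra _ H) => f [].
Qed.

Lemma test_H10 phi : test_fun Omega phi -> H10 Omega phi.
Proof.
move=> tphi; split; first exact: test_W1.
move=> e e0; exists phi; split => //.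
have -> : (phi \- phi)%R = cst 0 by apply/funext => x; rewrite /= subrr.
have Z f : sqint Omega f -> aeO Omega (fun x => f x = 0) -> (nL Omega 2%:E f <= 0%:E)%E.
  move=> sf f0; apply/n2_le => //; rewrite expr0n/=.
  rewrite (@eq_intO _ _ _ _ (fun=> 0)) //.
  - by rewrite /intO /Rintegral integral0.
  - exact: integ_meas sf.2.
  - exact: meas_cst.
  - by move: f0; apply: aeO_imp => x _ ->; rewrite expr0n.
apply: (@le_lt_trans _ _ 0%E); last by rewrite lte_fin.
have t0 := test_cst0.
have Zw i : (nL Omega 2%:E (wd Omega i (cst 0%R)) <= 0%:E)%E.
  have [_ /(_ i)[Hw sw]] := W1_wd (test_W1 t0).
  apply: Z => //; have := wd_ae (test_weak_partial i t0).
  by apply: aeO_imp => x _ ->; exact: derive_cst.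
rewrite /nW1 big_bool/= -(adde0 0%E); apply: leeD.
  by apply: Z; [apply: sqint_cont; exact: (t0.1 [::]).1|exact: aeO_all].
by rewrite -(adde0 0%E); apply: leeD; exact: Zw.
Qed.

(** By uniqueness, the weak derivative of [y - phi] is the difference of the weak
    derivative of [y] and the classical one of [phi]. *)
Lemma H10_approx y (e : R) : H10 Omega y -> 0 < e -> exists phi,
  [/\ test_fun Omega phi, intO Omega (fun x => (y x - phi x) ^+ 2) <= e &
   forall i, intO Omega (fun x => (wd Omega i y x - 'D_(evec i) phi x) ^+ 2) <= e].
Proof.
move=> [Wy Hy] e0; have r0 : 0 < Num.sqrt e by rewrite sqrtr_gt0.
have [phi [tphi]] := Hy _ r0; rewrite /nW1 big_bool/= => /ltW H.
have [sy wy] := W1_wd Wy; have [sphi wphi] := W1_wd (test_W1 tphi).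
have P p f := @nL_ge0 R Omega p f.
have [H0 H1 H2] : [/\ (nL Omega 2%:E (y \- phi)%R <= (Num.sqrt e)%:E)%E,
    (nL Omega 2%:E (wd Omega true (y \- phi)%R) <= (Num.sqrt e)%:E)%E &
    (nL Omega 2%:E (wd Omega false (y \- phi)%R) <= (Num.sqrt e)%:E)%E].
  split; apply: le_trans H.
  - by rewrite leeDl// adde_ge0.
  - by rewrite addeCA leeDl// adde_ge0.
  - by rewrite addeA leeDr// adde_ge0.
exists phi; split => //.
  have := (n2_le oO (ltW r0) (sqintB oO sy sphi)).1 H0.
  by rewrite sqr_sqrtr// ltW.
move=> i; have [sw Ew] := wdB i Wy (test_W1 tphi).
have : (nL Omega 2%:E (wd Omega i (y \- phi)%R) <= (Num.sqrt e)%:E)%E by case: i {sw Ew}.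
move=> /(n2_le oO (ltW r0) sw); rewrite sqr_sqrtr; last exact: ltW.
apply: le_trans.
rewrite le_eqVlt; apply/orP; left; apply/eqP; apply: eq_intO => //.
- apply: measX; apply: measB; first by have [_ []] := wy i.
  by apply: meas_cont; exact: (tphi.1 [:: i]).1.
- by apply: measX; exact: sw.1.
- have := aeO_and Ew (wd_ae (test_weak_partial i tphi)).
  by apply: aeO_imp => x _ [-> ->].
Qed.

End WeakPartials.

(** * Passing to the limit along test functions *)

Section EnergyEstimate.
Context {R : realType} (Omega : set (R * R)).
Local Notation mu := (@leb2 R).
Hypothesis oO : open Omega.
Hypothesis bO : bounded_set Omega.
Implicit Types (f g h phi psi y w : R * R -> R) (i : bool).

Let mO : measurable (Omega : set (plane R)) := measurable_open2 oO.

Let sqi_cont h (ch : continuous h) : sqint Omega h := sqint_cont oO bO ch.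

Lemma meas_ltr f g : meas Omega f -> meas Omega g ->
  measurable_fun (Omega : set (plane R)) (fun x : plane R => f x < g x).
Proof. exact: measurable_fun_ltr. Qed.

Lemma meas_if (b : R * R -> bool) f g :
  measurable_fun (Omega : set (plane R)) (b : plane R -> bool) ->
  meas Omega f -> meas Omega g -> meas Omega (fun x => if b x then f x else g x).
Proof.
move=> mb mf mg; apply: measurable_fun_if => //.
  apply: measurable_funS mf => //; exact: subIsetl.
apply: measurable_funS mg => //; exact: subIsetl.
Qed.

Definition tail f (M : R) : R * R -> R := fun x => if M < f x then f x else 0.

Lemma integ_tail f M : integ Omega f -> integ Omega (tail f M).
Proof.
move=> fi; have mf := integ_meas fi.
apply: (integ_le oO _ (integ_norm fi)).
  apply: meas_if => //; last exact: meas_cst.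
  by apply: meas_ltr => //; exact: meas_cst.
by apply: aeO_all => x _; rewrite /tail; case: ifP; rewrite ?normr0.
Qed.

Lemma small_tail f e : integ Omega f -> 0 < e -> exists2 M : R, 0 < M & intO Omega (tail f M) <= e.
Proof.
move=> fi e0.
have m1 n : measurable_fun (Omega : set (plane R)) (fun x : plane R => (tail f n.+1%:R x)%:E).
  exact: measurable_int (integ_tail _ fi).
have m2 : measurable_fun (Omega : set (plane R)) (fun x : plane R => 0%:E : \bar R).
  exact: measurable_cst.
have cv : {ae mu, forall x, Omega x -> (fun n => (tail f n.+1%:R x)%:E) @ \oo --> (0%:E : \bar R)}.
  apply: aeW => x _; apply: cvg_near_cst; near=> n.
  rewrite /tail ifF//; apply/negbTE; rewrite -leNgt.
  near: n; exists (Num.trunc `|f x|) => // n /= nx.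
  apply: (le_trans (ler_norm _)); apply/ltW/(lt_le_trans (truncnS_gt _)).
  by rewrite ler_nat.
have dom : {ae mu, forall x n, Omega x -> (`|(tail f n.+1%:R x)%:E| <= `|(f x)%:E|)%E}.
  by apply: aeW => x n _; rewrite lee_fin /tail; case: ifP; rewrite ?normr0.
have [_ _] := dominated_convergence mO m1 m2 cv (integrable_abse fi) dom.
rewrite integral0 => /fine_cvgP[_ /cvgrPdist_le /(_ e e0)[N _ /(_ N (leqnn _))]].
rewrite /= sub0r normrN => H; exists N.+1%:R; first exact: ltr0Sn.
by apply: le_trans H; exact: ler_norm.
Unshelve. all: by end_near.
Qed.

(** Convergence in the Sobolev norm is enough to pass to the limit, without
    extracting an almost everywhere convergent subsequence: where the integrable
    weight [k * wd i y] is bounded the Lipschitz bound on [q] applies, and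
    elsewhere the weight has small integral. *)
Lemma intO_pass_limit i k y (q : R -> R) (L e : R) :
  sqint Omega k -> sqint Omega y -> sqint Omega (wd Omega i y) ->
  continuous q -> (forall s, `|q s| <= 1) ->
  (forall s s', `|q s - q s'| <= L * `|s - s'|) -> 0 < L -> 0 < e ->
  exists2 d : R, 0 < d & forall phi, test_fun Omega phi ->
    intO Omega (fun x => (y x - phi x) ^+ 2) <= d ->
    intO Omega (fun x => (wd Omega i y x - 'D_(evec i) phi x) ^+ 2) <= d ->
    `|intO Omega (fun x => k x * 'D_(evec i) phi x * q (phi x)) -
      intO Omega (fun x => k x * wd Omega i y x * q (y x))| <= e.
Proof.
move=> sk sy sw cq q1 qL L0 e0.
set w := wd Omega i y in sw *.
pose f (x : R * R) : R := `|k x * w x|.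
have fi : integ Omega f by apply: integ_norm; exact: sqint_mul.
have e8 : 0 < e / 8 by rewrite divr_gt0.
have [M M0 HM] := small_tail fi e8.
pose A := intO Omega (fun x => k x ^+ 2).
pose B := intO Omega (fun=> 1 : R).
have A0 : 0 <= A by apply: intO_ge0 => x _; exact: sqr_ge0.
have B0 : 0 <= B by apply: intO_ge0.
(* Young weights that make each of the four error terms at most [e / 8]. *)
pose eta := e / (8 * (A + 1)).
have eta0 : 0 < eta by rewrite divr_gt0// mulr_gt0// ltr_wpDl.
pose eta' := e / (8 * (M * L) * (B + 1)).
have eta'0 : 0 < eta' by rewrite divr_gt0// !mulr_gt0// ltr_wpDl.
pose d := Num.min (e / 8 * eta) (e / (8 * (M * L)) * eta').
have d0 : 0 < d.
  rewrite lt_min; apply/andP; split; first exact: mulr_gt0.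
  by rewrite mulr_gt0// divr_gt0// !mulr_gt0.
exists d => // phi tphi Hy Hw.
set p := 'D_(evec i) phi in Hw *.
have sphi : sqint Omega phi by apply: sqi_cont; exact: (tphi.1 [::]).1.
have sp : sqint Omega p by apply: sqi_cont; exact: (tphi.1 [:: i]).1.
have mq g : meas Omega g -> meas Omega (fun x => q (g x)).
  by move=> mg; apply: meas_comp mg; exact: continuous_measurable_fun.
have iq g g' : integ Omega g -> meas Omega g' -> integ Omega (fun x => g x * q (g' x)).
  move=> gi mg'; apply: (integ_le oO _ (integ_norm gi)).
    by apply: measM; [exact: integ_meas gi|exact: mq].
  by apply: aeO_all => x _; rewrite normrM ler_piMr.
have i1 := iq _ _ (sqint_mul oO sk sp) sphi.1.
have i2 := iq _ _ (sqint_mul oO sk sw) sy.1.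
rewrite -intOB//; apply: (le_trans (le_norm_intO oO (integB oO i1 i2))).
pose D1 (x : R * R) : R := (y x - phi x) ^+ 2; pose D2 (x : R * R) : R := (w x - p x) ^+ 2.
have iD1 : integ Omega D1 by exact: (sqintB oO sy sphi).2.
have iD2 : integ Omega D2 by exact: (sqintB oO sw sp).2.
pose bnd (x : R * R) : R := (eta * k x ^+ 2 + eta^-1 * D2 x) +
  (2 * tail f M x + (M * L * eta' + M * L * eta'^-1 * D1 x)).
have ik2 := integZ oO eta sk.2.
have iD2' := integZ oO eta^-1 iD2.
have it := integZ oO 2 (integ_tail M fi).
have iD1' := integZ oO (M * L * eta'^-1) iD1.
have ic := integ_cst oO bO (M * L * eta').
have icD := integD oO ic iD1'.
have ibnd : integ Omega bnd by apply: integD => //; [exact: integD|exact: integD].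
apply: (@le_trans _ _ (intO Omega bnd)).
  apply: (le_intO oO _ ibnd); first by apply: integ_norm; exact: integB.
  apply: aeO_all => x _.
  have young (a b c : R) : 0 < c -> `|a| * `|b| <= c * a ^+ 2 + c^-1 * b ^+ 2.
    move=> c0; rewrite -(real_normK (num_real a)) -(real_normK (num_real b)).
    move: (normr_ge0 a) (normr_ge0 b) => a0 b0; set u := `|a|; set v := `|b|.
    rewrite -(ler_pM2l c0) mulrDr [c * (c^-1 * _)]mulrA divff ?gt_eqF// mul1r.
    have := sqr_ge0 (c * u - v); have := sqr_ge0 (c * u); have := sqr_ge0 v.
    rewrite sqrrB exprMn; nra.
  have E : k x * p x * q (phi x) - k x * w x * q (y x) =
      k x * (p x - w x) * q (phi x) + k x * w x * (q (phi x) - q (y x)) by ring.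
  rewrite E; apply: (le_trans (ler_normD _ _)); apply: lerD.
    rewrite normrM; apply: (@le_trans _ _ (`|k x| * `|w x - p x|)); last exact: young.
    by rewrite normrM [`|p x - _|]distrC ler_piMr// mulr_ge0.
  rewrite normrM -/(f x) /tail.
  have f0 : 0 <= f x by rewrite normr_ge0.
  have D0 : 0 <= D1 x by exact: sqr_ge0.
  have q2 : `|q (phi x) - q (y x)| <= 2.
    by apply: (le_trans (ler_normB _ _)); have := q1 (phi x); have := q1 (y x); lra.
  have ML : 0 <= M * L by rewrite mulr_ge0// ltW.
  have e1 : 0 <= eta' by exact: ltW.
  case: ltP => fM.
    rewrite [X in _ <= X]addrC; apply: ler_wpDl.
      by apply: addr_ge0; [exact: mulr_ge0|apply: mulr_ge0 => //; apply: mulr_ge0 => //; rewrite invr_ge0].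
    by rewrite mulrC ler_wpM2r.
  rewrite mulr0 add0r.
  apply: (@le_trans _ _ (M * (L * `|phi x - y x|))).
    by apply: ler_pM => //; exact: qL.
  have := young 1 (y x - phi x) eta' eta'0.
  rewrite normr1 mul1r expr1n mulr1 distrC -/(D1 x) => H.
  by have := ler_wpM2l ML H; rewrite mulrDr !mulrA.
rewrite /bnd !intOD//; last 2 first.
- exact: integD.
- exact: integD.
rewrite (intO_cst oO bO) !intOZ//; last 2 first.
- exact: integ_tail.
- exact: sk.2.
rewrite -/A -/B.
have {}Hy : intO Omega D1 <= d by [].
have {}Hw : intO Omega D2 <= d by [].
have dle1 : d <= e / 8 * eta by rewrite ge_min lexx.
have dle2 : d <= e / (8 * (M * L)) * eta' by rewrite ge_min lexx orbT.
have T1 : eta * A <= e / 8.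
  rewrite /eta invfM mulrA -mulrA ger_pMr// mulrC ler_pdivrMr ?ltr_wpDl// mul1r lerDl//.
have T2 : eta^-1 * intO Omega D2 <= e / 8.
  by rewrite ler_pdivrMl// mulrC; exact: le_trans dle1.
have T3 : M * L * eta' * B <= e / 8.
  have -> : M * L * eta' = e / 8 / (B + 1).
    by rewrite /eta'; field; rewrite !gt_eqF// ltr_wpDl.
  rewrite -mulrA ger_pMr// mulrC ler_pdivrMr ?ltr_wpDl// mul1r lerDl//.
have T4 : M * L / eta' * intO Omega D1 <= e / 8.
  have ML : 0 < M * L by rewrite mulr_gt0.
  apply: (@le_trans _ _ (M * L / eta' * (e / (8 * (M * L)) * eta'))).
    by apply: ler_wpM2l; [rewrite divr_ge0// ltW|exact: le_trans dle2].
  by rewrite le_eqVlt; apply/orP; left; apply/eqP; field; rewrite !gt_eqF.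
lra.
Qed.

End EnergyEstimate.

(** * Flux and energy through strips around a level *)

Section LevelStrips.
Context {R : realType} (Omega : set (R * R)).
Local Notation mu := (@leb2 R).
Hypothesis oO : open Omega.
Hypothesis bO : bounded_set Omega.
Implicit Types (f g h phi psi y w u : R * R -> R) (i : bool) (t k : R).

Lemma add_approx (a a' b b' c e : R) : `|a - b| <= e / 2 -> `|a' - b'| <= e / 2 ->
  `|a + a'| <= c -> b + b' <= c + e.
Proof. by rewrite !ler_norml => /andP[? ?] /andP[? ?] /andP[? ?]; lra. Qed.

Lemma add_le_split (a b c : R) : 0 <= a -> 0 <= b -> a + b <= c -> a <= c /\ b <= c.
Proof. by move=> a0 b0 abc; split; lra. Qed.

Lemma half_le (c a W s : R) : 0 < c -> c <= a -> 0 <= W -> 2^-1 <= s ->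
  c / 2 * W <= a * W * s.
Proof.
move=> c0 ca W0 s2; rewrite mulrAC; apply: ler_pM => //; first by rewrite mulr_ge0// ltW.
exact: ler_wpM2r.
Qed.

Definition strip y t k f : R * R -> R := fun x => if `|y x - t| <= k then f x else 0.

Lemma meas_strip y t k f : meas Omega y -> meas Omega f -> meas Omega (strip y t k f).
Proof.
move=> my mf; apply: (meas_if oO) => //; last exact: meas_cst.
apply: measurable_fun_ler; last exact: meas_cst.
by apply: meas_norm; apply: measB => //; exact: meas_cst.
Qed.

Lemma integ_strip y t k f : meas Omega y -> integ Omega f -> integ Omega (strip y t k f).
Proof.
move=> my fi; apply: (integ_le oO _ (integ_norm fi)).
  by apply: meas_strip => //; exact: integ_meas fi.
by apply: aeO_all => x _; rewrite /strip; case: ifP; rewrite ?normr0.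
Qed.

Lemma continuous_slope t k : 0 < k -> continuous (slope t k).
Proof.
move=> k0 s; apply: differentiable_continuous; apply/derivable1_diffP.
by have [] := @is_derive_slope _ t k k0 s.
Qed.

Lemma slope_norm1 t k s : `|slope t k s| <= 1.
Proof. by rewrite ger0_norm ?slope_le1// ltW// slope_gt0. Qed.

Lemma slope_lipschitz t k : 0 < k -> forall s s', `|slope t k s - slope t k s'| <= k^-1 * `|s - s'|.
Proof. by move=> k0 s s'; rewrite mulrC; exact: slope_lip. Qed.

(** Integrating by parts against the smooth truncation of [y], which vanishes
    on the boundary, so that [psi] needs no compact support. *)
Lemma strip_flux i t k y psi : 0 < k -> H10 Omega y -> smooth psi ->
  `|intO Omega (fun x => psi x * wd Omega i y x * slope t k (y x))| <=
  k * pi * intO Omega (fun x => `|'D_(evec i) psi x|).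
Proof.
move=> k0 Hy spsi.
have [sy wy] := W1_wd oO Hy.1; have [_ sw] := wy i.
have spsi0 := sqint_cont oO bO (spsi [::]).1.
have spsi1 := sqint_cont oO bO (spsi [:: i]).1.
rewrite -[leLHS]subr0; apply/ler_addgt0Pr => e e0; rewrite subr0.
have [d d0 Hd] := intO_pass_limit oO bO spsi0 sy sw (@continuous_slope t k k0)
  (@slope_norm1 t k) (@slope_lipschitz t k k0) (etrans (invr_gt0 k) k0) e0.
have [phi [tphi Hphi /(_ i) Hw]] := H10_approx oO bO Hy d0.
have := Hd phi tphi Hphi Hw.
set I1 := intO _ _; set I2 := intO _ _ => H12.
have B1 : `|I1| <= k * pi * intO Omega (fun x => `|'D_(evec i) psi x|).
  have [stphi [K [cK KO K0]]] := @test_trunc _ t k k0 _ _ tphi.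
  have := @intO_by_parts R Omega oO bO i _ _ K stphi spsi cK KO.
  have -> : I1 = intO Omega (fun x => 'D_(evec i) (fun x => trunc t k (phi x)) x * psi x).
    congr intO; apply/funext => x.
    have [_ ->] := @is_derive_test_trunc _ t k k0 _ _ i x tphi.
    by rewrite [RHS]mulrC mulrA mulrAC.
  move=> H; rewrite -normrN -H; last by move=> x /K0 ->; rewrite mul0r.
  have it : integ Omega (fun x => trunc t k (phi x) * 'D_(evec i) psi x).
    by apply: sqint_mul => //; apply: (sqint_cont oO bO); exact: (stphi [::]).1.
  apply: (le_trans (le_norm_intO oO it)).
  rewrite -(intOZ oO); last by apply: integ_norm; exact: sqint_integ.
  apply: le_intO => //; [exact: integ_norm|by apply: integZ => //; apply: integ_norm; exact: sqint_integ|].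
  by apply: aeO_all => x _; rewrite normrM ler_wpM2r// trunc_bound.
have -> : I2 = I1 - (I1 - I2) by rewrite opprB addrC subrK.
by apply: (le_trans (ler_normB _ _)); exact: lerD.
Qed.

(** Testing the equation with the smooth truncation of [y]: the strip where [y]
    is within [k] of [t] carries energy of order [k] only, because the right-hand
    side of the equation is multiplied by a function of size [k] while the gradient
    is multiplied by at least [1 / 2] in the strip. *)
Lemma strip_energy (A u y : R * R -> R) (c0 Ca t : R) : 0 < c0 ->
  meas Omega A -> aeO Omega (fun x => c0 <= A x <= Ca) -> sqint Omega u ->
  H10 Omega y ->
  (forall w, H10 Omega w -> intO Omega (fun x => A x * gdot Omega y w x) =
                            intO Omega (fun x => u x * w x)) ->
  forall i k, 0 < k -> intO Omega (strip y t k (fun x => wd Omega i y x ^+ 2)) <=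
    2 * pi / c0 * intO Omega (fun x => `|u x|) * k.
Proof.
move=> c00 mA Ab su Hy Heq i k k0.
have [sy wy] := W1_wd oO Hy.1.
have sw j := (wy j).2.
have Ab' : aeO Omega (fun x => `|A x| <= Ca).
  by move: Ab; apply: aeO_imp => x _ /andP[H1 H2]; rewrite ger0_norm// (le_trans _ H1)// ltW.
pose kk j x := A x * wd Omega j y x.
have skk j : sqint Omega (kk j) by exact: (sqint_mulb oO mA Ab' (sw j)).
pose J j := intO Omega (fun x => kk j x * wd Omega j y x * slope t k (y x)).
have mq g : meas Omega g -> meas Omega (fun x => slope t k (g x)).
  by move=> mg; apply: meas_comp mg; apply: continuous_measurable_fun; exact: continuous_slope.
have iq g g' : integ Omega g -> meas Omega g' -> integ Omega (fun x => g x * slope t k (g' x)).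
  move=> gi mg'; apply: (integ_le oO _ (integ_norm gi)).
    by apply: measM; [exact: integ_meas gi|exact: mq].
  by apply: aeO_all => x _; rewrite normrM ler_piMr// slope_norm1.
have iJ j : integ Omega (fun x => kk j x * wd Omega j y x * slope t k (y x)).
  by apply: iq; [exact: sqint_mul|exact: sy.1].
have J0 j : 0 <= J j.
  rewrite /J; rewrite -[X in X <= _](_ : intO Omega (fun=> 0) = 0); last first.
    by rewrite /intO /Rintegral integral0.
  apply: (le_intO oO (integ_cst oO bO 0) (iJ j)).
  move: Ab; apply: aeO_imp => x _ /andP[Ac _].
  rewrite /kk -!mulrA mulr_ge0//; first by apply: le_trans Ac; exact: ltW.
  by rewrite mulrA -expr2 mulr_ge0// ?sqr_ge0// ltW// slope_gt0.
have Hsum : J false + J true <= k * pi * intO Omega (fun x => `|u x|).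
  apply/ler_addgt0Pr => e e0; have e2 : 0 < e / 2 by rewrite divr_gt0.
  have k1 : 0 < k^-1 by rewrite invr_gt0.
  have [d1 d10 Hd1] := intO_pass_limit oO bO (skk false) sy (sw false) (@continuous_slope t k k0)
    (@slope_norm1 t k) (@slope_lipschitz t k k0) k1 e2.
  have [d2 d20 Hd2] := intO_pass_limit oO bO (skk true) sy (sw true) (@continuous_slope t k k0)
    (@slope_norm1 t k) (@slope_lipschitz t k k0) k1 e2.
  have d0 : 0 < Num.min d1 d2 by rewrite lt_min d10 d20.
  have [phi [tphi Hphi Hw]] := H10_approx oO bO Hy d0.
  have m1 : Num.min d1 d2 <= d1 by rewrite ge_min lexx.
  have m2 : Num.min d1 d2 <= d2 by rewrite ge_min lexx orbT.
  pose I j := intO Omega (fun x => kk j x * 'D_(evec j) phi x * slope t k (phi x)).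
  have HI1 : `|I false - J false| <= e / 2 :=
    Hd1 phi tphi (le_trans Hphi m1) (le_trans (Hw false) m1).
  have HI2 : `|I true - J true| <= e / 2 :=
    Hd2 phi tphi (le_trans Hphi m2) (le_trans (Hw true) m2).
  have tt := @test_trunc _ t k k0 _ _ tphi.
  have sphi : meas Omega phi by apply: meas_cont; exact: (tphi.1 [::]).1.
  have ikk j : integ Omega (fun x => kk j x * 'D_(evec j) phi x * slope t k (phi x)).
    apply: iq => //; apply: sqint_mul => //.
    by apply: (sqint_cont oO bO); exact: (tphi.1 [:: j]).1.
  have E : I false + I true = intO Omega (fun x => u x * trunc t k (phi x)).
    rewrite -Heq; last exact: (test_H10 oO bO).
    rewrite /I -(intOD oO)//; apply: eq_intO => //.
    - by apply: integ_meas; exact: integD.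
    - rewrite /gdot; apply: measM => //.
      have H j : meas Omega (fun x => wd Omega j y x * wd Omega j (fun x => trunc t k (phi x)) x).
        apply: measM; first exact: (sw j).1.
        exact: (meas_wd (test_weak_partial oO bO j tt)).
      rewrite (_ : (fun x => _) = fun x => wd Omega true y x * wd Omega true (fun x => trunc t k (phi x)) x +
          wd Omega false y x * wd Omega false (fun x => trunc t k (phi x)) x).
        exact: measD.
      by apply/funext => x; rewrite big_bool.
    - have := aeO_and (wd_ae oO (test_weak_partial oO bO true tt))
                      (wd_ae oO (test_weak_partial oO bO false tt)).
      apply: aeO_imp => x _ [E1 E2]; rewrite /gdot big_bool /= E1 E2.
      have [_ ->] := @is_derive_test_trunc _ t k k0 _ _ true x tphi.
      have [_ ->] := @is_derive_test_trunc _ t k k0 _ _ false x tphi.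
      have R6 (a p q s c d : R) :
        a * p * c * s + a * q * d * s = a * (q * (s * d) + p * (s * c)) by ring.
      exact: R6.
  have B : `|I false + I true| <= k * pi * intO Omega (fun x => `|u x|).
    have it : integ Omega (fun x => u x * trunc t k (phi x)).
      by apply: sqint_mul => //; apply: (sqint_cont oO bO); exact: (tt.1 [::]).1.
    rewrite E; apply: (le_trans (le_norm_intO oO it)).
    have iu := integ_norm (sqint_integ oO bO su).
    rewrite -(intOZ oO)//.
    apply: (le_intO oO) => //; [exact: integ_norm|exact: integZ|].
    by apply: aeO_all => x _; rewrite normrM mulrC ler_wpM2r// trunc_bound.
  exact: add_approx HI1 HI2 B.
have Ji : J i <= k * pi * intO Omega (fun x => `|u x|).
  have [H1 H2] := add_le_split (J0 false) (J0 true) Hsum.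
  by case: i; [exact: H2|exact: H1].
rewrite -(ler_pM2l (_ : 0 < c0 / 2)) ?divr_gt0//.
have -> : c0 / 2 * (2 * pi / c0 * intO Omega (fun x => `|u x|) * k) =
    k * pi * intO Omega (fun x => `|u x|).
  by move: (intO _ _) => c; field; rewrite gt_eqF.
apply: le_trans Ji.
have ist : integ Omega (strip y t k (fun x => wd Omega i y x ^+ 2)).
  by apply: integ_strip; [exact: sy.1|exact: (sw i).2].
rewrite -(intOZ oO)//; apply: (le_intO oO) => //; first exact: integZ.
move: Ab; apply: aeO_imp => x _ /andP[Ac _].
rewrite /strip; case: ifP => yk; last first.
  rewrite mulr0 /kk -!mulrA mulr_ge0//; first by apply: le_trans Ac; exact: ltW.
  by rewrite mulrA -expr2 mulr_ge0// ?sqr_ge0// ltW// slope_gt0.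
rewrite /kk -[A x * _ * _]mulrA -expr2.
by apply: half_le => //; [exact: sqr_ge0|exact: slope_ge].
Qed.

End LevelStrips.

(** * The coefficient and its one-sided derivatives *)

Section OneSidedCalculus.
Context {R : realType}.
Implicit Types (D : set R) (f : R -> R) (x y l M : R).

Lemma within_dnbhsP D x (P : set R) :
  (\forall y \near within D x^', P y) <->
  exists2 e : R, 0 < e & forall y, `|y - x| < e -> y != x -> D y -> P y.
Proof.
split => [/nbhs_ballP[e /= e0 He]|[e e0 He]].
  by exists e => // y yx yNx Dy; apply: He => //; rewrite /ball/= distrC.
apply/nbhs_ballP; exists e => //= y; rewrite /ball/= distrC => yx yNx Dy.
exact: He.
Qed.

Lemma dquot_is_derive D f x l : nbhs x D ->
  dquot f x y @[y --> within D x^'] --> l -> is_derive x (1 : R) f l.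
Proof.
move=> /nbhs_ballP[d /= d0 xD] Hl.
have H : h^-1 *: ((f \o shift x) (h *: (1 : R)) - f x) @[h --> 0^'] --> l.
  apply/cvgrPdist_le => e e0.
  move/cvgrPdist_le : Hl => /(_ e e0) /within_dnbhsP[e1 e10 He1].
  near=> h.
  have h0 : h != 0 by near: h; exact: nbhs_dnbhs_neq.
  have hd : `|h| < d by near: h; exact: dnbhs0_lt.
  have he : `|h| < e1 by near: h; exact: dnbhs0_lt.
  have := He1 (h + x); rewrite addrK /dquot addrK => /(_ he).
  rewrite /= /GRing.scale/= mulr1 mulrC; apply.
    by rewrite -subr_eq0 addrK.
  by apply: xD; rewrite /ball/= distrC addrK.
by split; [apply/cvg_ex; exists l|exact: cvg_lim].
Unshelve. all: by end_near.
Qed.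

Lemma dquot_continuous D f : (forall x, D x -> cvg (dquot f x y @[y --> within D x^'])) ->
  {within D, continuous f}.
Proof.
move=> Hf; apply/subspace_continuousP => x Dx.
have /cvg_ex[/= l Hl] := Hf x Dx.
apply/cvgrPdist_le => e e0.
move/cvgrPdist_le : Hl => /(_ 1 ltr01) /within_dnbhsP[d d0 Hd].
have L0 : 0 < `|l| + 1 by rewrite ltr_wpDl.
apply/nbhs_ballP; exists (Num.min d (e / (`|l| + 1))).
  by rewrite /= lt_min d0 divr_gt0.
move=> y; rewrite /ball/= lt_min => /andP[yd ye] Dy.
have [->|yx] := eqVneq y x; first by rewrite subrr normr0 ltW.
have := Hd y; rewrite distrC => /(_ yd yx Dy).
rewrite /dquot => H.
have H1 : `|(f y - f x) / (y - x)| <= `|l| + 1.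
  have := ler_normB l (l - (f y - f x) / (y - x)); rewrite subKr; lra.
have yx0 : 0 < `|y - x| by rewrite normr_gt0 subr_eq0.
move: H1; rewrite normrM normfV ler_pdivrMr// distrC => H1.
apply: (le_trans H1); rewrite distrC -ler_pdivlMl// mulrC; exact: ltW.
Qed.

Lemma within_bounded D f M : closed D -> {within D, continuous f} ->
  exists2 C : R, 0 < C & forall t, D t -> `|t| <= M -> `|f t| <= C.
Proof.
move=> cD cf.
have cK : compact (D `&` `[- M, M]).
  by rewrite setIC; apply: compact_closedI => //; exact: segment_compact.
have /compact_bounded [B [Br HB]] : compact (f @` (D `&` `[- M, M])).
  apply: continuous_compact => //; apply: continuous_subspaceW cf; exact: subIsetl.
exists (`|B| + 1) => [|t Dt tM]; first by rewrite ltr_wpDl.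
apply: (HB (`|B| + 1) _ (f t)); first by rewrite ltr_pwDr// ler_norm.
by exists t => //; split => //=; rewrite in_itv/= -ler_norml.
Qed.

Lemma dwithinP D f x : D x -> cvg (dquot f x y @[y --> within D x^']) ->
  dquot f x y @[y --> within D x^'] --> dwithin D f x.
Proof. by []. Qed.

Lemma dwithin_lip D f M : is_interval D -> closed D -> C2_on D f ->
  exists2 B : R, 0 < B & forall s s', D s -> D s' -> `|s| <= M -> `|s'| <= M ->
    `|dwithin D f s - dwithin D f s'| <= B * `|s - s'|.
Proof.
move=> iD cD [H1 H2 H3]; have [B B0 HB] := within_bounded M cD H3; exists B => //.
suff H s s' : s < s' -> D s -> D s' -> `|s| <= M -> `|s'| <= M ->
    `|dwithin D f s - dwithin D f s'| <= B * `|s - s'|.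
  move=> s s' Ds Ds' sM s'M; have [ss|ss|->] := ltgtP s s'; first exact: H.
    by rewrite distrC [`|s - s'|]distrC; exact: H.
  by rewrite !subrr normr0 mulr0.
move=> ss Ds Ds' sM s'M.
have sub : `[s, s']%classic `<=` D.
  by move=> z /=; rewrite in_itv/= => /andP[? ?]; apply: (iD s s') => //; apply/andP.
have cg : {within `[s, s'], continuous (dwithin D f)}.
  by apply: continuous_subspaceW (dquot_continuous H2).
have dg z : z \in `]s, s'[ -> is_derive z (1 : R) (dwithin D f) (dwithin D (dwithin D f) z).
  move=> zs; have Dz : D z by apply: sub; exact: subset_itv_oo_cc.
  apply: (@dquot_is_derive D); last exact: dwithinP (H2 z Dz).
  have : nbhs z `]s, s'[%classic by apply: open_nbhs_nbhs; split => //; exact: interval_open.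
  by apply: filterS => w ws; apply: sub; exact: subset_itv_oo_cc.
have [c cs E] := MVT ss dg cg.
rewrite distrC E normrM [`|s - s'|]distrC ler_wpM2r//.
have cin : c \in `[s, s'] by exact: subset_itv_oo_cc.
apply: HB; first exact: sub.
move: cin sM s'M; rewrite in_itv/= !ler_norml => /andP[? ?] /andP[? ?] /andP[? ?].
by apply/andP; split; lra.
Qed.

End OneSidedCalculus.

Section Coefficients.
Context {R : realType} (P : problem R).
Hypothesis HP : standing_assumptions P.
Local Notation tb := (tbar P).

Lemma closed_left : closed (left_part P).
Proof. exact: closed_le. Qed.

Lemma closed_right : closed (right_part P).
Proof. exact: closed_ge. Qed.

Lemma interval_left : is_interval (left_part P).
Proof. by move=> x y _ /= yt z /andP[_ zy]; rewrite /left_part/=; exact: le_trans yt. Qed.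

Lemma interval_right : is_interval (right_part P).
Proof. by move=> x y /= xt _ z /andP[xz _]; rewrite /right_part/=; exact: le_trans xz. Qed.

Lemma cont_a0 : {within left_part P, continuous (a0 P)}.
Proof. by have [H _ _] := sa_a0 HP; exact: dquot_continuous H. Qed.

Lemma cont_a1 : {within right_part P, continuous (a1 P)}.
Proof. by have [H _ _] := sa_a1 HP; exact: dquot_continuous H. Qed.

Lemma cont_da0 : {within left_part P, continuous (da0 P)}.
Proof. by have [_ H _] := sa_a0 HP; exact: dquot_continuous H. Qed.

Lemma cont_da1 : {within right_part P, continuous (da1 P)}.
Proof. by have [_ H _] := sa_a1 HP; exact: dquot_continuous H. Qed.

Lemma measurable_split (f g : R -> R) :
  {within left_part P, continuous f} -> {within right_part P, continuous g} ->
  measurable_fun setT (fun t : R => if t <= tb then f t else g t).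
Proof.
move=> cf cg; apply: measurable_fun_if => //.
- by apply: measurable_fun_ler => //; exact: measurable_cst.
- rewrite setTI (_ : _ @^-1` _ = left_part P); last by apply/seteqP; split => t //=.
  by apply: subspace_continuous_measurable_fun => //; exact: closed_measurable closed_left.
- rewrite setTI; apply: (@measurable_funS _ _ _ _ (right_part P)).
  + exact: closed_measurable closed_right.
  + by move=> t /= /negbT; rewrite -ltNge => /ltW.
  + by apply: subspace_continuous_measurable_fun => //; exact: closed_measurable closed_right.
Qed.

Lemma measurable_aco : measurable_fun setT (aco P).
Proof. exact: measurable_split cont_a0 cont_a1. Qed.

Lemma measurable_da : measurable_fun setT (da P).
Proof.
have -> : da P = fun t => if t == tb then 0 else (if t <= tb then da0 P t else da1 P t).
  apply/funext => t; rewrite /da; case: (ltgtP t tb) => // _.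
apply: measurable_fun_ifT; [|exact: measurable_cst|exact: measurable_split cont_da0 cont_da1].
by apply: measurable_fun_eqr => //; exact: measurable_cst.
Qed.

Lemma aco_bounded (M : R) : exists2 C : R, 0 < C & forall t : R, `|t| <= M -> aco P t <= C.
Proof.
have [C0 C00 H0] := within_bounded M closed_left cont_a0.
have [C1 C10 H1] := within_bounded M closed_right cont_a1.
exists (C0 + C1) => [|t tM]; first exact: addr_gt0.
rewrite /aco; case: (leP t tb) => tt.
  by have := H0 t tt tM; rewrite ler_norml => /andP[_ ?]; lra.
by have := H1 t (ltW tt) tM; rewrite ler_norml => /andP[_ ?]; lra.
Qed.

Lemma da_bounded (M : R) : exists2 C : R, 0 < C & forall t : R, `|t| <= M -> `|da P t| <= C.
Proof.
have [C0 C00 H0] := within_bounded M closed_left cont_da0.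
have [C1 C10 H1] := within_bounded M closed_right cont_da1.
exists (C0 + C1) => [|t tM]; first exact: addr_gt0.
rewrite /da; case: (ltgtP t tb) => tt; last by rewrite normr0; lra.
  by have := H0 t (ltW tt) tM; lra.
by have := H1 t (ltW tt) tM; lra.
Qed.

(** The second derivative is bounded on each side, so the mean value theorem gives
    the Lipschitz term; a segment crossing [tbar] is cut there, which costs the jump. *)
Lemma da_jump (M : R) : exists2 B : R, 0 < B & forall s s' : R,
  `|s| <= M -> `|s'| <= M -> s != tb -> s' != tb ->
  `|da P s - da P s'| <= B * `|s - s'| + (if `|s' - tb| <= `|s - s'| then sigma0 P else 0).
Proof.
have [B0 B00 H0] := dwithin_lip (Num.max M `|tb|) interval_left closed_left (sa_a0 HP).
have [B1 B10 H1] := dwithin_lip (Num.max M `|tb|) interval_right closed_right (sa_a1 HP).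
exists (B0 + B1) => [|s s' sM s'M st s't]; first exact: addr_gt0.
have mM : M <= Num.max M `|tb| by rewrite le_max lexx.
have mt : `|tb| <= Num.max M `|tb| by rewrite le_max lexx orbT.
have {}sM := le_trans sM mM; have {}s'M := le_trans s'M mM.
have s0 : 0 <= sigma0 P by exact: normr_ge0.
have i0 : 0 <= (if `|s' - tb| <= `|s - s'| then sigma0 P else 0) by case: ifP.
have n0 := normr_ge0 (s - s').
have cross (C C' x x' z z' : R) : 0 < C -> 0 < C' -> C + C' = B0 + B1 ->
    `|z - z'| = sigma0 P -> `|x - z| <= C * `|s - tb| -> `|z' - x'| <= C' * `|tb - s'| ->
    `|s - tb| + `|tb - s'| = `|s - s'| ->
    `|x - x'| <= (B0 + B1) * `|s - s'| + (if `|s' - tb| <= `|s - s'| then sigma0 P else 0).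
  move=> c0 c0' CC zz xz zx ss.
  have -> : `|s' - tb| <= `|s - s'| by rewrite distrC -ss lerDr.
  have -> : x - x' = (x - z) + (z - z') + (z' - x') by ring.
  apply: (le_trans (ler_normD _ _)); apply: (le_trans (lerD (ler_normD _ _) (lexx _))).
  rewrite zz -CC mulrDl; have := normr_ge0 (s - tb); have := normr_ge0 (tb - s') => p1 p2.
  have : C * `|s - tb| <= C * `|s - s'| by rewrite ler_pM2l// -ss lerDl.
  have : C' * `|tb - s'| <= C' * `|s - s'| by rewrite ler_pM2l// -ss lerDr.
  lra.
rewrite /da; case: (ltgtP s tb) st => // ss _; case: (ltgtP s' tb) s't => // ss' _.
- by have := H0 s s' (ltW ss) (ltW ss') sM s'M; rewrite -/(da0 P); nra.
- have E1 := H0 s tb (ltW ss) (lexx _) sM mt.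
  have E2 := H1 tb s' (lexx _) (ltW ss') mt s'M.
  apply: (cross B0 B1 _ _ _ _ B00 B10 _ _ E1 E2) => //.
  by rewrite !ltr0_norm ?subr_lt0//; [ring|exact: lt_trans ss'].
- have E1 := H1 s tb (ltW ss) (lexx _) sM mt.
  have E2 := H0 tb s' (lexx _) (ltW ss') mt s'M.
  apply: (cross B1 B0 _ _ _ _ B10 B00 _ _ E1 E2) => //; first by rewrite addrC.
    by rewrite distrC.
  by rewrite !gtr0_norm ?subr_gt0//; [ring|exact: lt_trans ss].
- by have := H1 s s' (ltW ss) (ltW ss') sM s'M; rewrite -/(da1 P); nra.
Qed.

End Coefficients.

(** * Representatives that are continuous up to the boundary *)

Section ContinuousRepresentatives.
Context {R : realType} (Omega : set (R * R)).
Local Notation mu := (@leb2 R).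
Hypothesis oO : open Omega.
Hypothesis bO : bounded_set Omega.
Implicit Types (f g h : R * R -> R).

Lemma compact_closure : compact (closure Omega).
Proof.
have [M M0 OM] := bounded_box bO.
have cb : compact (box (- M) M (- M) M) by exact: compact_box.
apply: (subclosed_compact _ cb); first exact: closed_closure.
by move=> x /(closure_subset OM); exact: (compact_closed2 cb).
Qed.

(** Nonempty open sets have positive measure. *)
Lemma open_ae_nonempty A (Q : R * R -> Prop) : open A -> A !=set0 -> A `<=` Omega ->
  aeO Omega Q -> exists2 x, A x & Q x.
Proof.
move=> oA [x Ax] AO HQ; apply: contrapT => nQ.
have : x \in A by rewrite inE.
rewrite (open_bigcup_obox oA) inE => -[q /= qA xq].
set B := obox _ _ _ _ in xq; have BA : B `<=` A.
  by move=> z [z1 z2]; apply: qA; split; exact: subset_itv_oo_cc.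
have [N [mN N0 HN]] : mu.-negligible B.
  apply: negligibleS HQ => z Bz /= H; apply: nQ; exists z; first exact: BA.
  by apply: H; apply: AO; exact: BA.
have : (mu B <= mu N)%E by apply: le_measure; rewrite ?inE//; exact: measurable_obox.
have [l1 l2] : (ratr q.1.1.1 : R) < ratr q.1.1.2 /\ (ratr q.1.2 : R) < ratr q.2.
  move: xq; rewrite /B /obox/= !in_itv/= => -[/andP[x1 x2] /andP[x3 x4]].
  by split; [exact: lt_trans x2|exact: lt_trans x4].
by rewrite N0 /B leb2_obox ?(ltW l1) ?(ltW l2)// lee_fin leNgt mulr_gt0 ?subr_gt0.
Qed.

Lemma withinP (D : set (R * R)) f : {within D, continuous f} ->
  forall x, D x -> forall e, 0 < e -> exists2 U, open_nbhs x U & forall z, U z -> D z -> `|f x - f z| < e.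
Proof.
move=> /subspace_continuousP cf x Dx e e0.
have /cvgrPdist_lt /(_ e e0) := cf x Dx.
rewrite /within/= => /nbhs_interior; set A := (X in nbhs x X) => HA.
exists A; first by split; [exact: open_interior|exact: nbhs_singleton].
by move=> z Az Dz; have := interior_subset Az; apply.
Qed.

Lemma ae_le_closure h (c : R) : {within closure Omega, continuous h} ->
  aeO Omega (fun x => h x <= c) -> forall x, closure Omega x -> h x <= c.
Proof.
move=> ch hc x Ox; rewrite leNgt; apply/negP => cx.
have e0 : 0 < h x - c by rewrite subr_gt0.
have [U [oU Ux] HU] := withinP ch Ox e0.
have [||z [Oz Uz] hz] := @open_ae_nonempty (Omega `&` U) _ (openI oO oU) _ _ hc.
- by have [z [Oz Uz]] := Ox U (open_nbhs_nbhs (conj oU Ux)); exists z.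
- exact: subIsetl.
have := HU z Uz (subset_closure Oz); rewrite ltr_norml => /andP[_ ?].
by move: hz e0; lra.
Qed.

(** Inequalities between continuous functions that hold almost everywhere hold on the
    whole closure, so the approximants are uniformly close to each other there; the
    infimum of their shifted values is a common limit. *)
Lemma crep_uniform f :
  (forall e : R, 0 < e -> exists2 g, {within closure Omega, continuous g} &
     aeO Omega (fun x => `|f x - g x| <= e)) ->
  {within closure Omega, continuous (crep Omega f)} /\
  aeO Omega (fun x => crep Omega f x = f x).
Proof.
move=> H; pose en (n : nat) : R := n.+1%:R^-1.
have en0 n : 0 < en n by rewrite invr_gt0.
have /choice[g Hg] n : exists g, {within closure Omega, continuous g} /\
    aeO Omega (fun x => `|f x - g x| <= en n).
  by have [g g1 g2] := H _ (en0 n); exists g.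
have gg n m x : closure Omega x -> `|g n x - g m x| <= en n + en m.
  apply: (@ae_le_closure (fun x => `|g n x - g m x|)).
    move=> z; apply: cvg_norm; apply: cvgB; [exact: (Hg n).1|exact: (Hg m).1].
  have := aeO_and (Hg n).2 (Hg m).2; apply: aeO_imp => z _ [].
  by have := ler_distD (f z) (g n z) (g m z); rewrite [`|g n z - f z|]distrC; lra.
pose Y x := inf (range (fun n => g n x + en n)).
have YE n x : closure Omega x -> `|Y x - g n x| <= en n.
  move=> Ox.
  have lb m : g m x - en m <= Y x.
    apply: lb_le_inf; first by exists (g 0 x + en 0), 0.
    move=> _ [k _ <-]; have := gg m k x Ox; rewrite ler_norml => /andP[_ ?]; lra.
  have ub : Y x <= g n x + en n.
    apply: ge_inf; last by exists n.
    exists (g 0 x - en 0) => _ [k _ <-]; have := gg 0 k x Ox; rewrite ler_norml => /andP[_ ?]; lra.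
  by have := lb n; rewrite ler_norml => ?; apply/andP; split; lra.
have small (e : R) : 0 < e -> exists n, en n < e.
  move=> e0; exists (Num.trunc e^-1).
  by rewrite invf_plt ?posrE// truncnS_gt.
suff HY : {within closure Omega, continuous Y} /\ aeO Omega (fun x => Y x = f x).
  by rewrite /crep; case: xgetP => [h _ //|/(_ Y)].
split.
  apply/subspace_continuousP => x Ox; apply/cvgrPdist_le => e e0.
  have [n ne] : exists n, en n < e / 4 by apply: small; rewrite divr_gt0.
  have e4 : 0 < e / 4 by rewrite divr_gt0.
  have [U [oU Ux] HU] := withinP (Hg n).1 Ox e4.
  have : nbhs x U by exact: open_nbhs_nbhs.
  rewrite /within/=; apply: filterS => z Uz Oz.
  have := HU z Uz Oz; have := YE n x Ox; have := YE n z Oz.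
  by rewrite !ler_norml ltr_norml => /andP[? ?] /andP[? ?] /andP[? ?]; apply/andP; split; lra.
have : {ae mu, forall x n, Omega x -> `|f x - g n x| <= en n}.
  by apply: ae_foralln => n; exact: (Hg n).2.
apply: ae2_imp => x Hx Ox.
apply/eqP; rewrite -subr_eq0 -normr_le0; apply/ler_addgt0Pr => e e0; rewrite add0r.
have [n ne] : exists n, en n < e / 2 by apply: small; rewrite divr_gt0.
have := Hx n Ox; have := YE n x (subset_closure Ox); rewrite !ler_norml => /andP[? ?] /andP[? ?].
by apply/andP; split; lra.
Qed.

End ContinuousRepresentatives.

(** * The measure of strips around the level set *)

Section Polygon.
Context {R : realType}.

Lemma open_halfplane (c : R * R * R) :
  open [set x : R * R | c.1.1 * x.1 + c.1.2 * x.2 < c.2].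
Proof.
have cf : continuous (fun x : R * R => c.1.1 * x.1 + c.1.2 * x.2).
  by move=> x; apply: cvgD; apply: cvgM; try exact: cvg_cst; [exact: cvg_fst|exact: cvg_snd].
exact: (open_comp (fun x _ => cf x) (@open_lt R c.2)).
Qed.

Lemma open_polygonal (A : set (R * R)) : convex_polygonal_domain A -> open A.
Proof.
move=> [_ _ [s ->]]; elim: s => [|c s IH].
  by rewrite (_ : [set x | _] = setT); [exact: openT|apply/seteqP; split => x].
rewrite (_ : [set x | _] = [set x : R * R | c.1.1 * x.1 + c.1.2 * x.2 < c.2] `&`
    [set x : R * R | forall c, c \in s -> c.1.1 * x.1 + c.1.2 * x.2 < c.2]).
  by apply: openI => //; exact: open_halfplane.
apply/seteqP; split => [x /= H|x /= [H1 H2] c'].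
  by split; [apply: H; rewrite inE eqxx|move=> c' c's; apply: H; rewrite inE c's orbT].
by rewrite inE => /orP[/eqP ->//|]; exact: H2.
Qed.

End Polygon.

Section StripMeasure.
Context {R : realType} (P : problem R) (y : R * R -> R).
Local Notation mu := (@leb2 R).
Local Notation Omega := (dom P).
Local Notation t := (tbar P).
Hypothesis oO : open Omega.
Hypothesis bO : bounded_set Omega.
Hypothesis Hy : H10 Omega y.
Hypothesis Yc : {within closure Omega, continuous (crep Omega y)}.
Hypothesis Yy : aeO Omega (fun x => crep Omega y x = y x).
Implicit Types (k r c : R).

Let mO : measurable (Omega : set (plane R)) := measurable_open2 oO.

Definition in_strip k : R * R -> R := fun x => if 0 < `|y x - t| <= k then 1 else 0.

Let my : meas Omega y.
Proof. by have [[]] := W1_wd oO Hy.1. Qed.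

Lemma in_strip_ge0 k x : 0 <= in_strip k x.
Proof. by rewrite /in_strip; case: ifP. Qed.

Lemma in_strip_le1 k x : in_strip k x <= 1.
Proof. by rewrite /in_strip; case: ifP. Qed.

Lemma meas_in_strip k : meas Omega (in_strip k).
Proof.
apply: (meas_if oO); [|exact: meas_cst|exact: meas_cst].
apply: measurable_and.
  by apply: measurable_fun_ltr; [exact: meas_cst|apply: meas_norm; apply: measB => //; exact: meas_cst].
by apply: measurable_fun_ler; [apply: meas_norm; apply: measB => //; exact: meas_cst|exact: meas_cst].
Qed.

Lemma indic_bound (V : set (R * R)) x : 0 <= (\1_V x : R) <= 1.
Proof. by rewrite indicE; case: (_ \in _); rewrite /= ?lexx ?ler01. Qed.

Lemma integ_in_strip k (V : set (R * R)) : measurable (V : set (plane R)) ->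
  integ Omega (fun x => in_strip k x * \1_V x).
Proof.
move=> mV; apply: (@integ_bounded R Omega oO bO _ 1).
  by apply: measM; [exact: meas_in_strip|exact: measurable_funTS].
apply: aeO_all => x _; rewrite ger0_norm; last first.
  by rewrite mulr_ge0 ?in_strip_ge0//; case/andP: (indic_bound V x).
by apply: mulr_ile1; rewrite ?in_strip_ge0 ?in_strip_le1//; case/andP: (indic_bound V x).
Qed.

(** The part in [V] of the strip of width [k] around the level set has measure of
    order [k]. *)
Definition thin_on (V : set (R * R)) := exists c r : R, [/\ 0 < c, 0 < r &
  forall k, 0 < k < r -> intO Omega (fun x => in_strip k x * \1_V x) <= c * k].

Definition thin (A : set (R * R)) := exists2 V, open V /\ A `<=` V & thin_on V.

Lemma thin_sub A B : A `<=` B -> thin B -> thin A.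
Proof. by move=> AB [V [oV BV] HV]; exists V => //; split => // x /AB /BV. Qed.

Lemma thinU A B : thin A -> thin B -> thin (A `|` B).
Proof.
move=> [V [oV AV] [c [r [c0 r0 H]]]] [W [oW BW] [c' [r' [c0' r0' H']]]].
exists (V `|` W).
  split; first exact: openU.
  by move=> x [/AV|/BW]; [left|right].
exists (c + c'), (Num.min r r'); split; [exact: addr_gt0|by rewrite lt_min r0|].
move=> k; rewrite lt_min => /andP[k0 /andP[kr kr']].
have mV := measurable_open2 oV; have mW := measurable_open2 oW.
apply: (@le_trans _ _ (intO Omega (fun x => in_strip k x * \1_V x + in_strip k x * \1_W x))).
  apply: (le_intO oO).
  - by apply: integ_in_strip; exact: measurableU.
  - by apply: (integD oO); exact: integ_in_strip.
  - apply: aeO_all => x _; rewrite -mulrDr ler_wpM2l ?in_strip_ge0// !indicE in_setU.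
    by case: (_ \in _); case: (_ \in _); rewrite /= ?addr0 ?add0r// lerDl.
rewrite (intOD oO); [|exact: integ_in_strip|exact: integ_in_strip].
by rewrite mulrDl; apply: lerD; [apply: H|apply: H']; apply/andP.
Qed.

Lemma thin_off x : closure Omega x -> crep Omega y x <> t ->
  exists2 U, open_nbhs x U & thin_on U.
Proof.
move=> Ox Yx; pose d := `|crep Omega y x - t| / 2.
have d0 : 0 < d by rewrite divr_gt0// normr_gt0 subr_eq0; apply/eqP.
have [U oU HU] := withinP Yc Ox d0; exists U => //.
exists 1, d; split => // k /andP[k0 kd].
apply: (@le_trans _ _ (intO Omega (fun=> 0))); last first.
  by rewrite /intO /Rintegral integral0 /= mul1r ltW.
apply: (le_intO oO); [|exact: integ_cst|].
  by apply: integ_in_strip; exact: measurable_open2 oU.1.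
move: Yy; apply: aeO_imp => z Oz Yz; rewrite indicE.
case: (boolP (z \in U)) => [|_]; last by rewrite mulr0.
rewrite inE => /HU /(_ (subset_closure Oz)); rewrite Yz => H.
rewrite /in_strip ifF ?mul0r//; apply/negbTE/negP => /andP[_ yk].
move: d0 kd H; rewrite /d; move: (crep _ _ x) (y z) yk => a b yk d0 kd H.
have := ler_distD b a t; lra.
Qed.

Lemma continuous_bump a b c d (n : R) : continuous (@bump R a b c d n).
Proof. exact: (smooth_bump a b c d n [::]).1. Qed.

(** Near such a point one component of the gradient keeps its sign and is bounded
    below, so that the flux through the strip controls its measure. As
    [strip_flux] asks nothing of the support of [psi], the point may lie on the boundary. *)
Lemma thin_regular x i : closure Omega x -> cgrad Omega y i x != 0 ->
  exists2 U, open_nbhs x U & thin_on U.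
Proof.
move=> Ox gx.
have [gc gw] : {within closure Omega, continuous (cgrad Omega y i)} /\
    aeO Omega (fun z => cgrad Omega y i z = wd Omega i y z).
  move: gx; rewrite /cgrad /crep; case: xgetP => [h _ //|_].
  by rewrite /cst eqxx.
pose G := cgrad Omega y i; pose m := `|G x| / 2.
have m0 : 0 < m by rewrite divr_gt0// normr_gt0.
have [U0 [oU0 U0x] HU0] := withinP gc Ox m0.
pose s := Num.sg (G x).
have sG z : U0 z -> closure Omega z -> m <= s * G z.
  move=> Uz Oz; have := HU0 z Uz Oz; rewrite -/G => H.
  have -> : s * G z = `|G x| - s * (G x - G z).
    by rewrite normrEsg /s; ring.
  have : s * (G x - G z) <= `|G x - G z|.
    by apply: (le_trans (ler_norm _)); rewrite normrM normr_sg gx mul1r.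
  by rewrite /m in H *; lra.
have : x \in U0 by rewrite inE.
rewrite (open_bigcup_obox oU0) inE => -[q /= qU xq].
pose psi := bump (ratr q.1.1.1) (ratr q.1.1.2) (ratr q.1.2) (ratr q.2) (1 : R).
have psix : 0 < psi x by exact: bump_gt0.
have psiU z : ~ U0 z -> psi z = 0.
  move=> nU; apply: bump_out => // -[z1 z2]; apply: nU; apply: qU.
  by split; exact: subset_itv_oo_cc.
have psi0 z : 0 <= psi z by exact: bump_ge0.
pose U := psi @^-1` `]psi x / 2, +oo[%classic.
have oU : open U.
  by apply: open_comp => [z _|]; [exact: continuous_bump|exact: interval_open].
exists U; first by split => //; rewrite /U /= in_itv/= andbT; lra.
have spsi : smooth psi by exact: smooth_bump.
pose D := intO Omega (fun z => `|'D_(evec i) psi z|).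
have D0 : 0 <= D by apply: intO_ge0 => z _.
pose e := psi x / 2 * m / 2.
have e0 : 0 < e by rewrite !divr_gt0// mulr_gt0// divr_gt0.
exists ((pi * D + 1) / e), 1; split => //.
  by rewrite divr_gt0// ltr_wpDl// mulr_ge0// pi_ge0.
move=> k /andP[k0 _].
have [sy wy] := W1_wd oO Hy.1; have sw := (wy i).2.
have spsi0 := sqint_cont oO bO (spsi [::]).1.
have := strip_flux oO bO i t k0 Hy spsi; rewrite -/D.
set F := fun z => psi z * wd Omega i y z * slope t k (y z) => HF.
have iF : integ Omega F.
  apply: (integ_le oO _ (integ_norm (sqint_mul oO spsi0 sw))).
    apply: measM; first by apply: measM; [exact: spsi0.1|exact: sw.1].
    by apply: meas_comp my; apply: continuous_measurable_fun; exact: continuous_slope.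
  by apply: aeO_all => z _; rewrite /F normrM ler_piMr// slope_norm1.
have mU := measurable_open2 oU.
have H1 : e * intO Omega (fun z => in_strip k z * \1_U z) <= s * intO Omega F.
  rewrite -!(intOZ oO)//; last exact: integ_in_strip.
  apply: (le_intO oO); [by apply: integZ => //; exact: integ_in_strip|exact: integZ|].
  move: gw; apply: aeO_imp => z Oz gz.
  have [zU0|zU0] := pselect (U0 z); last first.
    rewrite /F (psiU z)// !mul0r mulr0 indicE.
    have -> : (z \in U) = false.
      apply/negP; rewrite inE /U/= in_itv/= andbT (psiU z)//.
      by apply/negP; rewrite -leNgt divr_ge0.
    by rewrite /= !mulr0.
  have mz := sG z zU0 (subset_closure Oz); rewrite /G gz in mz.
  have s0 : 0 < slope t k (y z) by exact: slope_gt0.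
  have -> : s * F z = psi z * (s * wd Omega i y z) * slope t k (y z).
    by rewrite /F; move: (slope _ _ _) (psi z) (wd _ _ _ _) => p1 p2 p3; ring.
  have r0 : 0 <= psi z * (s * wd Omega i y z) * slope t k (y z).
    apply: mulr_ge0; last exact: ltW.
    by apply: mulr_ge0 => //; exact: le_trans (ltW m0) mz.
  rewrite /in_strip; case: ifP => [/andP[_ yk]|_]; last by rewrite mul0r mulr0.
  rewrite mul1r indicE; case: (boolP (z \in U)) => [|_]; last by rewrite mulr0.
  rewrite inE /U/= in_itv/= andbT mulr1 => pz.
  apply: ler_pM; [by rewrite mulr_ge0// ?ltW// divr_gt0|by []| |exact: slope_ge].
  by apply: ler_pM => //; [rewrite ltW// divr_gt0|exact: ltW|exact: ltW].
rewrite mulrAC ler_pdivlMr// mulrC; apply: (le_trans H1).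
apply: (le_trans (ler_norm _)); rewrite normrM normr_sg gx mul1r.
apply: (le_trans HF); rewrite mulrDl mul1r.
have -> : k * pi * D = pi * D * k by ring.
by rewrite lerDl ltW.
Qed.

Lemma open_edist_ball (c0 : R * R) e : open [set x : R * R | Defs.edist x c0 < e].
Proof.
have cf : continuous (fun x : R * R => Defs.edist x c0).
  move=> x; rewrite /Defs.edist.
  apply: (@continuous_comp _ _ _ (fun x : R * R => (x.1 - c0.1) ^+ 2 + (x.2 - c0.2) ^+ 2) Num.sqrt); last exact: sqrt_continuous.
  apply: cvgD; rewrite /=.
    by under eq_fun do rewrite expr2; apply: cvgM; apply: cvgB; try exact: cvg_cst; exact: cvg_fst.
  by under eq_fun do rewrite expr2; apply: cvgM; apply: cvgB; try exact: cvg_cst; exact: cvg_snd.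
exact: (open_comp (fun x _ => cf x) (@open_lt R e)).
Qed.

Lemma thin_degenerate C x cs e0 r0 : C x -> closure Omega x ->
  0 < cs -> 0 < e0 -> 0 < r0 ->
  (forall r, 0 < r < r0 ->
     (mu ([set x | (0 < `|crep Omega y x - t| < r)%R] `&` nbhd P C e0)
      <= (cs * r)%:E)%E) ->
  exists2 U, open_nbhs x U & thin_on U.
Proof.
move=> Cx Ox cs0 e00 r00 H.
exists [set z | Defs.edist z x < e0].
  split; first exact: open_edist_ball.
  by rewrite /= /Defs.edist !subrr expr0n/= addr0 sqrtr0.
exists (2 * cs), (r0 / 2); split; [exact: mulr_gt0|exact: divr_gt0|].
move=> k /andP[k0 kr].
set U := [set z | _]; pose E := [set x | (0 < `|crep Omega y x - t| < 2 * k)%R] `&` nbhd P C e0.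
have mU : measurable (U : set (plane R)) by apply: measurable_open2; exact: open_edist_ball.
have mE : measurable (E : set (plane R)).
  have -> : E = (closure Omega `&` [set x | 0 < `|crep Omega y x - t| < 2 * k]) `&`
      \bigcup_(c in C) [set z | Defs.edist z c < e0].
    apply/seteqP; split => z /=.
      by move=> [H1 [Oz [c Cc Hc]]]; split => //; exists c.
    by move=> [[Oz H1] [c Cc Hc]]; split => //; split => //; exists c.
  have mC : measurable (closure Omega : set (plane R)).
    by apply: measurable_closed2; exact: closed_closure.
  apply: measurableI; last first.
    by apply: measurable_open2; apply: bigcup_open => c _; exact: open_edist_ball.
  have mY : measurable_fun (closure Omega : set (plane R)) (crep Omega y : plane R -> R).
    exact: measurable_within2.
  have mN : measurable_fun (closure Omega : set (plane R)) (fun z : plane R => `|crep Omega y z - t|).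
    by apply: measurableT_comp => //; apply: measurable_funB => //; exact: measurable_cst.
  have mB : measurable_fun (closure Omega : set (plane R)) (fun z : plane R => 0 < `|crep Omega y z - t| < 2 * k).
    by apply: measurable_and; apply: measurable_fun_ltr => //; exact: measurable_cst.
  exact: (mB mC [set true] _).
have iE : integ Omega (\1_E : R * R -> R).
  apply: (@integ_bounded R Omega oO bO _ 1); first exact: measurable_funTS.
  by apply: aeO_all => z _; rewrite ger0_norm; case/andP: (indic_bound E z).
apply: (@le_trans _ _ (intO Omega (\1_E : R * R -> R))).
  apply: (le_intO oO) => //; first exact: integ_in_strip.
  move: Yy; apply: aeO_imp => z Oz Yz; rewrite /in_strip.
  case: ifP => [/andP[y0 yk]|_]; last by rewrite mul0r; case/andP: (indic_bound E z).
  rewrite mul1r !indicE; case: (boolP (z \in U)) => // zU.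
  rewrite [z \in E](_ : _ = true)//; apply/mem_set; split => /=.
    by rewrite Yz y0/=; lra.
  split; first exact: subset_closure.
  by exists x => //; move: zU; rewrite inE.
rewrite -lee_fin -(integ_fin oO)// integral_indic//.
have k2 : 0 < 2 * k < r0 by apply/andP; split; lra.
apply: (@le_trans _ _ (mu E)); first by apply: le_measure; rewrite ?inE//; exact: measurableI.
by apply: (le_trans (H _ k2)); rewrite lee_fin; lra.
Qed.

Lemma thin_local x : level_set_condition P y -> closure Omega x ->
  exists2 U, open_nbhs x U & thin_on U.
Proof.
move=> [_ Hl] Ox; have [Yx|Yx] := pselect (crep Omega y x = t); last exact: thin_off.
have lx : level_set P y x by [].
have xC : connected_component (level_set P y) x x by exact: connected_component_refl.
have [H|[_ [cs [e0 [r0 [cs0 e00 r00 H]]]]]] := Hl x lx.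
  by have [i gi] := H x xC; exact: thin_regular gi.
exact: thin_degenerate xC Ox cs0 e00 r00 H.
Qed.

(** Complements of thin sets form a filter; were the closure of the domain not
    thin, this filter would have a cluster point, near which the strips are thin. *)
Lemma thin_closure : level_set_condition P y -> thin (closure Omega).
Proof.
move=> Hl; apply: contrapT => nthin.
pose F : set_system (R * R) := [set A | thin (closure Omega `\` A)].
have thin0 : thin set0.
  exists set0; first by split => //; exact: open0.
  exists 1, 1; split => // k /andP[k0 _].
  rewrite (_ : (fun x => _) = fun=> 0) ?mul1r.
    by rewrite /intO /Rintegral integral0 /= ltW.
  by apply/funext => x; rewrite indic0 mulr0.
have FF : ProperFilter F.
  apply: Build_ProperFilter; first by rewrite /F/= setD0.
  split => [|A B HA HB|A B AB]; rewrite /F/=.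
  - by rewrite setDT.
  - by rewrite setDIr; exact: thinU.
  - by apply: thin_sub => x [Ox nB]; split => // /AB.
have FO : F (closure Omega) by rewrite /F/= setDv.
have [x [Ox Fx]] := compact_closure bO FF FO.
have [U [oU Ux] HU] := thin_local Hl Ox.
have FU : F (~` U).
  by exists U => //; split => // z [_ /contrapT].
by have [z [+ ]] := Fx _ _ FU (open_nbhs_nbhs (conj oU Ux)).
Qed.

Lemma strip_measure : level_set_condition P y ->
  exists c r : R, [/\ 0 < c, 0 < r & forall k, 0 < k < r -> intO Omega (in_strip k) <= c * k].
Proof.
move=> /thin_closure [V [oV OV] [c [r [c0 r0 H]]]]; exists c, r; split => // k kr.
apply: le_trans (H k kr); rewrite le_eqVlt; apply/orP; left; apply/eqP.
apply: (eq_intO oO).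
- exact: meas_in_strip.
- by apply: integ_meas; apply: integ_in_strip; exact: measurable_open2.
- apply: aeO_all => x Ox; rewrite indicE mem_set ?mulr1//.
  by apply: OV; exact: subset_closure.
Qed.

End StripMeasure.

(** * Energy of the states *)

Section StateEstimates.
Context {R : realType} (P : problem R).
Local Notation mu := (@leb2 R).
Local Notation Omega := (dom P).
Local Notation t := (tbar P).
Hypothesis HP : standing_assumptions P.
Implicit Types (u v y z : R * R -> R) (i : bool) (k r : R).

Let oO : open Omega := open_polygonal (sa_dom HP).
Let bO : bounded_set Omega.
Proof. by have [] := sa_dom HP. Qed.
Let mO : measurable (Omega : set (plane R)) := measurable_open2 oO.

Lemma leb2_setT_gt0 : (0 < mu [set: plane R])%E.
Proof.
apply: (@lt_le_trans _ _ (mu (obox 0 1 0 1))).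
  by rewrite leb2_obox// !subr0 mulr1 lte_fin.
by apply: le_measure; rewrite ?inE//; exact: measurable_obox.
Qed.

Lemma noo_le f (c : R) : 0 <= c ->
  (nL Omega +oo%E f <= c%:E)%E <-> aeO Omega (fun x => `|f x| <= c).
Proof.
move=> c0; rewrite /nL unlock /Lnorm leb2_setT_gt0.
have E x : (abse \o (EFin \o f \_ Omega)) x = (`|(f \_ Omega) x|)%:E by [].
split => [/ess_supP|] H.
  move: H; apply: ae2_imp => x; rewrite E lee_fin patchE => H Ox.
  by move: H; rewrite mem_set.
apply/ess_supP; move: H; apply: ae2_imp => x H; rewrite E lee_fin patchE.
by case: ifPn => [|_]; [rewrite inE => /H|rewrite normr0].
Qed.

Lemma noo_bounded f : Lp Omega +oo%E f -> exists2 M : R, 0 < M & aeO Omega (fun x => `|f x| <= M).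
Proof.
move=> [_]; have := nL_ge0 Omega +oo%E f.
case E : (nL _ _ _) => [r| |]//; rewrite lee_fin => r0 _.
exists (r + 1); first by rewrite ltr_wpDl.
have /(noo_le f r0) : (nL Omega +oo%E f <= r%:E)%E by rewrite E.
by apply: aeO_imp => x _; lra.
Qed.

Lemma edist_nbhs (x : R * R) (e : R) : 0 < e -> nbhs x [set z | Defs.edist z x < e].
Proof.
move=> e0; apply: open_nbhs_nbhs; split; first exact: open_edist_ball.
by rewrite /= /Defs.edist !subrr expr0n/= addr0 sqrtr0.
Qed.

Lemma cont_bco : {within closure Omega, continuous (bco P)}.
Proof.
have [K HK] := sa_b_lip HP.
apply/subspace_continuousP => x Ox; apply/cvgrPdist_le => e e0.
have K0 : 0 < `|K| + 1 by rewrite ltr_wpDl.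
have := @edist_nbhs x (e / (`|K| + 1)) (divr_gt0 e0 K0).
rewrite /within/=; apply: filterS => z /= Hz Oz.
rewrite distrC; apply: (le_trans (HK z x Oz Ox)).
have d0 : 0 <= Defs.edist z x by exact: sqrtr_ge0.
move: Hz; rewrite ltr_pdivlMr// => /ltW; apply: le_trans.
by rewrite mulrC ler_wpM2l// (le_trans (ler_norm K))// lerDl.
Qed.

Lemma meas_bco : meas Omega (bco P).
Proof.
apply: (@measurable_funS _ _ _ _ (closure Omega)).
- by apply: measurable_closed2; exact: closed_closure.
- exact: subset_closure.
- apply: measurable_within2 cont_bco; apply: measurable_closed2; exact: closed_closure.
Qed.

Lemma bco_bounded : exists2 C : R, 0 < C & forall x, Omega x -> bco P x <= C.
Proof.
have /compact_bounded [B [Br HB]] : compact (bco P @` closure Omega).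
  by apply: continuous_compact cont_bco _; exact: compact_closure.
exists (`|B| + 1) => [|x Ox]; first by rewrite ltr_wpDl.
apply: (le_trans (ler_norm _)); apply: (HB (`|B| + 1) _ (bco P x)).
  by rewrite ltr_pwDr// ler_norm.
by exists x => //; exact: subset_closure.
Qed.

Lemma Uad_L2 u : Uad P u -> L2 P u.
Proof.
move=> [[mu_ uoo] _]; apply/(Lp2_sqint oO).
have [M _ HM] := noo_bounded (conj mu_ uoo).
exact: (sqint_bounded oO bO mu_ HM).
Qed.

(** The constant depends on the control through its [L^1] norm only. *)
Lemma state_energy : exists2 CE : R, 0 < CE & forall u y, Uad P u -> weak_sol P u y ->
  forall i k, 0 < k -> intO Omega (strip y t k (fun x => wd Omega i y x ^+ 2)) <= CE * k.
Proof.
have [c0 c00 Hc0] := sa_b_pos HP.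
pose m1 := intO Omega (fun=> 1 : R).
have m10 : 0 <= m1 by apply: intO_ge0.
pose U := `|alpha P| + `|beta P|.
have U0 : 0 <= U by rewrite addr_ge0.
have p0 : 0 < 2 * pi / c0 :> R by rewrite divr_gt0// mulr_gt0// pi_gt0.
exists (2 * pi / c0 * (U * m1 + 1)).
  by rewrite mulr_gt0// ltr_wpDl// mulr_ge0.
move=> u y uad [Hy yoo Heq] i k k0.
have [M M0 HM] := noo_bounded yoo.
have [Ca Ca0 HCa] := aco_bounded HP M.
have [Cb Cb0 HCb] := bco_bounded.
have /(Lp2_sqint oO) su := Uad_L2 uad.
have mA : meas Omega (fun x => bco P x + aco P (y x)).
  apply: measD; first exact: meas_bco.
  by apply: meas_comp yoo.1; exact: measurable_aco.
have HA : aeO Omega (fun x => c0 <= bco P x + aco P (y x) <= Cb + Ca).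
  move: HM; apply: aeO_imp => x Ox yM; apply/andP; split.
    by rewrite -[c0]addr0 lerD ?Hc0 ?(sa_a_ge0 HP)//; exact: subset_closure.
  by rewrite lerD ?HCb ?HCa.
apply: (le_trans (strip_energy oO bO t c00 mA HA su Hy Heq i k0)).
rewrite ler_pM2r// ler_pM2l// ler_wpDr//.
have -> : U * m1 = intO Omega (fun=> U) by rewrite (intO_cst oO bO).
apply: (le_intO oO); [by apply: integ_norm; exact: sqint_integ|exact: integ_cst|].
move: uad.2; apply: aeO_imp => x _ /andP[a1 a2]; rewrite /U.
rewrite ler_norml; apply/andP; split.
  by have := ler_normr (alpha P) (- alpha P); have := ler_norm (- alpha P); rewrite normrN; have := normr_ge0 (beta P); lra.
by have := ler_norm (beta P); have := normr_ge0 (alpha P); lra.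
Qed.

Lemma ae_zero_small f : meas Omega f -> integ Omega f -> (forall x, Omega x -> 0 <= f x) ->
  (forall e : R, 0 < e -> intO Omega f <= e) -> aeO Omega (fun x => f x = 0).
Proof.
move=> mf fi f0 fe.
have I0 : intO Omega f = 0.
  apply/eqP; rewrite eq_le intO_ge0// andbT; apply/ler_addgt0Pr => e e0.
  by rewrite add0r; exact: fe.
have : (\int[mu]_(x in Omega) `|(f x)%:E| = 0)%E.
  rewrite -[RHS]/(0%:E) -I0 -(integ_fin oO)//; apply: eq_integral => x.
  by rewrite inE => Ox; rewrite /= ger0_norm// f0.
have mEf : measurable_fun (Omega : set (plane R)) (EFin \o (f : plane R -> R)).
  exact/measurable_EFinP.
move=> /(ae_eq_integral_abs mu mO mEf).1; apply: ae2_imp => x H Ox.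
by have [] := H Ox.
Qed.

End StateEstimates.

(** * The terms of the consistency error *)

Section ErrorTerms.
Context {R : realType} (P : problem R).
Local Notation mu := (@leb2 R).
Local Notation Omega := (dom P).
Local Notation t := (tbar P).
Hypothesis HP : standing_assumptions P.
Implicit Types (u v y z : R * R -> R) (i : bool) (k r : R).

Let oO : open Omega := open_polygonal (sa_dom HP).
Let bO : bounded_set Omega.
Proof. by have [] := sa_dom HP. Qed.

Definition energy_bound (CE : R) y := forall i k, 0 < k ->
  intO Omega (strip y t k (fun x => wd Omega i y x ^+ 2)) <= CE * k.

(** The level set lies in strips of arbitrarily small width, hence energy. *)
Lemma gradient_zero_level (CE : R) y i : 0 < CE -> H10 Omega y -> energy_bound CE y ->
  aeO Omega (fun x => y x = t -> wd Omega i y x = 0).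
Proof.
move=> CE0 Hy HE; have [sy wy] := W1_wd oO Hy.1; have sw := (wy i).2.
pose f x := if y x == t then wd Omega i y x ^+ 2 else 0.
have mf : meas Omega f.
  apply: (meas_if oO); [|exact: measX sw.1|exact: meas_cst].
  by apply: measurable_fun_eqr; [exact: sy.1|exact: meas_cst].
have fi : integ Omega f.
  apply: (integ_le oO mf sw.2); apply: aeO_all => x _.
  by rewrite /f; case: ifP => _; rewrite ?normr0 ?sqr_ge0// ger0_norm// sqr_ge0.
have : aeO Omega (fun x => f x = 0).
  apply: (ae_zero_small HP mf fi) => [x _|e e0].
    by rewrite /f; case: ifP => _; rewrite ?sqr_ge0.
  have k0 : 0 < e / CE by rewrite divr_gt0.
  apply: (@le_trans _ _ (intO Omega (strip y t (e / CE) (fun x => wd Omega i y x ^+ 2)))).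
    apply: (le_intO oO fi); first by apply: (integ_strip oO); [exact: sy.1|exact: sw.2].
    apply: aeO_all => x _; rewrite /f /strip; case: eqP => [->|_].
      by rewrite subrr normr0 (ltW k0).
    by case: ifP => _; rewrite ?sqr_ge0.
  by apply: (le_trans (HE i _ k0)); rewrite mulrC divfK// gt_eqF.
apply: aeO_imp => x _; rewrite /f => + yt; rewrite yt eqxx => /eqP.
by rewrite sqrf_eq0 => /eqP.
Qed.

Lemma sqr3 (z a b c : R) : `|z| <= a + b + c -> z ^+ 2 <= 3 * (a ^+ 2 + b ^+ 2 + c ^+ 2).
Proof.
move=> zabc; apply: (@le_trans _ _ ((a + b + c) ^+ 2)).
  by rewrite -(real_normK (num_real z)) lerXn2r// nnegrE (le_trans _ zabc).
have := sqr_ge0 (a - b); have := sqr_ge0 (b - c); have := sqr_ge0 (a - c).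
by rewrite !sqrrB !sqrrD; lra.
Qed.

Lemma sqr_scaled (s a b : R) : (s * (a + b)) ^+ 2 <= 2 * s ^+ 2 * (a ^+ 2 + b ^+ 2).
Proof.
have := sqr_ge0 (s * (a - b)).
have -> : (s * (a - b)) ^+ 2 = s ^+ 2 * a ^+ 2 - 2 * (s ^+ 2 * (a * b)) + s ^+ 2 * b ^+ 2 by ring.
have -> : (s * (a + b)) ^+ 2 = s ^+ 2 * a ^+ 2 + 2 * (s ^+ 2 * (a * b)) + s ^+ 2 * b ^+ 2 by ring.
have -> : 2 * s ^+ 2 * (a ^+ 2 + b ^+ 2) = 2 * (s ^+ 2 * a ^+ 2) + 2 * (s ^+ 2 * b ^+ 2) by ring.
lra.
Qed.

(** Where [y] and [yb] lie on different sides of [tbar], or one of them equals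
    it, the gradient involved lives in the strip of width [r] or vanishes. *)
Lemma jump_term (M r A B s s' p p' : R) :
  `|s| <= M -> `|s'| <= M -> `|s - s'| <= r ->
  (forall t, `|t| <= M -> `|da P t| <= A) ->
  (forall s s', `|s| <= M -> `|s'| <= M -> s != t -> s' != t ->
     `|da P s - da P s'| <= B * `|s - s'| + (if `|s' - t| <= `|s - s'| then sigma0 P else 0)) ->
  0 <= B -> (s = t -> p = 0) -> (s' = t -> p' = 0) ->
  `|da P s * p - da P s' * p'| <=
    A * `|p - p'| + B * r * `|p'| + sigma0 P * (if `|s' - t| <= r then `|p'| else 0).
Proof.
move=> sM s'M ss HA HB B0 st s't.
have r0 : 0 <= r by exact: le_trans (normr_ge0 _) ss.
have T2 : 0 <= B * r * `|p'| by rewrite !mulr_ge0.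
have T3 : 0 <= sigma0 P * (if `|s' - t| <= r then `|p'| else 0).
  by rewrite mulr_ge0// ?normr_ge0//; case: ifP.
have [E|sNt] := eqVneq s t.
  rewrite (st E) mulr0 !sub0r !normrN normrM.
  have H : `|da P s'| * `|p'| <= A * `|p'| by rewrite ler_wpM2r// HA.
  by rewrite -addrA; apply: (le_trans H); rewrite lerDl addr_ge0.
have [E|s'Nt] := eqVneq s' t.
  rewrite (s't E) mulr0 !subr0 normrM normr0 !mulr0 addr0.
  have : `|da P s| * `|p| <= A * `|p| by rewrite ler_wpM2r// HA.
  by case: ifP; rewrite ?mulr0 addr0.
have -> : da P s * p - da P s' * p' = da P s * (p - p') + (da P s - da P s') * p' by ring.
apply: (le_trans (ler_normD _ _)); rewrite !normrM -addrA; apply: lerD.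
  by rewrite ler_wpM2r// HA.
apply: (@le_trans _ _ ((B * r + (if `|s' - t| <= r then sigma0 P else 0)) * `|p'|)).
  rewrite ler_wpM2r//; apply: (le_trans (HB s s' sM s'M sNt s'Nt)); apply: lerD.
    by rewrite ler_wpM2l.
  case: ifP => [H|_]; first by rewrite (le_trans H ss).
  by case: ifP => _ //; exact: normr_ge0.
by rewrite mulrDl lerD2l; case: ifP; rewrite ?mul0r ?mulr0.
Qed.

(** The jump contributes the energy of a strip of width [r], which is the term of
    first order in [r]. *)
Lemma Znorm_estimate (yb : R * R -> R) (CE M : R) : 0 < CE -> H10 Omega yb ->
  energy_bound CE yb ->
  exists2 C : R, 0 < C & forall y r, H10 Omega y -> energy_bound CE y ->
    aeO Omega (fun x => `|y x| <= M) -> aeO Omega (fun x => `|yb x| <= M) ->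
    0 < r -> aeO Omega (fun x => `|y x - yb x| <= r) ->
    (forall i, intO Omega (fun x => (wd Omega i y x - wd Omega i yb x) ^+ 2) <= r ^+ 2) ->
    (Znorm P y yb <= (Num.sqrt (C * (r ^+ 2 + r)))%:E)%E.
Proof.
move=> CE0 Hyb HEb; have [A A0 HA] := da_bounded HP M; have [B B0 HB] := da_jump HP M.
have [syb wyb] := W1_wd oO Hyb.1.
pose E := intO Omega (fun x => wd Omega true yb x ^+ 2) + intO Omega (fun x => wd Omega false yb x ^+ 2).
have Ei i : intO Omega (fun x => wd Omega i yb x ^+ 2) <= E.
  have p j : 0 <= intO Omega (fun x => wd Omega j yb x ^+ 2) by apply: intO_ge0 => x _; exact: sqr_ge0.
  by case: i; [exact: ler_wpDr (p false) (lexx _)|exact: ler_wpDl (p true) (lexx _)].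
have E0 : 0 <= E by apply: le_trans (Ei true); apply: intO_ge0 => x _; exact: sqr_ge0.
have s0 : 0 <= sigma0 P by exact: normr_ge0.
pose c1 := 3 * (A ^+ 2 + B ^+ 2 * E); pose c2 := 3 * (sigma0 P ^+ 2 * CE).
have c10 : 0 < c1 by rewrite mulr_gt0// ltr_pwDl ?exprn_gt0// mulr_ge0// exprn_ge0// ltW.
have c20 : 0 <= c2 by rewrite mulr_ge0// mulr_ge0 ?exprn_ge0// ltW.
exists (2 * (c1 + c2)); first by rewrite mulr_gt0// ltr_pwDl.
move=> y r Hy HE yM ybM r0 yr wr.
have [sy wy] := W1_wd oO Hy.1.
pose Z i x := da P (y x) * wd Omega i y x - da P (yb x) * wd Omega i yb x.
have mZ i : meas Omega (Z i).
  apply: measB; apply: measM; try exact: (wy i).2.1; try exact: (wyb i).2.1.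
  - by apply: meas_comp sy.1; exact: measurable_da.
  - by apply: meas_comp syb.1; exact: measurable_da.
pose W i x := 3 * ((A ^+ 2 * (wd Omega i y x - wd Omega i yb x) ^+ 2 +
   (B * r) ^+ 2 * wd Omega i yb x ^+ 2) + sigma0 P ^+ 2 * strip yb t r (fun x => wd Omega i yb x ^+ 2) x).
have i1 i := integZ oO (A ^+ 2) (sqintB oO (wy i).2 (wyb i).2).2.
have i2 i := integZ oO ((B * r) ^+ 2) (wyb i).2.2.
have i3 i := integZ oO (sigma0 P ^+ 2) (integ_strip oO t r syb.1 (wyb i).2.2).
have iW i : integ Omega (W i).
  by apply: (integZ oO); apply: (integD oO) => //; exact: (integD oO).
have ZW i : aeO Omega (fun x => Z i x ^+ 2 <= W i x).
  have := aeO_and (aeO_and yM ybM) (aeO_and yr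
    (aeO_and (gradient_zero_level i CE0 Hy HE) (gradient_zero_level i CE0 Hyb HEb))).
  apply: aeO_imp => x _ [[H1 H2] [H3 [H4 H5]]].
  have := jump_term H1 H2 H3 HA HB (ltW B0) H4 H5; rewrite -/(Z i x) => H.
  have := sqr3 H; rewrite /W /strip !exprMn !real_normK ?num_real//.
  by case: ifP => _; rewrite ?real_normK ?num_real ?expr0n.
have iZ i : integ Omega (fun x => Z i x ^+ 2).
  apply: (integ_le oO (measX 2 (mZ i)) (iW i)).
  by move: (ZW i); apply: aeO_imp => x _; rewrite ger0_norm// sqr_ge0.
have bZ i : intO Omega (fun x => Z i x ^+ 2) <= c1 * r ^+ 2 + c2 * r.
  apply: (le_trans (le_intO oO (iZ i) (iW i) (ZW i))).
  rewrite /W (intOZ oO); last by apply: (integD oO) => //; exact: (integD oO).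
  rewrite !(intOD oO)//; last exact: (integD oO).
  rewrite !(intOZ oO)//; try solve [exact: (sqintB oO (wy i).2 (wyb i).2).2
    |exact: (wyb i).2.2|exact: (integ_strip oO t r syb.1 (wyb i).2.2)].
  rewrite exprMn.
  have T1 := ler_wpM2l (sqr_ge0 A) (wr i).
  have T2 := ler_wpM2l (mulr_ge0 (sqr_ge0 B) (sqr_ge0 r)) (Ei i).
  have T3 := ler_wpM2l (sqr_ge0 (sigma0 P)) (HEb i r r0).
  have -> : c1 * r ^+ 2 + c2 * r =
    3 * ((A ^+ 2 * r ^+ 2 + B ^+ 2 * r ^+ 2 * E) + sigma0 P ^+ 2 * (CE * r)).
    by rewrite /c1 /c2; ring.
  by rewrite ler_wpM2l// lerD// lerD.
have sq2 x : Num.sqrt (\sum_(i : bool) Z i x ^+ 2) ^+ 2 = Z true x ^+ 2 + Z false x ^+ 2.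
  by rewrite big_bool/= sqr_sqrtr// addr_ge0 ?sqr_ge0.
have msq : meas Omega (fun x => Num.sqrt (\sum_(i : bool) Z i x ^+ 2)).
  apply: meas_comp.
    by apply: continuous_measurable_fun; exact: sqrt_continuous.
  under eq_fun do rewrite big_bool/=.
  by apply: measD; exact: measX.
have C0 : 0 <= 2 * (c1 + c2) * (r ^+ 2 + r).
  by rewrite !mulr_ge0// ?addr_ge0 ?sqr_ge0// ltW.
have Hsq : sqint Omega (fun x => Num.sqrt (\sum_(i : bool) Z i x ^+ 2)).
  split => //; rewrite (_ : (fun x => _) = fun x => Z true x ^+ 2 + Z false x ^+ 2).
    exact: (integD oO).
  by apply/funext => x; exact: sq2.
rewrite /Znorm /n2; apply/(n2_le oO _ Hsq); first exact: sqrtr_ge0.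
rewrite sqr_sqrtr// (_ : (fun x => _) = fun x => Z true x ^+ 2 + Z false x ^+ 2); last first.
  by apply/funext => x; exact: sq2.
rewrite (intOD oO)//; apply: (le_trans (lerD (bZ true) (bZ false))).
have p1 : 0 <= c1 * r by rewrite mulr_ge0// ltW.
have p2 : 0 <= c2 * r ^+ 2 by rewrite mulr_ge0// sqr_ge0.
by rewrite -mulrA !mulrDl !mulrDr; lra.
Qed.

(** The strip energy is used for the state [y] itself, with no comparison to the
    reference state. *)
Lemma V_estimate (CE : R) y r k : H10 Omega y -> energy_bound CE y -> 0 < k -> r <= k ->
  (n2 P (V P y r) <= (Num.sqrt (4 * sigma0 P ^+ 2 * CE * k))%:E)%E.
Proof.
move=> Hy HE k0 rk; have [sy wy] := W1_wd oO Hy.1.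
pose f i x := if 0 < `|y x - t| <= r then `|wd Omega i y x| else 0.
have mf i : meas Omega (f i).
  apply: (meas_if oO); [|exact: meas_norm (wy i).2.1|exact: meas_cst].
  apply: measurable_and.
    by apply: measurable_fun_ltr; [exact: meas_cst|apply: meas_norm; apply: measB; [exact: sy.1|exact: meas_cst]].
  by apply: measurable_fun_ler; [apply: meas_norm; apply: measB; [exact: sy.1|exact: meas_cst]|exact: meas_cst].
have sf i : sqint Omega (f i).
  apply: (sqint_le oO (mf i) (wy i).2); apply: aeO_all => x _.
  by rewrite /f; case: ifP => _; rewrite ?normr_id ?normr0.
have VE : V P y r = fun x => sigma0 P * (f true x + f false x).
  by apply/funext => x; rewrite /V big_bool.
have sV : sqint Omega (V P y r).
  by rewrite VE; apply: (sqintZ oO); exact: (sqintD oO).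
rewrite /n2; apply/(n2_le oO _ sV); first exact: sqrtr_ge0.
have bf i : intO Omega (fun x => f i x ^+ 2) <= CE * k.
  apply: le_trans (HE i k k0); apply: (le_intO oO (sf i).2).
    by apply: (integ_strip oO); [exact: sy.1|exact: (wy i).2.2].
  apply: aeO_all => x _; rewrite /f /strip; case: ifP => [/andP[_ H]|_].
    by rewrite (le_trans H rk) real_normK ?num_real.
  by rewrite expr0n/=; case: ifP => _; rewrite ?sqr_ge0.
have CEk : 0 <= CE * k.
  by apply: le_trans (bf true); apply: intO_ge0 => x _; exact: sqr_ge0.
rewrite sqr_sqrtr; last by rewrite -mulrA mulr_ge0// mulr_ge0// sqr_ge0.
apply: (@le_trans _ _ (intO Omega (fun x => 2 * sigma0 P ^+ 2 * (f true x ^+ 2 + f false x ^+ 2)))).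
  apply: (le_intO oO sV.2).
    by apply: (integZ oO); apply: (integD oO); exact: (sf _).2.
  by apply: aeO_all => x _; rewrite VE; exact: sqr_scaled.
rewrite (intOZ oO); last by apply: (integD oO); exact: (sf _).2.
rewrite (intOD oO); [|exact: (sf _).2|exact: (sf _).2].
have -> : 4 * sigma0 P ^+ 2 * CE * k = 2 * sigma0 P ^+ 2 * (CE * k + CE * k) by ring.
by apply: ler_wpM2l; [rewrite mulr_ge0 ?sqr_ge0|exact: lerD (bf true) (bf false)].
Qed.

(** Strips have measure and energy of order [k], so the gradient has [L^1] norm
    of order [k] on them. *)
Lemma Sigma_bounded (CE : R) y : 0 < CE -> H10 Omega y -> energy_bound CE y ->
  {within closure Omega, continuous (crep Omega y)} ->
  aeO Omega (fun x => crep Omega y x = y x) -> level_set_condition P y ->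
  exists2 C : R, 0 < C & forall k, 0 < k -> (nL Omega 1 (Sigma P k y) <= C%:E)%E.
Proof.
move=> CE0 Hy HE Yc Yy Hl; have [sy wy] := W1_wd oO Hy.1.
have [c [r [c0 r0 Hc]]] := strip_measure oO bO Hy Yc Yy Hl.
pose f k i x := if 0 < `|y x - t| <= k then `|wd Omega i y x| else 0.
have mf k i : meas Omega (f k i).
  apply: (meas_if oO); [|exact: meas_norm (wy i).2.1|exact: meas_cst].
  apply: measurable_and.
    by apply: measurable_fun_ltr; [exact: meas_cst|apply: meas_norm; apply: measB; [exact: sy.1|exact: meas_cst]].
  by apply: measurable_fun_ler; [apply: meas_norm; apply: measB; [exact: sy.1|exact: meas_cst]|exact: meas_cst].
have fi k i : integ Omega (f k i).
  apply: (integ_le oO (mf k i) (integ_norm (sqint_integ oO bO (wy i).2))).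
  by apply: aeO_all => x _; rewrite /f; case: ifP => _; rewrite ?normr_id ?normr0.
pose E i := intO Omega (fun x => `|wd Omega i y x|).
have E0 i : 0 <= E i by apply: intO_ge0 => x _.
have smp k : integ Omega (in_strip P y k).
  apply: (@integ_bounded R Omega oO bO _ 1); first exact: (meas_in_strip oO Hy).
  by apply: aeO_all => x _; rewrite ger0_norm ?in_strip_ge0 ?in_strip_le1.
pose D := CE + c + (E true + E false) / r.
have D0 : 0 < D by rewrite ltr_pwDl ?addr_gt0// divr_ge0 ?addr_ge0// ltW.
have Hf k i : 0 < k -> intO Omega (f k i) <= D * k.
  move=> k0; have [kr|rk] := ltP k r.
    apply: (@le_trans _ _ (intO Omega (fun x => strip y t k (fun x => wd Omega i y x ^+ 2) x + in_strip P y k x))).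
      apply: (le_intO oO (fi k i)).
        by apply: (integD oO) => //; apply: (integ_strip oO); [exact: sy.1|exact: (wy i).2.2].
      apply: aeO_all => x _; rewrite /f /strip /in_strip; case: ifP => [/andP[_ ->]|_].
        have := sqr_ge0 (`|wd Omega i y x| - 2^-1); rewrite sqrrB real_normK ?num_real//; lra.
      by rewrite addr0; case: ifP; rewrite ?sqr_ge0.
    rewrite (intOD oO)//; last by apply: (integ_strip oO); [exact: sy.1|exact: (wy i).2.2].
    have krr : 0 < k < r by apply/andP.
    apply: (le_trans (lerD (HE i k k0) (Hc k krr))).
    rewrite -mulrDl; apply: ler_wpM2r; first exact: ltW.
    by rewrite /D lerDl divr_ge0 ?addr_ge0 ?(ltW r0).
  apply: (@le_trans _ _ (E i)).
    apply: (le_intO oO (fi k i)); first by apply: integ_norm; exact: (sqint_integ oO bO (wy i).2).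
    by apply: aeO_all => x _; rewrite /f; case: ifP.
  apply: (@le_trans _ _ ((E true + E false) / r * k)).
    apply: (@le_trans _ _ (E true + E false)); first by case: i; [exact: ler_wpDr (E0 false) (lexx _)|exact: ler_wpDl (E0 true) (lexx _)].
    by rewrite mulrAC ler_pdivlMr// ler_wpM2l// addr_ge0.
  apply: ler_wpM2r; first exact: ltW.
  by rewrite /D lerDr addr_ge0 ?(ltW CE0) ?(ltW c0).
have s0 : 0 <= sigma0 P by exact: normr_ge0.
exists (2 * sigma0 P * D + 1); first by rewrite ltr_wpDl// !mulr_ge0// ltW.
move=> k k0.
have SE : Sigma P k y = fun x => k^-1 * sigma0 P * (f k true x + f k false x).
  by apply/funext => x; rewrite /Sigma /V big_bool mulrA.
have S0 x : 0 <= Sigma P k y x.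
  have f0 i : 0 <= f k i x by rewrite /f; case: ifP.
  by rewrite SE !mulr_ge0 ?invr_ge0 ?addr_ge0// ltW.
have iS : integ Omega (Sigma P k y) by rewrite SE; apply: (integZ oO); exact: (integD oO).
have -> : nL Omega 1 (Sigma P k y) = (intO Omega (Sigma P k y))%:E.
  rewrite /nL Lnorm1 -(integ_fin oO)// [RHS]integral_mkcond.
  apply: eq_integral => x _; rewrite /= !patchE; case: ifPn => _ /=; last by rewrite normr0.
  by rewrite ger0_norm.
rewrite lee_fin SE (intOZ oO); last exact: (integD oO).
rewrite (intOD oO)//.
have HI := lerD (Hf k true k0) (Hf k false k0).
set I := intO _ _ + intO _ _ in HI *.
rewrite -[k^-1 * _ * _]mulrA ler_pdivrMl//; have := ler_wpM2l s0 HI.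
have -> : sigma0 P * (D * k + D * k) = k * (2 * sigma0 P * D) by ring.
by move/le_trans; apply; rewrite ler_wpM2l ?(ltW k0)// lerDl.
Qed.

End ErrorTerms.

(** * Lipschitz dependence of the state and absorption *)

Lemma sqr_split {R : realType} (a b : R) : a ^+ 2 <= 2 * ((a - b) ^+ 2 + b ^+ 2).
Proof. by have := sqr_ge0 (a - b - b); rewrite !sqrrB; lra. Qed.

Section StateLipschitz.
Context {R : realType} (P : problem R).
Local Notation Omega := (dom P).
Hypothesis HP : standing_assumptions P.
Hypothesis HS : control_to_state P.
Implicit Types (u v y z : R * R -> R) (i : bool).

Let oO : open Omega := open_polygonal (sa_dom HP).
Let bO : bounded_set Omega.
Proof. by have [] := sa_dom HP. Qed.

Lemma L2B u v : L2 P u -> L2 P v -> L2 P (u \- v).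
Proof.
by move=> /(Lp2_sqint oO) su /(Lp2_sqint oO) sv; apply/(Lp2_sqint oO); exact: (sqintB oO).
Qed.

Lemma nY_noo f (c : R) : 0 <= c -> (nY P f <= c%:E)%E -> aeO Omega (fun x => `|f x| <= c).
Proof.
move=> c0 H; apply: (@noo_le R P f c c0).1; apply: le_trans H; rewrite /nY leeDr// /nW1.
by rewrite adde_ge0 ?nL_ge0// big_bool/= adde_ge0 ?nL_ge0.
Qed.

Lemma nY_wd f i (c : R) : (nY P f <= c%:E)%E -> (nL Omega 2%:E (wd Omega i f) <= c%:E)%E.
Proof.
move=> H; apply: le_trans H; rewrite /nY /nW1 big_bool/=.
have p0 p g : (0 <= nL Omega p g)%E by exact: nL_ge0.
rewrite -addeA; apply: (le_trans _ (leeDr _ _)) => //.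
apply: (le_trans _ (leeDl _ _)); last by exact: p0.
by case: i; [rewrite leeDl|rewrite leeDr].
Qed.

(** Differentiability of the control-to-state map at [ub], with increment quotient
    bounded by the norm of the derivative plus one. *)
Lemma state_lipschitz ub : L2 P ub -> exists K d0 : R, [/\ 0 < K, 0 < d0 &
  forall u (d : R), L2 P u -> 0 <= d <= d0 -> (n2 P (u \- ub)%R <= d%:E)%E ->
    aeO Omega (fun x => `|S P u x - S P ub x| <= K * d) /\
    forall i, intO Omega (fun x => (wd Omega i (S P u) x - wd Omega i (S P ub) x) ^+ 2)
      <= (K * d) ^+ 2].
Proof.
move=> Lub; have [d0 d00 Hd] := cs_frechet HS Lub ltr01.
have [K0 HK0] := cs_dS_bounded HS Lub.
exists (2 * (1 + `|K0|)), d0; split => //.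
move=> u d Lu /andP[dge0 dd0] nd.
pose v := u \- ub; have Lv : L2 P v by exact: L2B.
have uv : ub \+ v = u by apply/funext => x; rewrite /v /=; ring.
have nvd0 : (n2 P v <= d0%:E)%E by apply: (le_trans nd); rewrite lee_fin.
have := Hd v Lv nvd0; rewrite uv mul1e => H1.
have {}H1 := le_trans H1 nd.
pose z := dS P ub v.
have H2 : (nY P z <= (`|K0| * d)%:E)%E.
  apply: (le_trans (HK0 v Lv)); rewrite EFinM.
  apply: (@le_trans _ _ (`|K0|%:E * n2 P v)%E).
    by apply: lee_wpmul2r; [exact: nL_ge0|rewrite lee_fin ler_norm].
  by apply: lee_wpmul2l => //; rewrite lee_fin.
have Kd0 : 0 <= `|K0| * d by rewrite mulr_ge0.
have [Hz _] := cs_lin_sol HS Lub Lv.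
have [HSu _ _] := cs_sol HS Lu; have [HSub _ _] := cs_sol HS Lub.
split.
  have := aeO_and (nY_noo dge0 H1) (nY_noo Kd0 H2).
  apply: aeO_imp => x _ /= [E1 E2].
  have -> : S P u x - S P ub x = (S P u x - S P ub x - z x) + z x by ring.
  apply: (le_trans (ler_normD _ _)); apply: (le_trans (lerD E1 E2)).
  have -> : 2 * (1 + `|K0|) * d = d + `|K0| * d + (d + `|K0| * d) by ring.
  by rewrite lerDl addr_ge0.
move=> i.
have [su wu] := W1_wd oO HSu.1; have [sb wb] := W1_wd oO HSub.1; have [sz wz] := W1_wd oO Hz.1.
have wp := weak_partialB oO (weak_partialB oO (wu i).1 (wb i).1) (wz i).1.
pose D x := wd Omega i (S P u) x - wd Omega i (S P ub) x.
have sD : sqint Omega D by exact: (sqintB oO (wu i).2 (wb i).2).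
have sDz : sqint Omega (fun x => D x - wd Omega i z x) by exact: (sqintB oO sD (wz i).2).
have sW : sqint Omega (wd Omega i ((S P u \- S P ub) \- z)).
  by apply: (sqint_ae oO (meas_wd wp) sDz) (wd_ae oO wp).
have N1 := (n2_le oO dge0 sW).1 (nY_wd i H1).
have N2 := (n2_le oO Kd0 (wz i).2).1 (nY_wd i H2).
have N1' : intO Omega (fun x => (D x - wd Omega i z x) ^+ 2) <= d ^+ 2.
  apply: le_trans N1; rewrite le_eqVlt; apply/orP; left; apply/eqP.
  apply: (eq_intO oO); [exact: measX sDz.1|exact: measX sW.1|].
  by move: (wd_ae oO wp); apply: aeO_imp => x _ ->.
apply: (@le_trans _ _ (intO Omega (fun x => 2 * ((D x - wd Omega i z x) ^+ 2 + wd Omega i z x ^+ 2)))).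
  apply: (le_intO oO sD.2); first by apply: (integZ oO); apply: (integD oO); [exact: sDz.2|exact: (wz i).2.2].
  by apply: aeO_all => x _; exact: sqr_split.
rewrite (intOZ oO); last by apply: (integD oO); [exact: sDz.2|exact: (wz i).2.2].
rewrite (intOD oO); [|exact: sDz.2|exact: (wz i).2.2].
apply: (@le_trans _ _ (2 * (d ^+ 2 + (`|K0| * d) ^+ 2))); first by rewrite ler_pM2l// lerD.
rewrite !exprMn; move: (`|K0|) (normr_ge0 K0) => k k0.
have -> : 2 ^+ 2 * (1 + k) ^+ 2 * d ^+ 2 = 2 * (d ^+ 2 + k ^+ 2 * d ^+ 2) +
  (2 + 8 * k + 2 * k ^+ 2) * d ^+ 2 by ring.
by rewrite lerDl mulr_ge0 ?sqr_ge0// !addr_ge0// !mulr_ge0// exprn_ge0.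
Qed.

End StateLipschitz.

(** Absorption: the terms in the error [d] on the right come with a power of [h],
    or, by Young's inequality, with a small constant. *)
Lemma absorb_error {R : realType} (C c1 c2 K q hh : R) :
  0 < C -> 0 < c1 -> 0 <= c2 -> 0 < K -> 0 < q -> 0 < hh ->
  exists h0 C4 : R, [/\ 0 < h0, 0 < C4 & forall h d H : R,
    0 < h < h0 -> h < hh -> 0 <= d -> 0 < H -> h ^+ 3 <= q * H ^+ 2 ->
    d ^+ 2 <= C * (H + h * Num.sqrt (c1 * ((K * d + h) ^+ 2 + (K * d + h)))
                     + h * Num.sqrt (c2 * h)) ^+ 2 ->
    d <= C4 * H].
Proof.
move=> C0 c10 c20 K0 q0 hh0.
pose a := 3 * C * c1.
have a0 : 0 < a by rewrite !mulr_gt0.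
(* [h0] makes the coefficient of [d ^ 2] coming from [h ^ 2 * (K * d) ^ 2] at most [1 / 4]. *)
pose h0 := Num.min 1 (1 / (8 * a * K ^+ 2)).
have p0 : 0 < 8 * a * K ^+ 2 by rewrite !mulr_gt0 ?exprn_gt0.
have h00 : 0 < h0 by rewrite lt_min ltr01 divr_gt0.
pose B := 3 * C + (2 * a + a ^+ 2 * K ^+ 2) * q * hh + a * q + 3 * C * c2 * q.
have B0 : 0 < B.
  have b1 : 0 < 3 * C by rewrite mulr_gt0.
  have b2 : 0 < (2 * a + a ^+ 2 * K ^+ 2) * q * hh.
    apply: mulr_gt0 => //; apply: mulr_gt0 => //; apply: addr_gt0; first exact: mulr_gt0.
    by apply: mulr_gt0; exact: exprn_gt0.
  have b3 : 0 < a * q by exact: mulr_gt0.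
  have b4 : 0 <= 3 * C * c2 * q.
    by apply: mulr_ge0; [apply: mulr_ge0 => //; exact: ltW|exact: ltW].
  by apply: ltr_wpDr => //; apply: addr_gt0 => //; exact: addr_gt0.
exists h0, (Num.sqrt (2 * B)); split => //; first by rewrite sqrtr_gt0 mulr_gt0.
move=> h d H /andP[hp hh0'] hhh d0 H0 h3 Hd.
have r0 : 0 <= K * d + h by rewrite addr_ge0 ?mulr_ge0// ltW.
have Hd' : d ^+ 2 <= 3 * C * H ^+ 2 + a * (h ^+ 2 * ((K * d + h) ^+ 2 + (K * d + h)))
    + 3 * C * c2 * h ^+ 3.
  apply: (le_trans Hd).
  set s1 := Num.sqrt _; set s2 := Num.sqrt _.
  have E1 : s1 ^+ 2 = c1 * ((K * d + h) ^+ 2 + (K * d + h)).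
    rewrite sqr_sqrtr//; apply: mulr_ge0; first exact: ltW.
    by rewrite addr_ge0 ?sqr_ge0.
  have E2 : s2 ^+ 2 = c2 * h.
    by rewrite sqr_sqrtr//; apply: mulr_ge0 => //; exact: ltW.
  have Hn : `|H + h * s1 + h * s2| <= H + h * s1 + h * s2.
    by rewrite ger0_norm// !addr_ge0 ?mulr_ge0 ?sqrtr_ge0 ?(ltW hp) ?(ltW H0).
  have := ler_wpM2l (ltW C0) (sqr3 Hn); move/le_trans; apply.
  rewrite !exprMn E1 E2 /a le_eqVlt; apply/orP; left; apply/eqP; ring.
have T1 : a * (h ^+ 2 * (K * d + h) ^+ 2) <= d ^+ 2 / 4 + 2 * a * q * hh * H ^+ 2.
  have e1 : h ^+ 2 * (8 * a * K ^+ 2) <= 1.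
    have hle : h <= 1 / (8 * a * K ^+ 2) by apply: (le_trans (ltW hh0')); rewrite ge_min lexx orbT.
    have h1 : h <= 1 by apply: (le_trans (ltW hh0')); rewrite ge_min lexx.
    move: hle; rewrite ler_pdivlMr// => hle; rewrite expr2 -mulrA.
    by apply: (le_trans (ler_wpM2l (ltW hp) hle)); rewrite mulr1.
  have e2 : h ^+ 4 <= q * hh * H ^+ 2.
    rewrite exprS; apply: (@le_trans _ _ (hh * (q * H ^+ 2))).
      by apply: ler_pM => //; [exact: ltW|rewrite exprn_ge0// ltW|exact: ltW].
    by rewrite mulrCA mulrA.
  have e3 : (K * d + h) ^+ 2 <= 2 * (K ^+ 2 * d ^+ 2) + 2 * h ^+ 2.
    by have := sqr_ge0 (K * d - h); rewrite sqrrB sqrrD exprMn; lra.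
  apply: (@le_trans _ _ (a * (h ^+ 2 * (2 * (K ^+ 2 * d ^+ 2) + 2 * h ^+ 2)))).
    by rewrite ler_pM2l// ler_pM2l ?exprn_gt0.
  have -> : a * (h ^+ 2 * (2 * (K ^+ 2 * d ^+ 2) + 2 * h ^+ 2)) =
     h ^+ 2 * (8 * a * K ^+ 2) * (d ^+ 2 / 4) + 2 * a * h ^+ 4 by field.
  apply: lerD; first by rewrite ler_piMl// divr_ge0// sqr_ge0.
  have := ler_wpM2l (ltW a0) e2; lra.
have T2 : a * (h ^+ 2 * (K * d + h)) <= d ^+ 2 / 4 + a ^+ 2 * K ^+ 2 * q * hh * H ^+ 2 + a * q * H ^+ 2.
  have e2 : h ^+ 4 <= q * hh * H ^+ 2.
    rewrite exprS; apply: (@le_trans _ _ (hh * (q * H ^+ 2))).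
      by apply: ler_pM => //; [exact: ltW|rewrite exprn_ge0// ltW|exact: ltW].
    by rewrite mulrCA mulrA.
  have -> : a * (h ^+ 2 * (K * d + h)) = a * K * h ^+ 2 * d + a * h ^+ 3 by ring.
  have e4 := ler_wpM2l (ltW a0) h3.
  have e5 := ler_wpM2l (mulr_ge0 (sqr_ge0 a) (sqr_ge0 K)) e2.
  have e6 := sqr_ge0 (d / 2 - a * K * h ^+ 2).
  have E6 : (d / 2 - a * K * h ^+ 2) ^+ 2 = d ^+ 2 / 4 - a * K * h ^+ 2 * d + a ^+ 2 * K ^+ 2 * h ^+ 4 by field.
  rewrite E6 in e6.
  have -> : a * q * H ^+ 2 = a * (q * H ^+ 2) by ring.
  have -> : a ^+ 2 * K ^+ 2 * q * hh * H ^+ 2 = a ^+ 2 * K ^+ 2 * (q * hh * H ^+ 2) by ring.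
  move: e4 e5 e6; move: (a * K * h ^+ 2 * d) (a ^+ 2 * K ^+ 2 * h ^+ 4) (a ^+ 2 * K ^+ 2 * _) (a * (q * _)) (a * h ^+ 3) (d ^+ 2 / 4) => ? ? ? ? ? ?; lra.
have T3 : 3 * C * c2 * h ^+ 3 <= 3 * C * c2 * q * H ^+ 2.
  have -> : 3 * C * c2 * q * H ^+ 2 = 3 * C * c2 * (q * H ^+ 2) by ring.
  by apply: ler_wpM2l => //; apply: mulr_ge0 => //; apply: mulr_ge0 => //; exact: ltW.
have : d ^+ 2 <= 2 * B * H ^+ 2.
  have E : 2 * B * H ^+ 2 = 2 * (3 * C * H ^+ 2 + (2 * a * q * hh * H ^+ 2) +
     (a ^+ 2 * K ^+ 2 * q * hh * H ^+ 2 + a * q * H ^+ 2) + 3 * C * c2 * q * H ^+ 2).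
    by rewrite /B; ring.
  rewrite E; move: Hd'; rewrite !mulrDr; move: T1 T2 T3.
  rewrite !mulrDr.
  move: (a * (h ^+ 2 * (K * d + h) ^+ 2)) (a * (h ^+ 2 * (K * d)) + a * (h ^+ 2 * h)) => t1 t2.
  move: (2 * a * q * hh * H ^+ 2) (a ^+ 2 * K ^+ 2 * q * hh * H ^+ 2) (a * q * H ^+ 2) (3 * C * c2 * h ^+ 3) (3 * C * c2 * q * H ^+ 2) (3 * C * H ^+ 2) (d ^+ 2) => ? ? ? ? ? ? ?; lra.
move=> H2; have S0 : 0 <= Num.sqrt (2 * B) * H by rewrite mulr_ge0 ?sqrtr_ge0// ltW.
rewrite -(ler_pXn2r (_ : (0 < 2)%N)) ?nnegrE// exprMn sqr_sqrtr//.
by rewrite mulr_ge0// ltW.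
Qed.

(** * The error estimate *)

Section DiscreteStates.
Context {R : realType} (P : problem R).
Local Notation Omega := (dom P).
Hypothesis HP : standing_assumptions P.

Let oO : open Omega := open_polygonal (sa_dom HP).
Let bO : bounded_set Omega.
Proof. by have [] := sa_dom HP. Qed.

(** The discrete states are continuous up to the boundary and converge uniformly. *)
Lemma state_continuous (Hs : set R) (Th : R -> seq (@triangle R)) (db rb : R)
    (ub : R * R -> R) (pt krho h2 Cinf : R) :
  mesh_family P Hs Th db rb -> 0 < h2 -> 0 < Cinf ->
  (forall h, Hs h -> h < h2 ->
     exists y, disc_state P (Th h) (S P ub) pt krho ub y) ->
  (forall h, Hs h -> h < h2 ->
     (noo P (S P ub \- Sh P (Th h) (S P ub) pt krho ub)%R <= (Cinf * h)%:E)%E) ->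
  {within closure Omega, continuous (crep Omega (S P ub))} /\
  aeO Omega (fun x => crep Omega (S P ub) x = S P ub x).
Proof.
move=> [_ _ Hpos H0 _] h20 C0 Hex Herr; apply: (crep_uniform oO) => e e0.
have r0 : 0 < Num.min h2 (e / Cinf) by rewrite lt_min h20 divr_gt0.
have [h [hs]] := H0 _ (nbhsx_ballx (0 : R) _ r0).
have hp := Hpos h hs.
rewrite /ball/= sub0r normrN gtr0_norm// lt_min => /andP[hh2 he].
exists (Sh P (Th h) (S P ub) pt krho ub).
  rewrite /Sh; case: xgetP => [y _ [[[cy _ _] _] _]|]; first exact: cy.
  by have [y Hy] := Hex h hs hh2 => /(_ y).
have Ch : 0 <= Cinf * h by rewrite mulr_ge0// ltW.
have := (@noo_le R P _ _ Ch).1 (Herr h hs hh2); apply: aeO_imp => x _ /le_trans; apply.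
by rewrite mulrC -ler_pdivlMr// ltW.
Qed.

End DiscreteStates.

Theorem theorem5p11 (R : realType) (P : problem R)
  (* continuous setting *)
  (HP : standing_assumptions P)
  (HS : control_to_state P)
  (ps : R) (Hps : 2 < ps) (Hreg : W2_regularity P ps)
  (* triangulations *)
  (Hs : set R) (Th : R -> seq (@triangle R)) (db rb : R)
  (HTh : mesh_family P Hs Th db rb)
  (* reference control and fixed constants *)
  (ub : R * R -> R) (Hub : Uad P ub)
  (pt h1 rho krho Crho h2 Cinf : R)
  (Hpt : 4 <= pt) (Hh1 : 0 < h1) (Hrho : 0 < rho) (Hkrho : 0 < krho)
  (Hdisc : forall h u, Hs h -> h < h1 -> L2ball P ub rho u ->
     (exists! y, disc_state P (Th h) (S P ub) pt krho u y) /\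
     let e := S P u \- Sh P (Th h) (S P ub) pt krho u in
     (n2 P e + h%:E * nW1 (dom P) 2%:E e + h%:E * noo P e
      <= (Crho * h ^+ 2)%:E)%E)
  (Hh2 : 0 < h2 < h1)
  (Hiso : forall h y, Hs h -> h < h2 ->
     Vh_ball P (Th h) (S P ub) pt krho y -> lin_iso P (Th h) y)
  (HCinf : 0 < Cinf)
  (Hinf : forall h u, Hs h -> h < h2 -> L2ball P ub rho u -> Uad P u ->
     (noo P (S P u \- Sh P (Th h) (S P ub) pt krho u)%R <= (Cinf * h)%:E)%E)
  (gam p0 p1 : R)
  (Hp0 : 2 < p0) (Hp1 : 2 < p1 < ps)
  (Hgam_p : [/\ 1 - 2 / p0 <= gam, gam < Num.min (1 / p0) (1 - 2 / p1)
             & Num.min (1 / p0) (1 - 2 / p1) < 1 / 2])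
  (Hgam : 0 < gam < 1 / 2)
  (* strict local minimum and discrete solutions *)
  (epsb : R) (Hepsb : 0 < epsb < rho)
  (Hmin : strict_local_min P ub epsb)
  (hhat : R) (Hhhat : 0 < hhat < h2)
  (ybh ubh : R -> R * R -> R)
  (Hsol : forall h, Hs h -> h < hhat ->
     disc_local_sol P (Sh P (Th h) (S P ub) pt krho) ub epsb (ybh h) (ubh h))
  (Hcvg_y : nW1 (dom P) 2%:E (ybh h \- S P ub)%R @[h --> within Hs 0^'+] --> 0%E)
  (Hcvg_u : n2 P (ubh h \- ub)%R @[h --> within Hs 0^'+] --> 0%E)
  (* choice of hhat *)
  (Hhat : exists C epsh : R, [/\ 0 < C, 0 < epsh <= epsb &
     forall h uh, Hs h -> h < hhat -> Uadh P uh -> L2ball P ub epsh uh ->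
       (n2 P (ubh h \- ub)%R ^+ 2 <=
        C%:E * (eps_h P h gam (S P ub) (ubh h)
                  (Sh P (Th h) (S P ub) pt krho (ubh h)) ^+ 2
                + n2 P (ub \- uh)%R ^+ 2 + (dj P ub (uh \- ub)%R)%:E))%E])
  (* structure of the level set *)
  (Hlevel : level_set_condition P (S P ub))
  (* first- and second-order conditions *)
  (Hopt : exists phi : R * R -> R,
     [/\ W10 (dom P) (pbar P)%:E phi /\ W1 (dom P) +oo%E phi,
         adjoint_eq P (S P ub) phi,
         (forall u, Uad P u ->
            0 <= intO (dom P) (fun x => (phi x + nu P * ub x) * (u x - ub x)))
       & forall v, crit_cone P ub phi v -> ~ aeO (dom P) (fun x => v x = 0) ->
            0 < Q P ub (S P ub) phi v]) :
  let kappa h := Cinf * h + fine (noo P (S P (ubh h) \- S P ub)%R) in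
  let bound h :=
    ((h `^ (1 + gam))%:E
     + (Num.sqrt (sigma0 P))%:E
       * (nL (dom P) 1 (Sigma P (kappa h) (S P ub)) `^ (1 / 2))
       * (h `^ (3 / 2))%:E)%E in
  exists C C' : R, [/\ 0 < C, 0 < C' & forall h, Hs h -> h < hhat ->
    (n2 P (ubh h \- ub)%R <= C%:E * bound h)%E /\
    (C%:E * bound h <= C'%:E * (h `^ (1 + gam))%:E)%E].
Proof.
move=> kappa bound.
have oO := open_polygonal (sa_dom HP).
have bO : bounded_set (dom P) by have [] := sa_dom HP.
have [g0 g2] := andP Hgam.
have [h20 h21] := andP Hh2.
have [hh0 hhh2] := andP Hhhat.
have [eb0 ebr] := andP Hepsb.
have [_ _ Hpos _ _] := HTh.
have Lub : L2 P ub := Uad_L2 HP Hub.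
have zsub (u : R * R -> R) : u \- u = cst 0 by apply/funext => x; rewrite /= subrr.
have n20 : n2 P (cst 0) = 0%E by rewrite /n2 /nL -[RHS](@Lnorm0 _ (plane R) R (@leb2 R) 2%:E)//; congr Lnorm; apply/funext => x; rewrite /= patchE; case: ifP.
have ballub r : 0 <= r -> L2ball P ub r ub.
  by move=> r0; split => //; rewrite zsub n20 lee_fin.
have [CE CE0 HCE] := state_energy HP.
have wsb := cs_sol HS Lub; have [Hyb yboo _] := wsb.
have HEb := HCE _ _ Hub wsb.
have [Yc Yy] : {within closure (dom P), continuous (crep (dom P) (S P ub))} /\
    aeO (dom P) (fun x => crep (dom P) (S P ub) x = S P ub x).
  apply: (@state_continuous _ _ HP _ _ _ _ ub pt krho _ _ HTh h20 HCinf) => h hs hh.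
    have [[y [Hy _]] _] := Hdisc h ub hs (lt_trans hh h21) (ballub _ (ltW Hrho)).
    by exists y.
  by apply: Hinf => //; exact: ballub (ltW Hrho).
have [CS CS0 HCS] := Sigma_bounded HP CE0 Hyb HEb Yc Yy Hlevel.
have [Mb Mb0 HMb] := noo_bounded yboo.
have [K [d0 [K0 d00 HK]]] := state_lipschitz HP HS Lub.
pose M := Mb + K * d0.
have [CZ CZ0 HCZ] := Znorm_estimate HP M CE0 Hyb HEb.
have s00 : 0 <= sigma0 P by exact: normr_ge0.
pose CV := 4 * sigma0 P ^+ 2 * CE * Cinf.
have CV0 : 0 <= CV by rewrite !mulr_ge0 ?sqr_ge0// ltW.
have [C [eh [C0 /andP[eh0 _] HC]]] := Hhat.
pose q := hhat `^ (1 - 2 * gam).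
have q0 : 0 < q by rewrite powR_gt0.
have [h0 [C4 [h00 C40 Habs]]] := absorb_error C0 CZ0 CV0 K0 q0 hh0.
have [h3 h30 Hh3] : exists2 h3 : R, 0 < h3 & forall h, Hs h -> h < h3 ->
    (n2 P (ubh h \- ub)%R <= d0%:E)%E.
  have : \forall h \near within Hs 0^'+, (n2 P (ubh h \- ub)%R <= d0%:E)%E.
    have A : nbhs (0 : R) (fun r : R => (r%:E <= d0%:E)%E).
      apply/nbhs_ballP; exists d0 => // r; rewrite /ball/= sub0r normrN lee_fin => rd.
      by apply: (le_trans (ler_norm r)); exact: ltW.
    exact: (Hcvg_u [set x | (x <= d0%:E)%E] A).
  move=> /nbhs_ballP[e /= ep He]; exists e => // h hs hlt.
  have hp := Hpos h hs.
  by apply: He => //; rewrite /ball/= sub0r normrN gtr0_norm.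
pose hm := Num.min h0 h3.
have hm0 : 0 < hm by rewrite lt_min h00.
pose H h := h `^ (1 + gam).
have Hgt h : 0 < h -> 0 < H h by move=> hp; rewrite powR_gt0.
(* Mesh sizes above [hm] need no estimate, since the error is at most [epsb]. *)
pose C1 := Num.max C4 (epsb / H hm).
have C10 : 0 < C1 by rewrite lt_max C40.
have main h : Hs h -> h < hhat -> (n2 P (ubh h \- ub)%R <= (C1 * H h)%:E)%E.
  move=> hs hh; have hp := Hpos h hs.
  have [[Huad _] [Luh Hball] Eyh _] := Hsol h hs hh.
  have sv : sqint (dom P) (ubh h \- ub).
    by apply/(Lp2_sqint oO); exact: (L2B HP Luh Lub).
  have [d dge0 [Ed _]] := n2_fin oO sv.
  have deb : d <= epsb by move: Hball; rewrite /n2 Ed lee_fin.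
  rewrite /n2 Ed lee_fin.
  have [hhm|hmh] := leP hm h.
    apply: (le_trans deb); apply: (@le_trans _ _ (epsb / H hm * H h)).
      rewrite mulrAC ler_pdivlMr ?Hgt// ler_pM2l//.
      by rewrite ge0_ler_powR ?nnegrE ?addr_ge0// ltW.
    by rewrite ler_pM2r ?Hgt// le_max lexx orbT.
  have [hlt0 hlt3] : h < h0 /\ h < h3 by move: hmh; rewrite lt_min => /andP[].
  have dd0 : d <= d0 by have := Hh3 h hs hlt3; rewrite /n2 Ed lee_fin.
  apply: (@le_trans _ _ (C4 * H h)); last first.
    by rewrite ler_pM2r ?Hgt// le_max lexx.
  apply: (Habs h d (H h)) => //; [by rewrite hp|exact: Hgt| |].
    have -> : h ^+ 3 = h `^ (1 - 2 * gam) * H h ^+ 2.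
      rewrite -!powR_mulrn ?powR_ge0 ?(ltW hp)// /H -powRrM -powRD; last first.
        by rewrite (gt_eqF hp) implybT.
      by congr (_ `^ _); ring.
    rewrite ler_pM2r ?exprn_gt0 ?Hgt//.
    by rewrite ge0_ler_powR ?nnegrE ?(ltW hp) ?(ltW hh0) ?(ltW hh)//; lra.
  have wsu := cs_sol HS Luh; have [Hy yoo _] := wsu.
  have HE := HCE _ _ Huad wsu.
  set r := K * d + h.
  have r0 : 0 < r by rewrite ltr_wpDl// mulr_ge0// ltW.
  have Kdr : K * d <= r by rewrite lerDl ltW.
  have Kd0 : 0 <= K * d by rewrite mulr_ge0// ltW.
  have ndd : (n2 P (ubh h \- ub)%R <= d%:E)%E by rewrite /n2 Ed.
  have dd00 : 0 <= d <= d0 by apply/andP.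
  have [Hoo Hw] := HK (ubh h) d Luh dd00 ndd.
  have HMy : aeO (dom P) (fun x => `|S P (ubh h) x| <= M).
    have := aeO_and Hoo HMb; apply: aeO_imp => x _ [E1 E2].
    have -> : S P (ubh h) x = S P ub x + (S P (ubh h) x - S P ub x) by ring.
    apply: (le_trans (ler_normD _ _)); apply: lerD => //.
    by apply: (le_trans E1); rewrite ler_pM2l.
  have HMb' : aeO (dom P) (fun x => `|S P ub x| <= M).
    move: HMb; apply: aeO_imp => x _ /le_trans; apply.
    by rewrite /M lerDl mulr_ge0// ltW.
  have Hoor : aeO (dom P) (fun x => `|S P (ubh h) x - S P ub x| <= r).
    by move: Hoo; apply: aeO_imp => x _ /le_trans; apply.
  have Hwr i : intO (dom P) (fun x => (wd (dom P) i (S P (ubh h)) x - wd (dom P) i (S P ub) x) ^+ 2) <= r ^+ 2.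
    by apply: (le_trans (Hw i)); rewrite lerXn2r// nnegrE ltW.
  have HZ := HCZ _ r Hy HE HMy HMb' r0 Hoor Hwr.
  pose rh := fine (noo P (Sh P (Th h) (S P ub) pt krho (ubh h) \- S P (ubh h))%R).
  have Ch0 : 0 < Cinf * h by rewrite mulr_gt0.
  have rhC : rh <= Cinf * h.
    have hh2 := lt_trans hh hhh2.
    have bu : L2ball P ub rho (ubh h).
      by split => //; apply: (le_trans Hball); rewrite lee_fin ltW.
    have := (@noo_le R P _ _ (ltW Ch0)).1 (Hinf h _ hs hh2 bu Huad).
    move=> Hn; have : (noo P (Sh P (Th h) (S P ub) pt krho (ubh h) \- S P (ubh h))%R <= (Cinf * h)%:E)%E.
      by apply: (@noo_le R P _ _ (ltW Ch0)).2; move: Hn; apply: aeO_imp => x _; rewrite /= distrC.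
    rewrite /rh; have := nL_ge0 (dom P) +oo%E (Sh P (Th h) (S P ub) pt krho (ubh h) \- S P (ubh h))%R.
    by rewrite /noo; case: (nL _ _ _) => [a| |]//; rewrite !lee_fin.
  have HV := V_estimate HP Hy HE Ch0 rhC.
  have Heps : (eps_h P h gam (S P ub) (ubh h) (Sh P (Th h) (S P ub) pt krho (ubh h)) <=
      (H h + h * Num.sqrt (CZ * (r ^+ 2 + r)) + h * Num.sqrt (CV * h))%:E)%E.
    rewrite /eps_h !EFinD; apply: leeD; first apply: leeD => //.
      by rewrite EFinM lee_pmul2l.
    rewrite EFinM lee_pmul2l//; apply: (le_trans HV).
    by rewrite lee_fin /CV -!mulrA.
  (* With the reference control as competitor only the consistency error remains. *)
  have Hub' : Uadh P ub by split => //; exact: Hub.1.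
  have := HC h ub hs hh Hub' (ballub _ (ltW eh0)).
  rewrite zsub n20 /n2 Ed /dj (_ : intO _ _ = 0); last first.
    rewrite (_ : (fun x => _) = cst 0); first by rewrite /intO /Rintegral integral0.
    by apply/funext => x; rewrite /= mulr0.
  have Z2 : (0 ^+ 2 = 0 :> \bar R)%E by rewrite expe2 mule0.
  rewrite Z2 !adde0 !expe2 => Hd2.
  set X := H h + _ + _ in Heps *.
  rewrite -lee_fin expr2 EFinM; apply: (le_trans Hd2).
  rewrite EFinM lee_pmul2l// expr2 EFinM.
  have e0 : (0 <= eps_h P h gam (S P ub) (ubh h) (Sh P (Th h) (S P ub) pt krho (ubh h)))%E.
    rewrite /eps_h !adde_ge0//.
    - by rewrite lee_fin ltW// Hgt.
    - by rewrite mule_ge0 ?nL_ge0// lee_fin ltW.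
    - by rewrite mule_ge0 ?nL_ge0// lee_fin ltW.
  exact: lee_pmul.
pose W := Num.sqrt (sigma0 P) * CS `^ (1 / 2).
have W0 : 0 <= W by rewrite mulr_ge0 ?sqrtr_ge0 ?powR_ge0.
exists C1, (C1 * (1 + W * hhat `^ (1 / 2 - gam))); split => //.
  by rewrite mulr_gt0// ltr_wpDr// mulr_ge0 ?powR_ge0.
move=> h hs hh; have hp := Hpos h hs.
have kp : 0 < kappa h.
  by rewrite /kappa ltr_wpDr ?mulr_gt0// fine_ge0// nL_ge0.
have SS := HCS _ kp.
have S0 : (0 <= nL (dom P) 1 (Sigma P (kappa h) (S P ub)))%E by exact: nL_ge0.
have q1 : (nL (dom P) 1 (Sigma P (kappa h) (S P ub)) `^ (1 / 2) <= (CS `^ (1 / 2))%:E)%E.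
  rewrite -poweR_EFin; apply: gt0_ler_poweR => //.
  - by rewrite in_itv/= S0 leey.
  - by rewrite in_itv/= leey lee_fin ltW.
split.
  apply: (le_trans (main h hs hh)); rewrite EFinM lee_pmul2l//.
  rewrite /bound leeDl// !mule_ge0 ?poweR_ge0// lee_fin ?sqrtr_ge0 ?powR_ge0//.
rewrite EFinM -muleA lee_pmul2l// /bound.
apply: (@le_trans _ _ ((H h)%:E + (Num.sqrt (sigma0 P))%:E * (CS `^ (1 / 2))%:E * (h `^ (3 / 2))%:E)%E).
  rewrite leeD2l//; apply: lee_wpmul2r; first by rewrite lee_fin powR_ge0.
  by apply: lee_wpmul2l => //; rewrite lee_fin sqrtr_ge0.
rewrite -!EFinM -EFinD lee_fin -/W.
have -> : (1 + W * hhat `^ (1 / 2 - gam)) * h `^ (1 + gam) =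
    H h + W * (hhat `^ (1 / 2 - gam) * h `^ (1 + gam)) by rewrite /H; ring.
rewrite lerD2l ler_wpM2l//.
have -> : h `^ (3 / 2) = h `^ (1 / 2 - gam) * h `^ (1 + gam).
  rewrite -powRD; last by rewrite (gt_eqF hp) implybT.
  by congr (_ `^ _); field.
rewrite ler_wpM2r ?powR_ge0// ge0_ler_powR ?nnegrE ?(ltW hp) ?(ltW hh0) ?(ltW hh)//.
lra.
Qed.
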